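(* Let $\bar B=(B_0,B_1)$ be a Banach pair, let $\theta\in(0,1)$ and $x\in B_0\cap B_1$. Let $\mathcal{J}_0(\bar B)$ be the space of finitely supported $B_0\cap B_1$-valued sequences indexed by $\mathbb{Z}$. All norms are as defined in the context. A Stafney-type lemma holds for each of the following methods. (1) (Annulus variant of Calderón's complex method.) $$\|x\|_{[\bar B]_{\theta,\mathbb{A}}}=\inf\Big\{\max_{j=0,1}\big\|\{e^{jn}b_n\}_{n\in\mathbb{Z}}\big\|_{FC(B_j)}:\ x=\sum_{n\in\mathbb{Z}}e^{\theta n}b_n,\ \{b_n\}_{n\in\mathbb{Z}}\in\mathcal{J}_0(\bar B)\Big\}.$$ In other words, in the definition of this norm one may restrict to Laurent polynomials $f(z)=\sum_n z^n b_n$ with coefficients in $B_0\cap B_1$. (2) (Lions–Peetre real method.) For every $p\in[1,\infty)$: (a) $$\|x\|_{(B_0,B_1)_{\theta,p}}=\inf\Big\{\max_{j=0,1}\big\|\{e^{(j-\theta)n}c_n\}_{n\in\mathbb{Z}}\big\|_{\ell^p(B_j)}:\ x=\sum_{n\in\mathbb{Z}}c_n,\ \{c_n\}_{n\in\mathbb{Z}}\in\mathcal{J}_0(\bar B)\Big\};$$ (b) $$\|x\|_{J,e}=\inf\Big\{\big\|\{e^{-\theta n}J(e^n,c_n;B_0,B_1)\}_{n\in\mathbb{Z}}\big\|_{\ell^p}:\ x=\sum_{n\in\mathbb{Z}}c_n,\ \{c_n\}_{n\in\mathbb{Z}}\in\mathcal{J}_0(\bar B)\Big\};$$ (c) $$\|x\|_{J,2}=\inf\Big\{\big\|\{2^{-\theta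 n}J(2^n,c_n;B_0,B_1)\}_{n\in\mathbb{Z}}\big\|_{\ell^p}:\ x=\sum_{n\in\mathbb{Z}}c_n,\ \{c_n\}_{n\in\mathbb{Z}}\in\mathcal{J}_0(\bar B)\Big\}.$$ (3) (Peetre ''$\pm$'' method.) $$\|x\|_{\langle B_0,B_1\rangle_\theta}=\inf\Big\{\max_{j=0,1}\big\|\{2^{(j-\theta)n}c_n\}_{n\in\mathbb{Z}}\big\|_{UC(B_j)}:\ x=\sum_{n\in\mathbb{Z}}c_n,\ \{c_n\}_{n\in\mathbb{Z}}\in\mathcal{J}_0(\bar B)\Big\}.$$ Moreover, the right-shift operator $\{b_n\}_{n\in\mathbb{Z}}\mapsto\{b_{n-1}\}_{n\in\mathbb{Z}}$ is an isometry on each of the sequence spaces $FC(B_j)$, $\ell^p(B_j)$ and $UC(B_j)$ involved, $j=0,1$.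
   Context: Banach spaces are over $\mathbb{C}$. A Banach pair $\bar B=(B_0,B_1)$ consists of two Banach spaces continuously embedded in some Hausdorff topological vector space. Sequence spaces, for a Banach space $B$ (all sequences indexed by $\mathbb{Z}$): - $\ell^p(B)$: $B$-valued sequences with $\{\|b_n\|_B\}\in\ell^p(\mathbb{Z})$, with norm $\|\{\|b_n\|_B\}\|_{\ell^p}$. - $FC(B)$: sequences of Fourier coefficients $b_n=\frac1{2\pi}\int_0^{2\pi}e^{-int}f(e^{it})\,dt$ of continuous functions $f:\mathbb{T}\to B$, with norm $\sup_{t}\|f(e^{it})\|_B$. - $UC(B)$: sequences such that $\sum_n\lambda_nb_n$ converges in $B$ for all complex $\{\lambda_n\}$ with $|\lambda_n|\le1$, with norm $\sup\|\sum_{n\in F}\lambda_nb_n\|_B$ over all finite $F\subset\mathbb{Z}$ and all such $\{\lambda_n\}$. For $t>0$ and $y\in B_0\cap B_1$, $J(t,y;B_0,B_1)=\max_{j=0,1}t^j\|y\|_{B_j}$. Annulus method: let $\mathbb{A}=\{z\in\mathbb{C}:1\le|z|\le e\}$. $\mathcal{F}_{\mathbb{A}}(\bar B)$ is the space of continuous $f:\mathbb{A}\to B_0+B_1$, analytic in the interior of $\mathbb{A}$, whose restriction to the circle $e^j\mathbb{T}$ is a continuous map into $B_j$ for $j=0,1$, with norm $\sup\{\|f(e^{j+it})\|_{B_j}:t\in[0,2\pi),\ j=0,1\}$. $[\bar B]_{\theta,\mathbb{A}}$ is the space of all $b=f(e^\theta)$ with $f\in\mathcal{F}_{\mathbb{A}}(\bar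 B)$, with norm the infimum of $\|f\|_{\mathcal{F}_{\mathbb{A}}(\bar B)}$ over such $f$. It coincides isometrically with the space of all $b=\sum_ne^{\theta n}b_n$ (convergence in $B_0+B_1$), where $b_n\in B_0\cap B_1$ and $\{e^{jn}b_n\}\in FC(B_j)$ for $j=0,1$, normed by $\inf\max_{j=0,1}\|\{e^{jn}b_n\}\|_{FC(B_j)}$. Real method: $(B_0,B_1)_{\theta,p}$ is the space of all $x=\sum_{n}e^{\theta n}b_n$ (convergence in $B_0+B_1$), where $b_n\in B_0\cap B_1$ and $\{e^{jn}b_n\}\in\ell^p(B_j)$ for $j=0,1$, with norm $\|x\|_{(B_0,B_1)_{\theta,p}}=\inf\max_{j=0,1}\|\{e^{jn}b_n\}\|_{\ell^p(B_j)}$ over all such representations (equivalently, with $c_n=e^{\theta n}b_n$, the infimum of $\max_j\|\{e^{(j-\theta)n}c_n\}\|_{\ell^p(B_j)}$). The two $J$-functional norms for this method are: - $\|x\|_{J,e}=\inf\|\{e^{-\theta n}J(e^n,c_n;B_0,B_1)\}\|_{\ell^p}$, over all representations $x=\sum_nc_n$ (convergence in $B_0+B_1$) with $c_n\in B_0\cap B_1$ and $\{e^{jn}c_n\}\in\ell^p(B_j)$ for $j=0,1$; - $\|x\|_{J,2}=\inf\|\{2^{-\theta n}J(2^n,c_n;B_0,B_1)\}\|_{\ell^p}$, over all representations $x=\sum_nc_n$ (convergence in $B_0+B_1$) with $c_n\in B_0\cap B_1$ and $\{2^{jn}c_n\}\in\ell^p(B_j)$ for $j=0,1$. Here the $\ell^p$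 norm is taken to be $+\infty$ for sequences not in $\ell^p$. Peetre's ''$\pm$'' method: $\langle B_0,B_1\rangle_\theta$ is the space of all $x=\sum_nc_n$ (convergence in $B_0+B_1$), where $c_n\in B_0\cap B_1$ and $\{2^{(j-\theta)n}c_n\}\in UC(B_j)$ for $j=0,1$, with norm $\inf\max_{j=0,1}\|\{2^{(j-\theta)n}c_n\}\|_{UC(B_j)}$ over all such representations. *)

(* Defs.v *)
From Stdlib Require Import Reals Lra ZArith List ProofIrrelevance.
From Coquelicot Require Import Coquelicot Iter.

Open Scope R_scope.

(** [restr_R V] is [V] with scalars restricted to the reals; Coquelicot's
    Riemann integral [RInt] is only available for real spaces. *)
Section RestrictionOfScalars.

Variable V : CompleteNormedModule C_AbsRing.

Lemma restr_R_scal_assoc (x y : R) (u : V) :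
  scal (RtoC x) (scal (RtoC y) u) = scal (RtoC (mult x y)) u.
Proof.
  rewrite scal_assoc. change (mult x y) with (x * y). now rewrite RtoC_mult.
Qed.

Lemma restr_R_scal_distr_r (x y : R) (u : V) :
  scal (RtoC (plus x y)) u = plus (scal (RtoC x) u) (scal (RtoC y) u).
Proof.
  rewrite <- scal_distr_r. change (plus x y) with (x + y). now rewrite RtoC_plus.
Qed.

Definition restr_R_ModuleSpace_mixin :
  ModuleSpace.mixin_of R_Ring (CompleteNormedModule.AbelianGroup C_AbsRing V) :=
  ModuleSpace.Mixin R_Ring (CompleteNormedModule.AbelianGroup C_AbsRing V)
    (fun r u => scal (RtoC r) u)
    restr_R_scal_assoc (fun u : V => scal_one u)
    (fun x u v => scal_distr_l (RtoC x) u v)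
    restr_R_scal_distr_r.

Definition restr_R_ModuleSpace_class : ModuleSpace.class_of R_Ring V :=
  ModuleSpace.Class R_Ring V
    (ModuleSpace.base C_Ring V
      (NormedModuleAux.base C_AbsRing V (NormedModule.base C_AbsRing V
        (CompleteNormedModule.base C_AbsRing V (CompleteNormedModule.class C_AbsRing V)))))
    restr_R_ModuleSpace_mixin.

Definition restr_R_Aux_class : NormedModuleAux.class_of R_AbsRing V :=
  NormedModuleAux.Class R_AbsRing V restr_R_ModuleSpace_class
    (NormedModuleAux.mixin C_AbsRing V (NormedModule.base C_AbsRing V
        (CompleteNormedModule.base C_AbsRing V (CompleteNormedModule.class C_AbsRing V)))).

Lemma restr_R_norm_scal (l : R) (x : V) :
  norm (scal (RtoC l) x) <= abs l * norm x.
Proof.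
  eapply Rle_trans; [apply (norm_scal (K := C_AbsRing) (RtoC l) x)|].
  apply Req_le. f_equal. apply Cmod_R.
Qed.

Definition restr_R_NormedModule_mixin :
  NormedModule.mixin_of R_AbsRing
    (NormedModuleAux.Pack R_AbsRing V restr_R_Aux_class V) :=
  NormedModule.Mixin R_AbsRing
    (NormedModuleAux.Pack R_AbsRing V restr_R_Aux_class V)
    (@norm C_AbsRing V) (@norm_factor C_AbsRing V)
    (fun x y : V => norm_triangle x y)
    restr_R_norm_scal
    (fun (x y : V) eps => norm_compat1 x y eps)
    (fun (x y : V) eps => norm_compat2 x y eps)
    (fun x : V => norm_eq_zero x).

Definition restr_R : CompleteNormedModule R_AbsRing :=
  CompleteNormedModule.Pack R_AbsRing V
    (CompleteNormedModule.Class R_AbsRing V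
       (NormedModule.Class R_AbsRing V restr_R_Aux_class restr_R_NormedModule_mixin)
       (CompleteNormedModule.mixin C_AbsRing V (CompleteNormedModule.class C_AbsRing V)))
    V.

End RestrictionOfScalars.

(** * Banach pairs *)

Record HausdorffTVS := {
  tvs_sort :> ModuleSpace C_Ring;
  tvs_open : (tvs_sort -> Prop) -> Prop;
  tvs_open_true : tvs_open (fun _ => True);
  tvs_open_and : forall U W, tvs_open U -> tvs_open W ->
    tvs_open (fun x => U x /\ W x);
  tvs_open_union : forall Us : (tvs_sort -> Prop) -> Prop,
    (forall U, Us U -> tvs_open U) -> tvs_open (fun x => exists U, Us U /\ U x);
  tvs_plus_continuous : forall x y W, tvs_open W -> W (plus x y) ->
    exists U U', tvs_open U /\ U x /\ tvs_open U' /\ U' y /\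
      forall u u', U u -> U' u' -> W (plus u u');
  tvs_scal_continuous : forall (a : C) x W, tvs_open W -> W (scal a x) ->
    exists (A : C -> Prop) U, locally a A /\ tvs_open U /\ U x /\
      forall b u, A b -> U u -> W (scal b u);
  tvs_hausdorff : forall x y, x <> y ->
    exists U U', tvs_open U /\ U x /\ tvs_open U' /\ U' y /\
      forall z, U z -> U' z -> False
}.

(** A pair is indexed by [bool]: [B false] is B_0 and [B true] is B_1. *)
Record BanachPair := {
  bp_space :> bool -> CompleteNormedModule C_AbsRing;
  bp_amb : HausdorffTVS;
  bp_emb : forall j, bp_space j -> bp_amb;
  bp_emb_plus : forall j x y, bp_emb j (plus x y) = plus (bp_emb j x) (bp_emb j y);
  bp_emb_scal : forall j (a : C) x, bp_emb j (scal a x) = scal a (bp_emb j x);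
  bp_emb_inj : forall j x y, bp_emb j x = bp_emb j y -> x = y;
  bp_emb_continuous : forall j U, tvs_open bp_amb U ->
    open (fun x : bp_space j => U (bp_emb j x))
}.

Arguments bp_emb {b} j x.

(** The number [j] in exponents such as e^(jn). *)
Definition idx (j : bool) : R := if j then 1 else 0.

(** ** The intersection of B_0 and B_1

    A vector of the intersection is given together with its two incarnations
    [x false] in B_0 and [x true] in B_1, which agree in the ambient space. *)

Record cap (B : BanachPair) := {
  cap_at :> forall j, B j;
  cap_eq : bp_emb false (cap_at false) = bp_emb true (cap_at true)
}.

Arguments cap_at {B} c j.
Arguments cap_eq {B} c.

(** ** The sum of B_0 and B_1

    The subspace of the ambient space spanned by B_0 and B_1, normed by
    inf (|b_0| + |b_1|) over all decompositions x = b_0 + b_1. *)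

Section SumSpace.

Variable B : BanachPair.

Definition decomposes (x : bp_amb B) (b : forall j, B j) : Prop :=
  x = plus (bp_emb false (b false)) (bp_emb true (b true)).

Record sumsp := {
  sum_val : bp_amb B;
  sum_dec : exists b, decomposes sum_val b
}.

Lemma sumsp_eq (x y : sumsp) : sum_val x = sum_val y -> x = y.
Proof.
  destruct x as [x hx], y as [y hy]; simpl; intros <-.
  now rewrite (proof_irrelevance _ hx hy).
Qed.

Lemma bp_norm_triangle j (x y : B j) : norm (plus x y) <= norm x + norm y.
Proof. exact (norm_triangle x y). Qed.

Lemma bp_norm_scal j (a : C) (x : B j) : norm (scal a x) <= Cmod a * norm x.
Proof. exact (norm_scal (K := C_AbsRing) a x). Qed.

Lemma bp_norm_zero j : norm (zero : B j) = 0.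
Proof. exact (norm_zero (V := B j)). Qed.

Lemma bp_emb_zero j : bp_emb j (zero : B j) = zero.
Proof.
  transitivity (bp_emb j (scal (@zero C_Ring) (zero : B j))).
  - f_equal. symmetry. apply (@scal_zero_l C_Ring (B j)).
  - rewrite bp_emb_scal. apply (@scal_zero_l C_Ring (bp_amb B)).
Qed.

Lemma decomposes_plus x y b c : decomposes x b -> decomposes y c ->
  decomposes (plus x y) (fun j => plus (b j) (c j)).
Proof.
  unfold decomposes; intros -> ->. rewrite !bp_emb_plus.
  rewrite <- !plus_assoc. f_equal. rewrite !plus_assoc. f_equal. apply plus_comm.
Qed.

Lemma decomposes_scal (a : C) x b : decomposes x b ->
  decomposes (scal a x) (fun j => scal a (b j)).
Proof.
  unfold decomposes; intros ->. now rewrite !bp_emb_scal, scal_distr_l.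
Qed.

Lemma decomposes_zero : decomposes zero (fun _ => zero).
Proof.
  unfold decomposes. now rewrite !bp_emb_zero, plus_zero_l.
Qed.

Definition sumsp_zero : sumsp :=
  {| sum_val := zero; sum_dec := ex_intro _ _ decomposes_zero |}.

Lemma sumsp_plus_dec (x y : sumsp) :
  exists b, decomposes (plus (sum_val x) (sum_val y)) b.
Proof.
  destruct (sum_dec x) as [b hb], (sum_dec y) as [c hc].
  eexists; apply (decomposes_plus _ _ _ _ hb hc).
Qed.

Definition sumsp_plus (x y : sumsp) : sumsp :=
  {| sum_val := plus (sum_val x) (sum_val y); sum_dec := sumsp_plus_dec x y |}.

Lemma sumsp_scal_dec (a : C) (x : sumsp) :
  exists b, decomposes (scal a (sum_val x)) b.
Proof.
  destruct (sum_dec x) as [b hb].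
  eexists; apply (decomposes_scal a _ _ hb).
Qed.

Definition sumsp_scal (a : C) (x : sumsp) : sumsp :=
  {| sum_val := scal a (sum_val x); sum_dec := sumsp_scal_dec a x |}.

Definition sumsp_opp (x : sumsp) : sumsp := sumsp_scal (opp (one : C)) x.

Lemma sumsp_plus_comm x y : sumsp_plus x y = sumsp_plus y x.
Proof. apply sumsp_eq, plus_comm. Qed.

Lemma sumsp_plus_assoc x y z :
  sumsp_plus x (sumsp_plus y z) = sumsp_plus (sumsp_plus x y) z.
Proof. apply sumsp_eq, plus_assoc. Qed.

Lemma sumsp_plus_zero_r x : sumsp_plus x sumsp_zero = x.
Proof. apply sumsp_eq, plus_zero_r. Qed.

Lemma sumsp_plus_opp_r x : sumsp_plus x (sumsp_opp x) = sumsp_zero.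
Proof.
  apply sumsp_eq; simpl.
  rewrite (@scal_opp_one C_Ring (bp_amb B)).
  apply (@plus_opp_r (ModuleSpace.AbelianGroup _ (bp_amb B))).
Qed.

Definition sumsp_AbelianMonoid_mixin :=
  AbelianMonoid.Mixin sumsp sumsp_plus sumsp_zero
    sumsp_plus_comm sumsp_plus_assoc sumsp_plus_zero_r.

Canonical sumsp_AbelianMonoid :=
  AbelianMonoid.Pack sumsp sumsp_AbelianMonoid_mixin sumsp.

Definition sumsp_AbelianGroup_mixin :=
  AbelianGroup.Mixin sumsp_AbelianMonoid sumsp_opp sumsp_plus_opp_r.

Canonical sumsp_AbelianGroup :=
  AbelianGroup.Pack sumsp
    (AbelianGroup.Class sumsp sumsp_AbelianMonoid_mixin sumsp_AbelianGroup_mixin) sumsp.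

Lemma sumsp_scal_assoc (a b : C) u :
  sumsp_scal a (sumsp_scal b u) = sumsp_scal (mult a b) u.
Proof. apply sumsp_eq, (@scal_assoc C_Ring (bp_amb B)). Qed.

Lemma sumsp_scal_one u : sumsp_scal (one : C) u = u.
Proof. apply sumsp_eq, (@scal_one C_Ring (bp_amb B)). Qed.

Lemma sumsp_scal_distr_l (a : C) (u v : sumsp) :
  sumsp_scal a (plus u v) = plus (sumsp_scal a u) (sumsp_scal a v).
Proof. apply sumsp_eq, (@scal_distr_l C_Ring (bp_amb B)). Qed.

Lemma sumsp_scal_distr_r (a b : C) (u : sumsp) :
  sumsp_scal (plus a b) u = plus (sumsp_scal a u) (sumsp_scal b u).
Proof. apply sumsp_eq, (@scal_distr_r C_Ring (bp_amb B)). Qed.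

Definition sumsp_ModuleSpace_mixin :=
  ModuleSpace.Mixin C_Ring sumsp_AbelianGroup sumsp_scal
    sumsp_scal_assoc sumsp_scal_one sumsp_scal_distr_l sumsp_scal_distr_r.

Canonical sumsp_ModuleSpace :=
  ModuleSpace.Pack C_Ring sumsp
    (ModuleSpace.Class C_Ring sumsp _ sumsp_ModuleSpace_mixin) sumsp.

Definition sumsp_norm_set (x : sumsp) (r : R) : Prop :=
  exists b, decomposes (sum_val x) b /\ r = norm (b false) + norm (b true).

Definition sumsp_norm (x : sumsp) : R := real (Glb_Rbar (sumsp_norm_set x)).

Lemma sumsp_norm_glb x : is_glb_Rbar (sumsp_norm_set x) (sumsp_norm x).
Proof.
  unfold sumsp_norm. pose proof (Glb_Rbar_correct (sumsp_norm_set x)) as h.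
  destruct (sum_dec x) as [b hb].
  destruct (Glb_Rbar (sumsp_norm_set x)) as [l| |]; simpl; trivial; exfalso.
  - exact (proj1 h _ (ex_intro _ b (conj hb eq_refl))).
  - apply (proj2 h (Finite 0)). intros r [c [_ ->]]. simpl.
    pose proof (norm_ge_0 (c false)). pose proof (norm_ge_0 (c true)). lra.
Qed.

Lemma sumsp_norm_le x b : decomposes (sum_val x) b ->
  sumsp_norm x <= norm (b false) + norm (b true).
Proof.
  intros hb. apply (proj1 (sumsp_norm_glb x)). now exists b.
Qed.

Lemma sumsp_norm_approx x e : sumsp_norm x < e ->
  exists b, decomposes (sum_val x) b /\ norm (b false) + norm (b true) < e.
Proof.
  intros he. apply Classical_Prop.NNPP; intros hn.
  apply (Rlt_not_le _ _ he).
  apply (proj2 (sumsp_norm_glb x) (Finite e)).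
  intros r [b [hb ->]]. simpl. apply Rnot_lt_le. intros h. apply hn. now exists b.
Qed.

Lemma sumsp_norm_ge_0 x : 0 <= sumsp_norm x.
Proof.
  apply (proj2 (sumsp_norm_glb x) (Finite 0)). intros r [c [_ ->]]. simpl.
  pose proof (norm_ge_0 (c false)). pose proof (norm_ge_0 (c true)). lra.
Qed.

Lemma sumsp_norm_triangle x y :
  sumsp_norm (sumsp_plus x y) <= sumsp_norm x + sumsp_norm y.
Proof.
  apply le_epsilon; intros e he.
  destruct (sumsp_norm_approx x (sumsp_norm x + e / 2)) as [b [hb hb']]; [lra|].
  destruct (sumsp_norm_approx y (sumsp_norm y + e / 2)) as [c [hc hc']]; [lra|].
  eapply Rle_trans.
  - apply sumsp_norm_le. apply (decomposes_plus _ _ _ _ hb hc).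
  - eapply Rle_trans; [apply Rplus_le_compat; apply bp_norm_triangle|]. lra.
Qed.

Lemma sumsp_norm_scal (a : C) x :
  sumsp_norm (sumsp_scal a x) <= Cmod a * sumsp_norm x.
Proof.
  apply le_epsilon; intros e he.
  pose proof (Cmod_ge_0 a) as ha.
  destruct (sumsp_norm_approx x (sumsp_norm x + e / (Cmod a + 1))) as [b [hb hb']].
  { assert (0 < e / (Cmod a + 1)) by (apply Rdiv_lt_0_compat; lra). lra. }
  eapply Rle_trans.
  - apply sumsp_norm_le. apply (decomposes_scal a _ _ hb).
  - eapply Rle_trans.
    { apply Rplus_le_compat; apply bp_norm_scal. }
    assert (h : Cmod a * (norm (b false) + norm (b true))
            <= Cmod a * (sumsp_norm x + e / (Cmod a + 1)))
      by (apply Rmult_le_compat_l; lra).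
    assert (h' : Cmod a * (e / (Cmod a + 1)) <= e).
    { replace (Cmod a * (e / (Cmod a + 1))) with (e - e / (Cmod a + 1))
        by (field; lra).
      assert (0 < e / (Cmod a + 1)) by (apply Rdiv_lt_0_compat; lra). lra. }
    lra.
Qed.

Lemma bp_emb_near_zero j U : tvs_open (bp_amb B) U -> U zero ->
  exists e, 0 < e /\ forall y : B j, norm y < e -> U (bp_emb j y).
Proof.
  intros hU h0.
  destruct (bp_emb_continuous B j U hU zero) as [e he].
  { now rewrite bp_emb_zero. }
  exists e; split; [apply cond_pos|]. intros y hy. apply he.
  apply (norm_compat1 (V := B j)). now rewrite (minus_zero_r (G := B j)).
Qed.

Lemma sumsp_norm_eq_zero x : sumsp_norm x = 0 -> x = sumsp_zero.
Proof.
  intros h. apply sumsp_eq. simpl. apply Classical_Prop.NNPP; intros hx.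
  destruct (tvs_hausdorff _ _ _ hx) as [U [W [hU [hUx [hW [hW0 hUW]]]]]].
  rewrite <- (plus_zero_l zero) in hW0.
  destruct (tvs_plus_continuous _ _ _ _ hW hW0) as [W0 [W1 [h0 [h00 [h1 [h10 hW']]]]]].
  destruct (bp_emb_near_zero false W0 h0 h00) as [e0 [he0 hb0]].
  destruct (bp_emb_near_zero true W1 h1 h10) as [e1 [he1 hb1]].
  destruct (sumsp_norm_approx x (Rmin e0 e1)) as [b [hb hb']].
  { rewrite h. now apply Rmin_glb_lt. }
  pose proof (norm_ge_0 (b false)). pose proof (norm_ge_0 (b true)).
  pose proof (Rmin_l e0 e1). pose proof (Rmin_r e0 e1).
  apply (hUW _ hUx). rewrite hb. apply hW'; [apply hb0|apply hb1]; lra.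
Qed.

Definition sumsp_ball (x : sumsp) (e : R) (y : sumsp) : Prop :=
  sumsp_norm (minus y x) < e.

Lemma sumsp_ball_center x (e : posreal) : sumsp_ball x e x.
Proof.
  unfold sumsp_ball. rewrite minus_eq_zero.
  apply Rle_lt_trans with 0; [|apply cond_pos].
  eapply Rle_trans; [apply (sumsp_norm_le zero _ decomposes_zero)|].
  cbv beta. rewrite !bp_norm_zero. lra.
Qed.

Lemma sumsp_ball_sym x y e : sumsp_ball x e y -> sumsp_ball y e x.
Proof.
  unfold sumsp_ball; intros h. eapply Rle_lt_trans; [|exact h].
  rewrite <- (opp_minus y x).
  change (opp (minus y x)) with (sumsp_scal (opp (one : C)) (minus y x)).
  eapply Rle_trans; [apply sumsp_norm_scal|].
  change (opp (one : C)) with (Copp (RtoC 1)).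
  rewrite Cmod_opp, Cmod_1. lra.
Qed.

Lemma sumsp_ball_triangle x y z e1 e2 :
  sumsp_ball x e1 y -> sumsp_ball y e2 z -> sumsp_ball x (e1 + e2) z.
Proof.
  unfold sumsp_ball; intros h1 h2.
  rewrite (minus_trans y).
  eapply Rle_lt_trans; [apply sumsp_norm_triangle|].
  apply Rlt_le_trans with (e2 + e1); [now apply Rplus_lt_compat|lra].
Qed.

Definition sumsp_UniformSpace_mixin :=
  UniformSpace.Mixin sumsp sumsp_zero sumsp_ball
    sumsp_ball_center sumsp_ball_sym sumsp_ball_triangle.

Canonical sumsp_UniformSpace :=
  UniformSpace.Pack sumsp sumsp_UniformSpace_mixin sumsp.

Definition sumsp_NormedModuleAux_class :=
  NormedModuleAux.Class C_AbsRing sumsp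
    (ModuleSpace.class C_Ring sumsp_ModuleSpace) sumsp_UniformSpace_mixin.

Canonical sumsp_NormedModuleAux :=
  NormedModuleAux.Pack C_AbsRing sumsp sumsp_NormedModuleAux_class sumsp.

Lemma sumsp_norm_compat2 (x y : sumsp) (e : posreal) :
  sumsp_ball x e y -> sumsp_norm (minus y x) < 1 * e.
Proof. unfold sumsp_ball; intros h. now rewrite Rmult_1_l. Qed.

Definition sumsp_NormedModule_mixin :=
  NormedModule.Mixin C_AbsRing sumsp_NormedModuleAux sumsp_norm 1
    sumsp_norm_triangle sumsp_norm_scal
    (fun x y e h => h) sumsp_norm_compat2 sumsp_norm_eq_zero.

Canonical sumsp_NormedModule :=
  NormedModule.Pack C_AbsRing sumsp
    (NormedModule.Class C_AbsRing sumsp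
      sumsp_NormedModuleAux_class sumsp_NormedModule_mixin) sumsp.

Lemma in_sum_dec j (y : B j) : exists b, decomposes (bp_emb j y) b.
Proof.
  destruct j.
  - exists (fun i : bool => if i as i' return B i' then y else zero).
    unfold decomposes. now rewrite bp_emb_zero, plus_zero_l.
  - exists (fun i : bool => if i as i' return B i' then zero else y).
    unfold decomposes. now rewrite bp_emb_zero, plus_zero_r.
Qed.

Definition in_sum j (y : B j) : sumsp :=
  {| sum_val := bp_emb j y; sum_dec := in_sum_dec j y |}.

(** Using the other component of [x] gives the same vector, by [cap_eq]. *)
Definition cap_in_sum (x : cap B) : sumsp := in_sum false (x false).

End SumSpace.

Arguments in_sum {B} j y.
Arguments cap_in_sum {B} x.

(** * Sequence spaces *)

(** A two-sided series converges when its two halves do. *)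
Definition is_sumZ {V : NormedModule C_AbsRing} (c : Z -> V) (x : V) : Prop :=
  exists s t : V,
    is_series (fun k : nat => c (Z.of_nat k)) s /\
    is_series (fun k : nat => c (- Z.of_nat (S k))%Z) t /\
    x = plus s t.

Definition ex_sumZ {V : NormedModule C_AbsRing} (c : Z -> V) : Prop :=
  exists x, is_sumZ c x.

Definition shiftZ {T : Type} (b : Z -> T) : Z -> T := fun n => b (n - 1)%Z.

(** Powers of nonnegative reals with 0^p = 0 ([Rpower 0 p] is 1). *)
Definition rpow (x p : R) : R := if Rlt_dec 0 x then Rpower x p else 0.

(** Norm of the scalar space l^p, equal to [p_infty] off l^p. *)
Definition lp_norm (p : R) (a : Z -> R) : Rbar :=
  Rbar_lub (fun r => exists F : list Z, NoDup F /\
    r = Finite (rpow (iter Rplus 0 F (fun n => rpow (Rabs (a n)) p)) (/ p))).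

Definition circle (z : C) : Prop := Cmod z = 1.

(** e^(it) *)
Definition cis (t : R) : C := (cos t, sin t).

Section SequenceSpaces.

Variable V : CompleteNormedModule C_AbsRing.

Definition lpV_norm (p : R) (b : Z -> V) : Rbar := lp_norm p (fun n => norm (b n)).

Definition in_lpV (p : R) (b : Z -> V) : Prop := is_finite (lpV_norm p b).

Definition fourier_coef (f : C -> V) (n : Z) : V :=
  scal (RtoC (/ (2 * PI)))
    (RInt (V := restr_R V) (fun t => scal (cis (- (IZR n * t))) (f (cis t))) 0 (2 * PI)).

Definition FC_rep (b : Z -> V) (f : C -> V) : Prop :=
  continuous_on circle f /\ forall n, b n = fourier_coef f n.

Definition in_FC (b : Z -> V) : Prop := exists f, FC_rep b f.

(** The values of [f] on the circle are determined by its Fourier coefficients,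
    so the infimum is over at most one number; it is [p_infty] off FC. *)
Definition FC_norm (b : Z -> V) : Rbar :=
  Rbar_glb (fun r => exists f, FC_rep b f /\
    r = Rbar_lub (fun s => exists t : R, s = Finite (norm (f (cis t))))).

Definition in_UC (b : Z -> V) : Prop :=
  forall lam : Z -> C, (forall n, Cmod (lam n) <= 1) ->
    ex_sumZ (fun n => scal (lam n) (b n)).

Definition UC_norm (b : Z -> V) : Rbar :=
  Rbar_lub (fun r => exists (F : list Z) (lam : Z -> C),
    NoDup F /\ (forall n, Cmod (lam n) <= 1) /\
    r = Finite (norm (iter plus zero F (fun n => scal (lam n) (b n))))).

(** Meant for linear [T], for which preserving distances amounts to preserving
    the norm. *)
Definition isometry_on (S : (Z -> V) -> Prop) (N : (Z -> V) -> Rbar)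
  (T : (Z -> V) -> (Z -> V)) : Prop :=
  forall b, S b -> S (T b) /\ N (T b) = N b.

End SequenceSpaces.

Arguments lpV_norm {V} p b.
Arguments in_lpV {V} p b.
Arguments fourier_coef {V} f n.
Arguments FC_rep {V} b f.
Arguments in_FC {V} b.
Arguments FC_norm {V} b.
Arguments in_UC {V} b.
Arguments UC_norm {V} b.
Arguments isometry_on {V} S N T.

(** * Interpolation methods *)

Definition max_j (N : bool -> Rbar) : Rbar := Rbar_lub (fun r => exists j, r = N j).

Section Interpolation.

Variable B : BanachPair.

Definition weighted (w : Z -> R) (c : Z -> cap B) (j : bool) : Z -> B j :=
  fun n => scal (RtoC (w n)) (c n j).

Definition represents (w : Z -> R) (c : Z -> cap B) (x : sumsp B) : Prop :=
  is_sumZ (fun n => scal (RtoC (w n)) (cap_in_sum (c n))) x.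

Definition finitely_supported (c : Z -> cap B) : Prop :=
  exists N : Z, forall n : Z, (N < Z.abs n)%Z -> forall j, c n j = zero.

Definition Jfun (t : R) (y : cap B) : R := Rmax (norm (y false)) (t * norm (y true)).

(** ** The annulus method *)

Definition annulus (z : C) : Prop := 1 <= Cmod z <= exp 1.

Definition annulus_circle (j : bool) (z : C) : Prop := Cmod z = exp (idx j).

Definition analytic_at (f : C -> sumsp B) (z : C) : Prop :=
  exists a : nat -> sumsp B, locally z (fun w => is_pseries a (Cminus w z) (f w)).

(** Only the values of [ann_fun] on the annulus and of [ann_trace j] on the
    circle of radius e^j matter. *)
Record annulus_fun := {
  ann_fun : C -> sumsp B;
  ann_trace : forall j, C -> B j;
  ann_continuous : continuous_on annulus ann_fun;
  ann_analytic : forall z, 1 < Cmod z < exp 1 -> analytic_at ann_fun z;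
  ann_trace_eq : forall j z, annulus_circle j z ->
    ann_fun z = in_sum j (ann_trace j z);
  ann_trace_continuous : forall j, continuous_on (annulus_circle j) (ann_trace j)
}.

Definition annulus_fun_norm (f : annulus_fun) : Rbar :=
  Rbar_lub (fun r => exists (j : bool) (t : R), 0 <= t < 2 * PI /\
    r = Finite (norm (ann_trace f j (Cmult (RtoC (exp (idx j))) (cis t))))).

Definition annulus_norm (theta : R) (x : sumsp B) : Rbar :=
  Rbar_glb (fun r => exists f : annulus_fun,
    ann_fun f (RtoC (exp theta)) = x /\ r = annulus_fun_norm f).

(** ** The real method *)

Definition real_norm (theta p : R) (x : sumsp B) : Rbar :=
  Rbar_glb (fun r => exists b : Z -> cap B,
    (forall j, in_lpV p (weighted (fun n => exp (idx j * IZR n)) b j)) /\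
    represents (fun n => exp (theta * IZR n)) b x /\
    r = max_j (fun j => lpV_norm p (weighted (fun n => exp (idx j * IZR n)) b j))).

(** |x|_(J,e) for [q = exp 1] and |x|_(J,2) for [q = 2]. A representation is
    admissible by the condition on q^(jn) c_n, without the factor q^(-theta n);
    it contributes [p_infty] when the sequence of J-functionals is not in l^p. *)
Definition J_norm (q theta p : R) (x : sumsp B) : Rbar :=
  Rbar_glb (fun r => exists c : Z -> cap B,
    (forall j, in_lpV p (weighted (fun n => Rpower q (idx j * IZR n)) c j)) /\
    represents (fun _ => 1) c x /\
    r = lp_norm p (fun n => Rpower q (- theta * IZR n) * Jfun (Rpower q (IZR n)) (c n))).

(** ** Peetre's method *)

Definition peetre_norm (theta : R) (x : sumsp B) : Rbar :=
  Rbar_glb (fun r => exists c : Z -> cap B,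
    (forall j, in_UC (weighted (fun n => Rpower 2 ((idx j - theta) * IZR n)) c j)) /\
    represents (fun _ => 1) c x /\
    r = max_j (fun j => UC_norm (weighted (fun n => Rpower 2 ((idx j - theta) * IZR n)) c j))).

End Interpolation.

Arguments weighted {B} w c j.
Arguments represents {B} w c x.
Arguments finitely_supported {B} c.
Arguments Jfun {B} t y.
Arguments annulus_norm {B} theta x.
Arguments real_norm {B} theta p x.
Arguments J_norm {B} q theta p x.
Arguments peetre_norm {B} theta x.

(* Main.v *)
Require Import Defs.
From Stdlib Require Import Reals Lra Lia ZArith List Classical ClassicalEpsilon
  FunctionalExtensionality PropExtensionality.
From Coquelicot Require Import Coquelicot Iter.
Open Scope R_scope.

(** Discrete methods. Given a representation x = sum c_n, the positive and the
    negative half of the series converge in B_1 and in B_0. The tail of negative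
    indices beyond -m is small in B_0, and because x lies in B_0 and B_1 it is
    also x minus the rest of the series, hence of moderate size in B_1. It can
    therefore be concentrated at one index at a cost tending to 0, and likewise
    for the positive tail.

    Annulus method. Put c = e^theta and write f = x + (z - c) g; since f(c) = x,
    g again belongs to the space of admissible functions. By Cauchy's theorem
    its Laurent coefficients computed on the two boundary circles agree, so they
    lie in B_0 and B_1. The Fejer means of g converge to g uniformly on
    both circles, and x + (z - c) sigma_N(g) is a Laurent polynomial with value x at c
    that is close to f. *)

(** * Linear identities in modules *)

(** Each equality needs finite sums that represent x exactly, while cutting off a representation
    leaves an error known to be small only in the sum. In the discrete methods all that the cut uses
    of the sequence space is that the weighted terms tend to 0; for l^p this is where p < infinity
    enters. The weight q^((j - theta) n) grows with n for j = 1 and decays for j = 0, so each half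
    of the series converges in one space, and in the other its partial sums grow more slowly than
    the inverse weight. Changing two entries then costs at most 2 eps.

    In the annulus method the Fejer means of f itself would take at c a value that is merely near x,
    with a discrepancy not controlled in B_0 and in B_1; the factor z - c makes the value exact.
    Since f has values only in B_0 + B_1 inside the annulus, Cauchy's theorem is applied there, and
    its integrals need the completeness of the sum. In the coordinates z = e^(s+it) the annulus
    becomes a strip, on which Goursat's bisection of rectangles applies. *)

Inductive lin_expr (K : Ring) : Type :=
| LVar (n : nat) | LZero | LPlus (a b : lin_expr K) | LOpp (a : lin_expr K)
| LScal (k : K) (a : lin_expr K).
Arguments LVar {K} n.
Arguments LZero {K}.
Arguments LPlus {K} a b.
Arguments LOpp {K} a.
Arguments LScal {K} k a.

Fixpoint lin_eval {K : Ring} {V : ModuleSpace K} (env : list V) (e : lin_expr K) : V :=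
  match e with
  | LVar n => nth n env zero
  | LZero => zero
  | LPlus a b => plus (lin_eval env a) (lin_eval env b)
  | LOpp a => opp (lin_eval env a)
  | LScal k a => scal k (lin_eval env a)
  end.

Fixpoint lin_coef {K : Ring} (e : lin_expr K) (m : nat) : K :=
  match e with
  | LVar n => if Nat.eqb n m then one else zero
  | LZero => zero
  | LPlus a b => plus (lin_coef a m) (lin_coef b m)
  | LOpp a => opp (lin_coef a m)
  | LScal k a => mult k (lin_coef a m)
  end.

Fixpoint lin_comb {K : Ring} {V : ModuleSpace K} (env : list V) (k : nat -> K) : V :=
  match env with
  | nil => zero
  | v :: env' => plus (scal (k O) v) (lin_comb env' (fun n => k (S n)))
  end.

Lemma plus_swap4 {G : AbelianMonoid} (a b c d : G) :
  plus (plus a b) (plus c d) = plus (plus a c) (plus b d).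
Proof.
  rewrite <- !plus_assoc. f_equal. rewrite !plus_assoc. f_equal. apply plus_comm.
Qed.

Lemma lin_comb_plus {K : Ring} {V : ModuleSpace K} (env : list V) (k l : nat -> K) :
  lin_comb env (fun n => plus (k n) (l n)) = plus (lin_comb env k) (lin_comb env l).
Proof.
  revert k l; induction env as [|v env IH]; intros k l; simpl.
  - symmetry; apply plus_zero_l.
  - rewrite IH, scal_distr_r. apply plus_swap4.
Qed.

Lemma lin_comb_scal {K : Ring} {V : ModuleSpace K} (env : list V) (a : K) (k : nat -> K) :
  lin_comb env (fun n => mult a (k n)) = scal a (lin_comb env k).
Proof.
  revert k; induction env as [|v env IH]; intros k; simpl.
  - symmetry; apply scal_zero_r.
  - now rewrite IH, <- scal_assoc, scal_distr_l.
Qed.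

Lemma lin_comb_zero {K : Ring} {V : ModuleSpace K} (env : list V) :
  lin_comb env (fun _ => zero : K) = zero.
Proof.
  induction env as [|v env IH]; simpl; trivial.
  now rewrite IH, scal_zero_l, plus_zero_l.
Qed.

Lemma lin_comb_opp {K : Ring} {V : ModuleSpace K} (env : list V) (k : nat -> K) :
  lin_comb env (fun n => opp (k n)) = opp (lin_comb env k).
Proof.
  revert k; induction env as [|v env IH]; intros k; simpl.
  - symmetry; apply (@opp_zero V).
  - rewrite IH, scal_opp_l. symmetry. apply (@opp_plus V).
Qed.

Lemma lin_comb_var {K : Ring} {V : ModuleSpace K} (env : list V) (m : nat) :
  lin_comb env (fun n => if Nat.eqb m n then one else zero : K) = nth m env zero.
Proof.
  revert m; induction env as [|v env IH]; intros [|m]; simpl; trivial.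
  - now rewrite scal_one, lin_comb_zero, plus_zero_r.
  - now rewrite scal_zero_l, plus_zero_l, IH.
Qed.

Lemma lin_eval_comb {K : Ring} {V : ModuleSpace K} (env : list V) (e : lin_expr K) :
  lin_eval env e = lin_comb env (lin_coef e).
Proof.
  induction e; simpl.
  - symmetry; apply lin_comb_var.
  - symmetry; apply lin_comb_zero.
  - rewrite IHe1, IHe2. symmetry; apply lin_comb_plus.
  - rewrite IHe. symmetry; apply lin_comb_opp.
  - rewrite IHe. symmetry; apply lin_comb_scal.
Qed.

(** By recursion on the number of atoms, so that [simpl] unfolds it into finitely many scalar
    equations, one per atom. *)
Fixpoint lin_eq_upto {K : Ring} (n : nat) (e f : lin_expr K) (m : nat) : Prop :=
  match n with
  | O => True
  | S n' => lin_coef e m = lin_coef f m /\ lin_eq_upto n' e f (S m)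
  end.

Lemma lin_eval_eq {K : Ring} {V : ModuleSpace K} (env : list V) (e f : lin_expr K) :
  lin_eq_upto (length env) e f 0 -> lin_eval env e = lin_eval env f.
Proof.
  rewrite !lin_eval_comb.
  (* The offset [m] is generalised because passing to the tail of [env] renumbers the atoms. *)
  assert (h : forall env m, lin_eq_upto (length env) e f m ->
    lin_comb (V := V) env (fun n => lin_coef e (m + n)) =
    lin_comb env (fun n => lin_coef f (m + n))); [|exact (h env O)].
  clear env; intros env; induction env as [|v env IH]; simpl; trivial.
  intros m [h1 h2]. rewrite Nat.add_0_r, h1. f_equal.
  specialize (IH (S m) h2).
  assert (hS : forall g : lin_expr K, (fun n => lin_coef g (m + S n)) = fun n => lin_coef g (S m + n)).
  { intros g. apply functional_extensionality; intros n.
    f_equal; lia. }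
  now rewrite !hS.
Qed.

Ltac lin_index x env :=
  lazymatch env with
  | x :: _ => constr:(O)
  | _ :: ?env' => let n := lin_index x env' in constr:(S n)
  end.

Ltac lin_add x env :=
  match env with
  | context [x :: _] => env
  | _ => constr:(x :: env)
  end.

Ltac lin_atoms e env :=
  lazymatch e with
  | @plus _ ?a ?b => let env := lin_atoms a env in lin_atoms b env
  | @minus _ ?a ?b => let env := lin_atoms a env in lin_atoms b env
  | @opp _ ?a => lin_atoms a env
  | @scal _ _ _ ?a => lin_atoms a env
  | @zero _ => env
  | _ => lin_add e env
  end.

Ltac lin_reify K e env :=
  lazymatch e with
  | @plus _ ?a ?b =>
      let a := lin_reify K a env in let b := lin_reify K b env in
      constr:(@LPlus K a b)
  | @minus _ ?a ?b =>
      let a := lin_reify K a env in let b := lin_reify K b env in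
      constr:(@LPlus K a (@LOpp K b))
  | @opp _ ?a => let a := lin_reify K a env in constr:(@LOpp K a)
  | @scal _ _ ?k ?a => let a := lin_reify K a env in constr:(@LScal K k a)
  | @zero _ => constr:(@LZero K)
  | _ => let n := lin_index e env in constr:(@LVar K n)
  end.

Ltac lin_setup K V :=
  lazymatch goal with
  | |- ?lhs = ?rhs =>
      let env := lin_atoms lhs (@nil V) in
      let env := lin_atoms rhs env in
      let l := lin_reify K lhs env in
      let r := lin_reify K rhs env in
      change (@lin_eval K V env l = @lin_eval K V env r);
      apply lin_eval_eq; simpl
  end.

(** Reflection turns a vector identity into one scalar identity per atom; those that involve a
    denominator survive [ring] and are left to a following [field]. *)
Ltac lin_C V :=
  lin_setup C_Ring V; repeat split;
  try match goal with |- ?a = ?b => change (@eq C a b) end;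
  repeat match goal with
  | |- context [@plus ?G ?a ?b] => change (@plus G a b) with (Cplus a b)
  | |- context [@mult ?G ?a ?b] => change (@mult G a b) with (Cmult a b)
  | |- context [@opp ?G ?a] => change (@opp G a) with (Copp a)
  | |- context [@minus ?G ?a ?b] => change (@minus G a b) with (Cminus a b)
  | |- context [@one ?G] => change (@one G) with (RtoC 1)
  | |- context [@zero ?G] => change (@zero G) with (RtoC 0)
  end; try ring.

Ltac lin_R V :=
  lin_setup R_Ring V; repeat split;
  try match goal with |- ?a = ?b => change (@eq R a b) end;
  repeat match goal with
  | |- context [@plus ?G ?a ?b] => change (@plus G a b) with (Rplus a b)
  | |- context [@mult ?G ?a ?b] => change (@mult G a b) with (Rmult a b)
  | |- context [@opp ?G ?a] => change (@opp G a) with (Ropp a)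
  | |- context [@minus ?G ?a ?b] => change (@minus G a b) with (Rminus a b)
  | |- context [@one ?G] => change (@one G) with 1
  | |- context [@zero ?G] => change (@zero G) with 0
  end; try ring.

Ltac Rmin_bounds a b := pose proof (Rmin_l a b); pose proof (Rmin_r a b).

(** * Series and truncation of representations *)

Lemma filterlim_norm_le {V : NormedModule C_AbsRing} (u : nat -> V) (l : V) (M : R) :
  filterlim u eventually (locally l) -> (forall n, norm (u n) <= M) -> norm l <= M.
Proof.
  intros h hM.
  assert (hl : is_lim_seq (fun n => norm (u n)) (norm l)).
  { apply (filterlim_comp _ _ _ u norm eventually (locally l) (locally (norm l)) h).
    apply filterlim_norm. }
  exact (is_lim_seq_le _ _ _ (Finite M) hM hl (is_lim_seq_const M)).
Qed.

Lemma is_series_unique_N {V : NormedModule C_AbsRing} (a : nat -> V) (s t : V) :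
  is_series a s -> is_series a t -> s = t.
Proof. intros h h'. exact (filterlim_locally_unique _ _ _ h h'). Qed.

Lemma is_series_norm_le {V : NormedModule C_AbsRing} (a : nat -> V) (l : V) (C r : R) :
  0 <= C -> 0 <= r < 1 -> (forall k, norm (a k) <= C * r ^ k) -> is_series a l ->
  norm l <= C / (1 - r).
Proof.
  intros hC hr ha hl. apply (filterlim_norm_le (sum_n a)); [exact hl|].
  intros n.
  assert (h : norm (sum_n a n) <= C * ((1 - r ^ (S n)) / (1 - r))).
  { induction n as [|n IH].
    - rewrite sum_O. eapply Rle_trans; [apply ha|]. simpl. apply Req_le. field. lra.
    - rewrite sum_Sn. eapply Rle_trans; [apply (norm_triangle (V := V))|].
      eapply Rle_trans; [apply Rplus_le_compat; [apply IH|apply ha]|].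
      apply Req_le. simpl. field. lra. }
  eapply Rle_trans; [exact h|]. unfold Rdiv. apply Rmult_le_compat_l; trivial.
  rewrite <- (Rmult_1_l (/ (1 - r))) at 2. apply Rmult_le_compat_r.
  - left; apply Rinv_0_lt_compat; lra.
  - pose proof (pow_le r (S n) (proj1 hr)). lra.
Qed.

Lemma is_series_linear {U V : NormedModule C_AbsRing} (L : U -> V) (a : nat -> U) (s : U) :
  is_linear L -> is_series a s -> is_series (fun k => L (a k)) (L s).
Proof.
  intros hL hs. unfold is_series.
  apply filterlim_ext with (fun n => L (sum_n a n)).
  - intros n. induction n as [|n IH].
    + now rewrite !sum_O.
    + now rewrite !sum_Sn, <- IH, (linear_plus L hL).
  - eapply filterlim_comp; [exact hs|]. apply (linear_cont L s hL).
Qed.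

Lemma is_series_eventually_zero {V : NormedModule C_AbsRing} (a : nat -> V) (N : nat) :
  (forall k, (N < k)%nat -> a k = zero) -> is_series a (sum_n a N).
Proof.
  intros h. unfold is_series.
  apply filterlim_ext_loc with (fun _ => sum_n a N); [|apply filterlim_const].
  exists N. intros n hn. induction hn as [|n hn IH]; trivial.
  rewrite sum_Sn, <- IH, h by lia. symmetry; apply plus_zero_r.
Qed.

Lemma is_series_tail {V : NormedModule C_AbsRing} (a : nat -> V) (s : V) (m : nat) :
  is_series a s -> is_series (fun k => a (S m + k)%nat) (minus s (sum_n a m)).
Proof.
  intros h. apply (is_series_incr_n a (S m)); [lia|].
  simpl pred.
  assert (e : plus (minus s (sum_n a m)) (sum_n a m) = s) by lin_C V.
  rewrite <- e in h. exact h.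
Qed.

Lemma is_series_terms_to_zero {V : NormedModule C_AbsRing} (a : nat -> V) (s : V) :
  is_series a s -> forall eps, 0 < eps ->
  exists N, forall k, (N <= k)%nat -> norm (a k) <= eps.
Proof.
  intros h eps he.
  assert (he2 : 0 < eps / 2) by lra.
  destruct (proj1 (filterlim_locally_ball_norm _ _) h (mkposreal _ he2)) as [N hN].
  exists (S N). intros [|k] hk; [lia|].
  replace (a (S k)) with
    (minus (minus (sum_n a (S k)) s) (minus (sum_n a k) s)) by (rewrite sum_Sn; lin_C V).
  pose proof (hN k ltac:(lia)) as h1. pose proof (hN (S k) ltac:(lia)) as h2.
  unfold ball_norm in h1, h2. simpl in h1, h2.
  eapply Rle_trans; [apply (norm_triangle (V := V))|]. rewrite norm_opp.
  change (eps / 2 * 1) with (eps / 2) in *. lra.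
Qed.

Lemma is_sumZ_ext {V : NormedModule C_AbsRing} (c d : Z -> V) (x : V) :
  (forall n, c n = d n) -> is_sumZ c x -> is_sumZ d x.
Proof.
  intros h [s [t [hs [ht ->]]]]. exists s, t. repeat split.
  - eapply is_series_ext; [|exact hs]. intros; apply h.
  - eapply is_series_ext; [|exact ht]. intros; apply h.
Qed.

Lemma is_sumZ_linear {U V : NormedModule C_AbsRing} (L : U -> V) (c : Z -> U) (x : U) :
  is_linear L -> is_sumZ c x -> is_sumZ (fun n => L (c n)) (L x).
Proof.
  intros hL [s [t [hs [ht ->]]]]. exists (L s), (L t). repeat split.
  - exact (is_series_linear L _ _ hL hs).
  - exact (is_series_linear L _ _ hL ht).
  - apply (linear_plus L hL).
Qed.

Lemma is_sumZ_plus {V : NormedModule C_AbsRing} (c d : Z -> V) (x y : V) :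
  is_sumZ c x -> is_sumZ d y -> is_sumZ (fun n => plus (c n) (d n)) (plus x y).
Proof.
  intros [s [t [hs [ht ->]]]] [s' [t' [hs' [ht' ->]]]].
  exists (plus s s'), (plus t t'). repeat split.
  - exact (is_series_plus _ _ _ _ hs hs').
  - exact (is_series_plus _ _ _ _ ht ht').
  - apply plus_swap4.
Qed.

Lemma is_sumZ_finite {V : NormedModule C_AbsRing} (c : Z -> V) (N : nat) :
  (forall n, (Z.of_nat N < n)%Z -> c n = zero) ->
  (forall n, (n < - Z.of_nat (S N))%Z -> c n = zero) ->
  is_sumZ c (plus (sum_n (fun k => c (Z.of_nat k)) N)
                  (sum_n (fun k => c (- Z.of_nat (S k))%Z) N)).
Proof.
  intros hp hm. do 2 eexists. split; [|split]; [| |reflexivity].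
  - apply is_series_eventually_zero. intros; apply hp; lia.
  - apply (is_series_eventually_zero (fun k => c (- Z.of_nat (S k))%Z)). intros; apply hm; lia.
Qed.

Lemma is_sumZ_unique {V : NormedModule C_AbsRing} (c : Z -> V) (x y : V) :
  is_sumZ c x -> is_sumZ c y -> x = y.
Proof.
  intros [s [t [hs [ht ->]]]] [s' [t' [hs' [ht' ->]]]].
  f_equal; eapply is_series_unique_N; eassumption.
Qed.

(** * The embeddings into the sum *)

Lemma is_linear_in_sum (B : BanachPair) (j : bool) :
  is_linear (K := C_AbsRing) (U := B j) (V := sumsp_NormedModule B) (in_sum j).
Proof.
  apply Build_is_linear.
  - intros x y. apply sumsp_eq. apply bp_emb_plus.
  - intros k x. apply sumsp_eq. apply bp_emb_scal.
  (* The decomposition with zero in the other summand bounds the norm in the sum by the norm in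
     B_j. *)
  - exists 1. split; [lra|]. intros x. rewrite Rmult_1_l.
    destruct j.
    + eapply Rle_trans.
      * apply (sumsp_norm_le B _ (fun i : bool => if i as i' return B i' then x else zero)).
        unfold decomposes. simpl. now rewrite bp_emb_zero, plus_zero_l.
      * cbv beta. rewrite bp_norm_zero. apply Req_le, Rplus_0_l.
    + eapply Rle_trans.
      * apply (sumsp_norm_le B _ (fun i : bool => if i as i' return B i' then zero else x)).
        unfold decomposes. simpl. now rewrite bp_emb_zero, plus_zero_r.
      * cbv beta. rewrite bp_norm_zero. apply Req_le, Rplus_0_r.
Qed.

Lemma in_sum_cap (B : BanachPair) (x : cap B) (j : bool) : in_sum j (x j) = cap_in_sum x.
Proof. apply sumsp_eq. destruct j; simpl; trivial. symmetry; apply cap_eq. Qed.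

(** New vectors of the intersection arise from two vectors computed separately, one in each space,
    once they are shown to agree in the sum. *)
Definition mk_cap {B : BanachPair} (y : B false) (z : B true)
  (h : in_sum false y = in_sum true z) : cap B :=
  {| cap_at := fun j : bool => if j as i return B i then z else y;
     cap_eq := f_equal (sum_val B) h |}.

Definition cap_zero (B : BanachPair) : cap B :=
  {| cap_at := fun j => zero;
     cap_eq := eq_trans (bp_emb_zero B false) (eq_sym (bp_emb_zero B true)) |}.

Lemma exp_neg_lt_1 (rho : R) : 0 < rho -> 0 < exp (- rho) < 1.
Proof.
  intros h. split; [apply exp_pos|]. rewrite <- exp_0. apply exp_increasing. lra.
Qed.

Lemma exp_INR (a : R) (k : nat) : exp (a * INR k) = exp a ^ k.
Proof.
  induction k as [|k IH]; [now rewrite Rmult_0_r, exp_0|].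
  rewrite S_INR. simpl. rewrite <- IH, <- exp_plus. f_equal. ring.
Qed.

(** Terms that are o(e^(-rho k)) are eventually dominated by a small multiple of a geometric
    sequence, so the tail after m is o(e^(-rho m)) as well. This treats each half of a
    representation in the space where its weight grows. *)
Lemma geometric_tail {V : CompleteNormedModule C_AbsRing} (a : nat -> V) (rho : R) :
  0 < rho ->
  (forall eps, 0 < eps -> exists N, forall k, (N <= k)%nat ->
     exp (rho * INR k) * norm (a k) <= eps) ->
  exists s, is_series a s /\
    forall eps, 0 < eps -> exists N, forall m, (N <= m)%nat ->
      exp (rho * INR m) * norm (minus s (sum_n a m)) <= eps.
Proof.
  intros hrho ha. pose proof (exp_neg_lt_1 rho hrho) as hr.
  set (r := exp (- rho)) in *.
  assert (hak : forall eps N, (forall k, (N <= k)%nat -> exp (rho * INR k) * norm (a k) <= eps) ->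
    forall k, (N <= k)%nat -> norm (a k) <= eps * r ^ k).
  { intros eps N h k hk. unfold r. rewrite <- exp_INR.
    replace (- rho * INR k) with (- (rho * INR k)) by ring. rewrite exp_Ropp.
    apply Rmult_le_reg_l with (exp (rho * INR k)); [apply exp_pos|].
    eapply Rle_trans; [apply h; trivial|]. apply Req_le. field.
    apply Rgt_not_eq, exp_pos. }
  assert (hex : ex_series a).
  { destruct (ha 1 Rlt_0_1) as [N hN].
    apply (ex_series_incr_n a N).
    apply ex_series_le with (fun k => r ^ N * r ^ k).
    - intros k. eapply Rle_trans; [apply (hak 1 N hN); lia|].
      rewrite Rmult_1_l, pow_add. apply Rle_refl.
    - apply (ex_series_scal_l (r ^ N) (fun k => r ^ k)). apply ex_series_geom.
      rewrite Rabs_right; lra. }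
  destruct hex as [s hs]. exists s. split; trivial.
  intros eps he.
  (* The factor 1 - r cancels the sum 1/(1 - r) of the geometric series. *)
  destruct (ha (eps * (1 - r))) as [N hN]; [apply Rmult_lt_0_compat; lra|].
  exists N. intros m hm.
  assert (h : norm (minus s (sum_n a m)) <= eps * (1 - r) * r ^ m / (1 - r)).
  { apply (is_series_norm_le (fun k => a (S m + k)%nat)); trivial.
    - apply Rmult_le_pos; [apply Rmult_le_pos; lra|apply pow_le; lra].
    - lra.
    - intros k. eapply Rle_trans; [apply (hak _ N hN); lia|].
      rewrite pow_add, !Rmult_assoc. repeat apply Rmult_le_compat_l; try lra.
      rewrite <- (Rmult_1_l (r ^ m * r ^ k)), <- Rmult_assoc. apply Rmult_le_compat_r; [apply pow_le; lra|].
      simpl. pose proof (pow_le r m). rewrite Rmult_1_l.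
      rewrite <- (Rmult_1_l (r ^ m)) at 2. apply Rmult_le_compat_r; [apply H; lra|lra].
    - exact (is_series_tail (V := V) a s m hs). }
  apply Rle_trans with (exp (rho * INR m) * (eps * r ^ m)).
  - apply Rmult_le_compat_l; [left; apply exp_pos|].
    eapply Rle_trans; [exact h|]. apply Req_le. field. lra.
  - unfold r. rewrite <- exp_INR. replace (- rho * INR m) with (- (rho * INR m)) by ring.
    rewrite exp_Ropp. apply Req_le. field. apply Rgt_not_eq, exp_pos.
Qed.

Lemma exp_INR_large (rho K eps : R) : 0 < rho -> 0 < eps ->
  exists N, forall m, (N <= m)%nat -> exp (- rho * INR m) * K <= eps.
Proof.
  intros hrho he. pose proof (exp_neg_lt_1 rho hrho) as hr.
  assert (hK : 0 < eps / (Rabs K + 1)).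
  { apply Rdiv_lt_0_compat; trivial. pose proof (Rabs_pos K). lra. }
  destruct (pow_lt_1_zero (exp (- rho)) ltac:(rewrite Rabs_right; lra) _ hK) as [N hN].
  exists N. intros m hm. specialize (hN m hm). rewrite exp_INR.
  assert (hp : 0 < exp (- rho) ^ m) by (apply pow_lt; lra).
  rewrite Rabs_right in hN by lra.
  apply Rle_trans with (exp (- rho) ^ m * (Rabs K + 1)).
  - apply Rmult_le_compat_l; [lra|]. pose proof (Rle_abs K). lra.
  - left. apply Rmult_lt_reg_r with (/ (Rabs K + 1)).
    + apply Rinv_0_lt_compat. pose proof (Rabs_pos K). lra.
    + rewrite Rmult_assoc, Rinv_r, Rmult_1_r; [exact hN|]. pose proof (Rabs_pos K). lra.
Qed.

Lemma geometric_growth {V : NormedModule C_AbsRing} (a : nat -> V) (y : V) (rho : R) :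
  0 < rho ->
  (forall eps, 0 < eps -> exists N, forall k, (N <= k)%nat ->
     exp (- rho * INR k) * norm (a k) <= eps) ->
  forall eps, 0 < eps -> exists N, forall m, (N <= m)%nat ->
    exp (- rho * INR m) * norm (minus y (sum_n a m)) <= eps.
Proof.
  intros hrho ha eps he. pose proof (exp_neg_lt_1 rho hrho) as hr.
  set (r := exp (- rho)) in *.
  (* With this [d] the bound K + eps/2 e^(rho m) reproduces itself when the next term is added,
     because e^(rho m) = r e^(rho (m+1)). *)
  set (d := eps / 2 * (1 - r)).
  assert (hd : 0 < d) by (apply Rmult_lt_0_compat; lra).
  destruct (ha d hd) as [N hN].
  set (K := norm (minus y (sum_n a N))).
  assert (hb : forall m, (N <= m)%nat ->
    norm (minus y (sum_n a m)) <= K + eps / 2 * exp (rho * INR m)).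
  { intros m hm. induction hm as [|m hm IH].
    - pose proof (exp_pos (rho * INR N)). unfold K.
      assert (0 <= eps / 2 * exp (rho * INR N)) by (apply Rmult_le_pos; lra). lra.
    - rewrite sum_Sn.
      replace (minus y (plus (sum_n a m) (a (S m)))) with
        (plus (minus y (sum_n a m)) (opp (a (S m)))) by lin_C V.
      eapply Rle_trans; [apply (norm_triangle (V := V))|]. rewrite norm_opp.
      assert (hS : norm (a (S m)) <= d * exp (rho * INR (S m))).
      { apply Rmult_le_reg_l with (exp (- rho * INR (S m))); [apply exp_pos|].
        eapply Rle_trans; [apply hN; lia|].
        replace (- rho * INR (S m)) with (- (rho * INR (S m))) by ring.
        rewrite exp_Ropp. apply Req_le. field. apply Rgt_not_eq, exp_pos. }
      assert (hq : exp (rho * INR m) = r * exp (rho * INR (S m))).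
      { unfold r. rewrite <- exp_plus, S_INR. f_equal. ring. }
      rewrite hq in IH.
      replace (K + eps / 2 * exp (rho * INR (S m))) with
        (K + eps / 2 * (r * exp (rho * INR (S m))) + d * exp (rho * INR (S m)))
        by (unfold d; field).
      lra. }
  destruct (exp_INR_large rho K (eps / 2) hrho ltac:(lra)) as [N' hN'].
  exists (N + N')%nat. intros m hm.
  apply Rle_trans with (exp (- rho * INR m) * (K + eps / 2 * exp (rho * INR m))).
  - apply Rmult_le_compat_l; [left; apply exp_pos|]. apply hb; lia.
  - rewrite Rmult_plus_distr_l.
    replace (exp (- rho * INR m) * (eps / 2 * exp (rho * INR m))) with (eps / 2).
    + specialize (hN' m ltac:(lia)). lra.
    + replace (- rho * INR m) with (- (rho * INR m)) by ring.
      rewrite exp_Ropp. field. apply Rgt_not_eq, exp_pos.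
Qed.

Lemma represents_one (B : BanachPair) (c : Z -> cap B) (x : sumsp B) :
  represents (fun _ => 1) c x <->
  is_sumZ (V := sumsp_NormedModule B) (fun n => cap_in_sum (c n)) x.
Proof.
  split; apply is_sumZ_ext; intros n.
  - apply (@scal_one C_Ring (sumsp_ModuleSpace B)).
  - symmetry. apply (@scal_one C_Ring (sumsp_ModuleSpace B)).
Qed.

Lemma linear_sum_n {U V : NormedModule C_AbsRing} (L : U -> V) (a : nat -> U) (n : nat) :
  is_linear L -> L (sum_n a n) = sum_n (fun k => L (a k)) n.
Proof.
  intros hL. induction n as [|n IH].
  - now rewrite !sum_O.
  - now rewrite !sum_Sn, <- IH, (linear_plus L hL).
Qed.

Lemma represents_finite (B : BanachPair) (c : Z -> cap B) (x : cap B) (N : nat) :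
  (forall n, (Z.of_nat N < n)%Z -> c n false = zero) ->
  (forall n, (n < - Z.of_nat (S N))%Z -> c n false = zero) ->
  plus (sum_n (fun k => c (Z.of_nat k) false) N)
       (sum_n (fun k => c (- Z.of_nat (S k))%Z false) N) = x false ->
  represents (fun _ => 1) c (cap_in_sum x).
Proof.
  intros hp hm hx. apply represents_one.
  apply (is_sumZ_linear _ (fun n => c n false) (x false) (is_linear_in_sum B false)).
  rewrite <- hx. now apply (is_sumZ_finite (fun n => c n false)).
Qed.

(** The weight q^((j - theta) n) with q = e^L: L = 1 gives base e and L = ln 2 gives base 2. *)
Definition geom_weight (theta L : R) (j : bool) (n : Z) : R :=
  exp (L * (idx j - theta) * IZR n).

(* Only the part of the representation outside [-m, m-1] is replaced. The tail of
   negative indices sums to a vector that is small in B_0 and, being the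
   difference of x and the rest, not too large in B_1; so it may be put at the
   single index -m-1. The tail of positive indices goes to index m. *)
Lemma truncate_representation (B : BanachPair) (theta L : R) (x : cap B) (c : Z -> cap B) :
  0 < theta < 1 -> 0 < L -> represents (fun _ => 1) c (cap_in_sum x) ->
  (forall j eps, 0 < eps -> exists N : nat, forall n, (N <= Z.abs_nat n)%nat ->
     geom_weight theta L j n * norm (c n j) <= eps) ->
  forall eps, 0 < eps -> exists (c' : Z -> cap B) (m : Z),
    finitely_supported c' /\ represents (fun _ => 1) c' (cap_in_sum x) /\
    (forall n, n = m \/ n = (- m - 1)%Z ->
       forall j, geom_weight theta L j n * norm (c' n j) <= eps) /\
    (forall n, n <> m -> n <> (- m - 1)%Z ->
       (forall j, c' n j = c n j) \/ (forall j, c' n j = zero)).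
Proof.
  intros ht hL hrep hdec eps heps.
  apply represents_one in hrep. destruct hrep as [s [t [hs [hT hx]]]].
  assert (hl0 : 0 < L * theta) by (apply Rmult_lt_0_compat; lra).
  assert (hl1 : 0 < L * (1 - theta)) by (apply Rmult_lt_0_compat; lra).
  set (neg := fun (j : bool) (k : nat) => c (- Z.of_nat (S k))%Z j).
  set (pos := fun (j : bool) (k : nat) => c (Z.of_nat k) j).
  set (K := exp L).
  assert (hK : 0 < K) by apply exp_pos.
  assert (hneg : forall k, INR (S k) = - IZR (- Z.of_nat (S k))).
  { intros k. rewrite opp_IZR, <- INR_IZR_INZ. ring. }
  assert (hn0 : forall e, 0 < e -> exists N, forall k, (N <= k)%nat ->
    exp (L * theta * INR k) * norm (neg false k) <= e).
  { intros e he. destruct (hdec false e he) as [N hN]. exists N. intros k hk.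
    eapply Rle_trans; [|apply (hN (- Z.of_nat (S k))%Z); lia].
    apply Rmult_le_compat_r; [apply norm_ge_0|]. unfold geom_weight.
    left. apply exp_increasing. simpl idx.
    replace (L * (0 - theta) * IZR (- Z.of_nat (S k))) with (L * theta * INR (S k))
      by (rewrite (hneg k); ring).
    apply Rmult_lt_compat_l; trivial. rewrite S_INR; lra. }
  assert (hn1 : forall e, 0 < e -> exists N, forall k, (N <= k)%nat ->
    exp (- (L * (1 - theta)) * INR k) * norm (neg true k) <= e).
  (* Entry k of [neg] has index -(k+1), so its weight carries an extra factor e^(-L(1-theta));
     asking for e/K compensates it, since K = e^L. *)
  { intros e he. destruct (hdec true (e / K)) as [N hN]; [now apply Rdiv_lt_0_compat|].
    exists N. intros k hk.
    specialize (hN (- Z.of_nat (S k))%Z ltac:(lia)). unfold geom_weight in hN. simpl idx in hN.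
    replace (L * (1 - theta) * IZR (- Z.of_nat (S k))) with
      (- (L * (1 - theta)) * INR k + - (L * (1 - theta))) in hN
      by (replace (IZR (- Z.of_nat (S k))) with (- INR (S k)) by (rewrite hneg; ring);
          rewrite S_INR; ring).
    rewrite exp_plus in hN.
    assert (hk' : 1 <= K * exp (- (L * (1 - theta)))).
    { unfold K. rewrite <- exp_plus. replace (L + - (L * (1 - theta))) with (L * theta) by ring.
      left. rewrite <- exp_0 at 1. now apply exp_increasing. }
    apply (Rmult_le_compat_l K) in hN; [|lra].
    replace (K * (e / K)) with e in hN by (field; lra).
    eapply Rle_trans; [|exact hN].
    rewrite <- (Rmult_1_l (exp _ * norm _)).
    replace (K * (exp (- (L * (1 - theta)) * INR k) * exp (- (L * (1 - theta))) *
        norm (c (- Z.of_nat (S k))%Z true)))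
      with ((K * exp (- (L * (1 - theta)))) *
        (exp (- (L * (1 - theta)) * INR k) * norm (neg true k))) by (unfold neg; ring).
    apply Rmult_le_compat_r; trivial.
    apply Rmult_le_pos; [left; apply exp_pos|apply norm_ge_0]. }
  assert (hp1 : forall e, 0 < e -> exists N, forall k, (N <= k)%nat ->
    exp (L * (1 - theta) * INR k) * norm (pos true k) <= e).
  { intros e he. destruct (hdec true e he) as [N hN]. exists N. intros k hk.
    specialize (hN (Z.of_nat k) ltac:(lia)). unfold geom_weight in hN.
    now rewrite <- INR_IZR_INZ in hN. }
  assert (hp0 : forall e, 0 < e -> exists N, forall k, (N <= k)%nat ->
    exp (- (L * theta) * INR k) * norm (pos false k) <= e).
  { intros e he. destruct (hdec false e he) as [N hN]. exists N. intros k hk.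
    specialize (hN (Z.of_nat k) ltac:(lia)). unfold geom_weight in hN.
    rewrite <- INR_IZR_INZ in hN. simpl idx in hN.
    now replace (L * (0 - theta)) with (- (L * theta)) in hN by ring. }
  destruct (geometric_tail (V := B false) _ _ hl0 hn0) as [S0 [hS0 hS0']].
  destruct (geometric_tail (V := B true) _ _ hl1 hp1) as [S1 [hS1 hS1']].
  (* [x true] minus [S1] is what the negative half ought to sum to in B_1. Convergence there is not
     claimed, only slow growth of the difference from the partial sums. *)
  pose proof (geometric_growth (V := B true) _ (minus (x true) S1) _ hl1 hn1) as hg1.
  pose proof (geometric_growth (V := B false) _ (minus (x false) S0) _ hl0 hp0) as hg0.
  assert (ht0 : in_sum false S0 = t).
  { eapply (is_series_unique_N (V := sumsp_NormedModule B)); [|exact hT].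
    exact (is_series_linear _ _ _ (is_linear_in_sum B false) hS0). }
  assert (hs1 : in_sum true S1 = s).
  { eapply (is_series_unique_N (V := sumsp_NormedModule B)); [|exact hs].
    eapply is_series_ext; [|exact (is_series_linear _ _ _ (is_linear_in_sum B true) hS1)].
    intros k. simpl. apply in_sum_cap. }
  assert (hsum : forall (a : nat -> cap B) m,
    in_sum false (sum_n (fun k => a k false) m) = in_sum true (sum_n (fun k => a k true) m)).
  { intros a m.
    rewrite (linear_sum_n (V := sumsp_NormedModule B) _ _ m (is_linear_in_sum B false)).
    rewrite (linear_sum_n (V := sumsp_NormedModule B) _ _ m (is_linear_in_sum B true)).
    apply sum_n_ext. intros k. now rewrite !in_sum_cap. }
  (* Two forms of the negative tail: in B_0 the remainder of a convergent series, in B_1 the vector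
     x minus everything else. As they agree in the sum, the tail lies in the intersection; [hv] is
     the same with the roles exchanged. *)
  assert (hu : forall m, in_sum false (minus S0 (sum_n (neg false) m)) =
    in_sum true (minus (minus (x true) S1) (sum_n (neg true) m))).
  { intros m.
    rewrite (linear_minus (V := sumsp_NormedModule B) _ _ _ (is_linear_in_sum B false)).
    rewrite !(linear_minus (V := sumsp_NormedModule B) _ _ _ (is_linear_in_sum B true)).
    rewrite ht0, hs1, in_sum_cap, hx.
    pose proof (hsum (fun k => c (- Z.of_nat (S k))%Z) m) as hm.
    change (in_sum false (sum_n (neg false) m) = in_sum true (sum_n (neg true) m)) in hm.
    rewrite hm.
    lin_C (sumsp_ModuleSpace B). }
  assert (hv : forall m, in_sum false (minus (minus (x false) S0) (sum_n (pos false) m)) =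
    in_sum true (minus S1 (sum_n (pos true) m))).
  { intros m.
    rewrite !(linear_minus (V := sumsp_NormedModule B) _ _ _ (is_linear_in_sum B false)).
    rewrite (linear_minus (V := sumsp_NormedModule B) _ _ _ (is_linear_in_sum B true)).
    rewrite ht0, hs1, in_sum_cap, hx.
    pose proof (hsum (fun k => c (Z.of_nat k)) m) as hm.
    change (in_sum false (sum_n (pos false) m) = in_sum true (sum_n (pos true) m)) in hm.
    rewrite hm.
    lin_C (sumsp_ModuleSpace B). }
  (* Moving a tail from m to the index m + 1 or -(m + 2) changes its weight by at most the factor
     e^(2L) = K^2. *)
  set (e := eps / (K * K)).
  assert (he : 0 < e) by (apply Rdiv_lt_0_compat; trivial; now apply Rmult_lt_0_compat).
  destruct (hS0' e he) as [N1 hN1]. destruct (hS1' e he) as [N2 hN2].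
  destruct (hg1 e he) as [N3 hN3]. destruct (hg0 e he) as [N4 hN4].
  set (m := (N1 + N2 + N3 + N4)%nat).
  specialize (hN1 m ltac:(lia)). specialize (hN2 m ltac:(lia)).
  specialize (hN3 m ltac:(lia)). specialize (hN4 m ltac:(lia)).
  set (u := mk_cap _ _ (hu m)). set (v := mk_cap _ _ (hv m)).
  (* The partial sums up to m end at the indices m and -(m + 1), so the tails belong at M = m + 1
     and at -M - 1 = -(m + 2). *)
  set (M := Z.of_nat (S m)).
  set (c' := fun n => if Z.eq_dec n M then v else if Z.eq_dec n (- M - 1)%Z then u
    else if Z_lt_dec M (Z.abs n) then cap_zero B else c n).
  assert (hcv : c' M = v) by (unfold c'; now destruct (Z.eq_dec M M)).
  assert (hcu : c' (- M - 1)%Z = u).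
  { unfold c'. destruct (Z.eq_dec _ M); [lia|]. now destruct (Z.eq_dec _ _). }
  assert (hcout : forall n, n <> M -> n <> (- M - 1)%Z -> (M < Z.abs n)%Z -> c' n = cap_zero B).
  { intros n h1 h2 h3. unfold c'. destruct (Z.eq_dec n M); [easy|].
    destruct (Z.eq_dec n (- M - 1)); [easy|]. now destruct (Z_lt_dec M (Z.abs n)). }
  assert (hcin : forall n, n <> M -> (Z.abs n <= M)%Z -> c' n = c n).
  { intros n h1 h3. unfold c'. destruct (Z.eq_dec n M); [easy|].
    destruct (Z.eq_dec n (- M - 1)); [lia|]. now destruct (Z_lt_dec M (Z.abs n)); [lia|]. }
  clearbody c'.
  exists c', M.
  assert (hexp : forall a b, a <= b + 2 * L -> exp a <= K * K * exp b).
  { intros a b hab. unfold K. rewrite <- !exp_plus.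
    destruct (Rle_lt_or_eq_dec _ _ hab) as [h| ->].
    - left. apply exp_increasing. lra.
    - right. f_equal. ring. }
  assert (hbound : forall a b y, a <= b + 2 * L -> 0 <= y -> exp b * y <= e -> exp a * y <= eps).
  { intros a b y hab hy h.
    apply Rle_trans with (K * K * exp b * y).
    - apply Rmult_le_compat_r; auto.
    - replace eps with (K * K * e) by (unfold e; field; lra).
      rewrite Rmult_assoc. apply Rmult_le_compat_l; trivial.
      left; now apply Rmult_lt_0_compat. }
  assert (hLt : L * theta <= L) by (rewrite <- (Rmult_1_r L) at 2; apply Rmult_le_compat_l; lra).
  assert (hLt' : L * (1 - theta) <= L) by (rewrite <- (Rmult_1_r L) at 2; apply Rmult_le_compat_l; lra).
  assert (hM : IZR M = INR m + 1) by (unfold M; rewrite <- INR_IZR_INZ, S_INR; ring).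
  assert (hM' : IZR (- M - 1) = - INR m - 2) by (rewrite minus_IZR, opp_IZR, hM; ring).
  split; [|split; [|split]].
  - exists (M + 1)%Z. intros n hn j. rewrite hcout by lia. reflexivity.
  - apply (represents_finite B _ x (S m)).
    + intros n hn. rewrite hcout by lia. reflexivity.
    + intros n hn. rewrite hcout by lia. reflexivity.
    + rewrite !sum_Sn.
      assert (ep : sum_n (fun k => c' (Z.of_nat k) false) m = sum_n (pos false) m).
      { apply sum_n_ext_loc. intros k hk. now rewrite hcin by lia. }
      assert (en : sum_n (fun k => c' (- Z.of_nat (S k))%Z false) m = sum_n (neg false) m).
      { apply sum_n_ext_loc. intros k hk. now rewrite hcin by lia. }
      fold M. replace (- Z.of_nat (S (S m)))%Z with (- M - 1)%Z by lia.
      rewrite hcv, hcu. setoid_rewrite ep. setoid_rewrite en.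
      simpl cap_at. lin_C (B false).
  - intros n hn j.
    destruct hn as [->| ->].
    + unfold geom_weight. rewrite hM, hcv. destruct j; simpl cap_at; simpl idx.
      * apply (hbound _ (L * (1 - theta) * INR m)); trivial; [|apply norm_ge_0]. lra.
      * apply (hbound _ (- (L * theta) * INR m)); trivial; [|apply norm_ge_0]. lra.
    + unfold geom_weight. rewrite hM', hcu. destruct j; simpl cap_at; simpl idx.
      * apply (hbound _ (- (L * (1 - theta)) * INR m)); trivial; [|apply norm_ge_0]. lra.
      * apply (hbound _ (L * theta * INR m)); trivial; [|apply norm_ge_0]. lra.
  - intros n h1 h2. destruct (Z_lt_dec M (Z.abs n)) as [h|h].
    + right. intros j. now rewrite hcout.
    + left. intros j. rewrite hcin by lia. reflexivity.
Qed.

(** * The norms of l^p and UC *)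

(** The axiom for norms gives one inequality; the other is the same axiom for the inverse scalar. *)
Lemma norm_scal_C {V : NormedModule C_AbsRing} (a : C) (y : V) :
  norm (scal a y) = Cmod a * norm y.
Proof.
  apply Rle_antisym; [exact (norm_scal (K := C_AbsRing) a y)|].
  destruct (Ceq_dec a 0) as [->|ha].
  - rewrite Cmod_0, Rmult_0_l. apply norm_ge_0.
  - assert (hp : 0 < Cmod a) by now apply Cmod_gt_0.
    assert (h : norm y <= Cmod (/ a)%C * norm (scal a y)).
    { replace y with (scal (/ a)%C (scal a y)) at 1; [exact (norm_scal (K := C_AbsRing) (/ a)%C _)|].
      rewrite scal_assoc. change (mult (/ a)%C a) with (/ a * a)%C.
      rewrite Cinv_l by trivial. exact (scal_one y). }
    rewrite Cmod_inv in h by trivial.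
    apply Rmult_le_reg_l with (/ Cmod a); [now apply Rinv_0_lt_compat|].
    rewrite <- Rmult_assoc, Rinv_l, Rmult_1_l by lra. exact h.
Qed.

Lemma norm_scal_RtoC {V : NormedModule C_AbsRing} (a : R) (y : V) :
  0 <= a -> norm (scal (RtoC a) y) = a * norm y.
Proof. intros h. rewrite norm_scal_C, Cmod_R, Rabs_right; trivial. lra. Qed.

Lemma Rbar_lub_ub (E : Rbar -> Prop) r : E r -> Rbar_le r (Rbar_lub E).
Proof. apply (proj1 (proj2_sig (Rbar_ex_lub E))). Qed.

Lemma Rbar_lub_le (E : Rbar -> Prop) M : (forall r, E r -> Rbar_le r M) -> Rbar_le (Rbar_lub E) M.
Proof. apply (proj2 (proj2_sig (Rbar_ex_lub E))). Qed.

Lemma Rbar_glb_lb (E : Rbar -> Prop) r : E r -> Rbar_le (Rbar_glb E) r.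
Proof. apply (proj1 (proj2_sig (Rbar_ex_glb E))). Qed.

Lemma Rbar_le_glb (E : Rbar -> Prop) M : (forall r, E r -> Rbar_le M r) -> Rbar_le M (Rbar_glb E).
Proof. apply (proj2 (proj2_sig (Rbar_ex_glb E))). Qed.

Lemma Rbar_le_epsilon (x : Rbar) (r : R) :
  (forall eps, 0 < eps -> Rbar_le x (r + eps)) -> Rbar_le x r.
Proof.
  intros h. destruct x as [x| |]; simpl in *; trivial; [|exact (h 1 Rlt_0_1)].
  apply le_epsilon. exact h.
Qed.

(** The common scheme of the equalities to be proved: [E1] comes from all representations, [E2] from
    the finitely supported ones. The value +infinity needs no approximation, and excluding -infinity
    leaves finite values, where an additive [eps] makes sense. *)
Lemma Rbar_glb_eq_approx (E1 E2 : Rbar -> Prop) :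
  (forall r, E2 r -> exists r', E1 r' /\ Rbar_le r' r) ->
  (forall r, E1 r -> r <> m_infty) ->
  (forall r : R, E1 (Finite r) -> forall eps, 0 < eps ->
     exists r', E2 r' /\ Rbar_le r' (r + eps)) ->
  Rbar_glb E1 = Rbar_glb E2.
Proof.
  intros h21 hm h12. apply Rbar_le_antisym; apply Rbar_le_glb.
  - intros r hr. destruct (h21 r hr) as [r' [h1 h2]].
    eapply Rbar_le_trans; [apply Rbar_glb_lb, h1|exact h2].
  - intros [r| |] hr; [|now destruct (Rbar_glb E2)|now destruct (hm _ hr)].
    apply Rbar_le_epsilon. intros eps he. destruct (h12 r hr eps he) as [r' [h1 h2]].
    eapply Rbar_le_trans; [apply Rbar_glb_lb, h1|exact h2].
Qed.

Lemma max_j_ub (N : bool -> Rbar) j : Rbar_le (N j) (max_j N).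
Proof. apply Rbar_lub_ub. now exists j. Qed.

Lemma max_j_le (N : bool -> Rbar) M : (forall j, Rbar_le (N j) M) -> Rbar_le (max_j N) M.
Proof. intros h. apply Rbar_lub_le. intros r [j ->]. apply h. Qed.

Lemma max_j_ext (N N' : bool -> Rbar) : (forall j, N j = N' j) -> max_j N = max_j N'.
Proof.
  intros h. apply Rbar_le_antisym; apply max_j_le; intros j.
  - rewrite h. apply max_j_ub.
  - rewrite <- h. apply max_j_ub.
Qed.

Lemma Rbar_ge_0_not_m_infty (x : Rbar) : Rbar_le 0 x -> x <> m_infty.
Proof. intros h ->. exact h. Qed.

Lemma iter_Rplus_le {I : Type} (F : list I) (f g : I -> R) :
  (forall n, In n F -> f n <= g n) -> iter Rplus 0 F f <= iter Rplus 0 F g.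
Proof.
  induction F as [|x F IH]; simpl; intros h; [lra|].
  apply Rplus_le_compat; auto.
Qed.

Lemma iter_Rplus_plus {I : Type} (F : list I) (f g : I -> R) :
  iter Rplus 0 F (fun n => f n + g n) = iter Rplus 0 F f + iter Rplus 0 F g.
Proof. induction F as [|x F IH]; simpl; [lra|]. rewrite IH; ring. Qed.

Lemma iter_Rplus_app {I : Type} (F G : list I) (f : I -> R) :
  iter Rplus 0 (F ++ G) f = iter Rplus 0 F f + iter Rplus 0 G f.
Proof. induction F as [|x F IH]; simpl; [lra|]. rewrite IH; ring. Qed.

Lemma iter_Rplus_ge_0 {I : Type} (F : list I) (f : I -> R) :
  (forall n, 0 <= f n) -> 0 <= iter Rplus 0 F f.
Proof.
  intros h. induction F as [|x F IH]; simpl; [lra|]. specialize (h x). lra.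
Qed.

Lemma iter_Rplus_incl {I : Type} (F : list I) :
  forall (G : list I) (f : I -> R), NoDup F -> (forall n, 0 <= f n) ->
  (forall n, In n F -> ~ In n G -> f n = 0) ->
  iter Rplus 0 F f <= iter Rplus 0 G f.
Proof.
  induction F as [|x F IH]; intros G f hF hf h; simpl; [now apply iter_Rplus_ge_0|].
  inversion_clear hF as [|? ? hx hF'].
  destruct (classic (In x G)) as [hG|hG].
  - destruct (in_split _ _ hG) as [G1 [G2 ->]].
    assert (h1 : iter Rplus 0 F f <= iter Rplus 0 (G1 ++ G2) f).
    { apply IH; trivial. intros n hn hn'. apply h; [now right|].
      intros hin. apply hn'. apply in_app_or in hin. apply in_or_app.
      destruct hin as [hin|[->|hin]]; auto. easy. }
    rewrite iter_Rplus_app in *. simpl. lra.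
  - rewrite (h x); [|now left|trivial].
    rewrite Rplus_0_l. apply IH; trivial. intros n hn; apply h; now right.
Qed.

Lemma iter_map {I J T : Type} (op : T -> T -> T) (x0 : T) (F : list I) (g : I -> J) (f : J -> T) :
  iter op x0 (map g F) f = iter op x0 F (fun n => f (g n)).
Proof. induction F as [|x F IH]; simpl; trivial. now rewrite IH. Qed.

Lemma rpow_ge_0 x p : 0 <= rpow x p.
Proof. unfold rpow. destruct (Rlt_dec 0 x); [left; apply exp_pos|lra]. Qed.

Lemma rpow_0 p : rpow 0 p = 0.
Proof. unfold rpow. destruct (Rlt_dec 0 0); lra. Qed.

Lemma rpow_pos x p : 0 < x -> 0 < rpow x p.
Proof. intros h. unfold rpow. destruct (Rlt_dec 0 x); [apply exp_pos|lra]. Qed.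

Lemma rpow_le x y p : 0 < p -> x <= y -> rpow x p <= rpow y p.
Proof.
  intros hp h. unfold rpow at 1. destruct (Rlt_dec 0 x) as [hx|hx]; [|apply rpow_ge_0].
  unfold rpow. destruct (Rlt_dec 0 y); [|lra].
  apply Rle_Rpower_l; lra.
Qed.

Lemma rpow_rpow x p q : 0 <= x -> p * q = 1 -> rpow (rpow x p) q = x.
Proof.
  intros hx h. destruct hx as [hx|<-]; [|now rewrite rpow_0, rpow_0].
  unfold rpow. destruct (Rlt_dec 0 x); [|lra].
  destruct (Rlt_dec 0 (Rpower x p)) as [_|n]; [|destruct n; apply exp_pos].
  now rewrite Rpower_mult, h, Rpower_1.
Qed.

(** Write z^p = z z^(p-1) and use that z^(p-1) is monotone. For p = 1 the exponent is 0, outside the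
    range of [rpow_le], so that case is apart. *)
Lemma rpow_superadditive x y p : 1 <= p -> 0 <= x -> 0 <= y ->
  rpow x p + rpow y p <= rpow (x + y) p.
Proof.
  intros hp hx hy.
  assert (e : forall z, 0 <= z -> rpow z p = z * rpow z (p - 1)).
  { intros z [hz| <-]; [|rewrite rpow_0; ring]. unfold rpow. destruct (Rlt_dec 0 z); [|lra].
    rewrite <- (Rpower_1 z) at 2 by trivial. rewrite <- Rpower_plus. f_equal; ring. }
  assert (hmono : forall a b, 0 <= a -> 0 <= b -> a * rpow a (p - 1) <= a * rpow (a + b) (p - 1)).
  { intros a b ha hb. destruct hp as [hp| <-].
    - apply Rmult_le_compat_l; trivial. apply rpow_le; lra.
    - destruct ha as [ha| <-]; [|lra]. apply Rmult_le_compat_l; [lra|]. unfold rpow.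
      replace (1 - 1) with 0 by ring.
      destruct (Rlt_dec 0 a); [|lra]. destruct (Rlt_dec 0 (a + b)); [|lra].
      rewrite !Rpower_O by trivial. lra. }
  rewrite !e by lra.
  pose proof (hmono x y hx hy). pose proof (hmono y x hy hx) as h.
  rewrite (Rplus_comm y x) in h. rewrite Rmult_plus_distr_r. lra.
Qed.

Definition lp_sum (p : R) (a : Z -> R) (F : list Z) : R :=
  iter Rplus 0 F (fun n => rpow (Rabs (a n)) p).

Lemma lp_norm_le (p : R) (a : Z -> R) (M : R) : 0 < p -> 0 <= M ->
  (forall F, NoDup F -> lp_sum p a F <= rpow M p) -> Rbar_le (lp_norm p a) M.
Proof.
  intros hp hM h. apply Rbar_lub_le. intros r [F [hF ->]]. simpl.
  rewrite <- (rpow_rpow M p (/ p)) by (trivial; field; lra).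
  apply rpow_le; [now apply Rinv_0_lt_compat|now apply h].
Qed.

Lemma lp_norm_ge_0 (p : R) (a : Z -> R) : Rbar_le 0 (lp_norm p a).
Proof.
  apply Rbar_lub_ub. exists nil. split; [constructor|]. simpl. now rewrite rpow_0.
Qed.

Lemma lp_sum_le (p : R) (a : Z -> R) (r : R) : 0 < p -> Rbar_le (lp_norm p a) r ->
  0 <= r /\ forall F, NoDup F -> lp_sum p a F <= rpow r p.
Proof.
  intros hp h. assert (hr : 0 <= r) by exact (Rbar_le_trans _ _ _ (lp_norm_ge_0 p a) h).
  split; trivial. intros F hF.
  assert (hs : 0 <= lp_sum p a F) by (apply iter_Rplus_ge_0; intros; apply rpow_ge_0).
  rewrite <- (rpow_rpow (lp_sum p a F) (/ p) p) by (trivial; field; lra).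
  apply rpow_le; trivial.
  assert (h' : Rbar_le (Finite (rpow (lp_sum p a F) (/ p))) r); [|exact h'].
  eapply Rbar_le_trans; [|exact h]. apply Rbar_lub_ub. now exists F.
Qed.

(** If infinitely many entries exceeded [eps], then k of them would force k eps^p <= r^p for every
    k. Here p must be finite. *)
Lemma lp_to_zero (p : R) (a : Z -> R) (r : R) : 0 < p -> Rbar_le (lp_norm p a) r ->
  forall eps, 0 < eps -> exists N, forall n, (N <= Z.abs_nat n)%nat -> Rabs (a n) <= eps.
Proof.
  intros hp hr eps he. destruct (lp_sum_le p a r hp hr) as [_ h].
  apply NNPP; intros hn.
  assert (hbig : forall k, exists F, NoDup F /\ INR k * rpow eps p <= lp_sum p a F).
  { induction k as [|k [F [hF hk]]].
    - exists nil. split; [constructor|]. unfold lp_sum; simpl. lra.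
    (* The next large entry is taken beyond all indices in [F], which keeps the list free of
       repetitions. *)
    - assert (hF' : exists N, forall n, In n F -> (Z.abs_nat n < N)%nat).
      { clear. induction F as [|x F [N hN]]; [now exists O|].
        exists (S (N + Z.abs_nat x)). intros n [->|hn]; [lia|]. specialize (hN n hn). lia. }
      destruct hF' as [N hN].
      assert (hx : exists n, (N <= Z.abs_nat n)%nat /\ eps < Rabs (a n)).
      { apply NNPP; intros hx. apply hn. exists N. intros n hn'. apply Rnot_lt_le.
        intros hlt. apply hx. now exists n. }
      destruct hx as [n [hn1 hn2]]. exists (n :: F). split.
      + constructor; trivial. intros hin. specialize (hN n hin). lia.
      + unfold lp_sum in *; simpl iter. rewrite S_INR.
        pose proof (rpow_le eps (Rabs (a n)) p hp (Rlt_le _ _ hn2)). lra. }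
  pose proof (rpow_pos eps p he) as hpos.
  destruct (INR_unbounded (rpow r p / rpow eps p)) as [k hk].
  destruct (hbig k) as [F [hF hkF]]. specialize (h F hF).
  apply Rmult_lt_compat_r with (r := rpow eps p) in hk; trivial.
  unfold Rdiv in hk. rewrite Rmult_assoc, Rinv_l, Rmult_1_r in hk by lra. lra.
Qed.

(** The exceptional indices are charged to a bump function [e] supported on them, whose sum over a
    list without repetitions is at most 2d. *)
Lemma iter_two_points (F : list Z) (f g : Z -> R) (m1 m2 : Z) (d : R) :
  NoDup F -> 0 <= d -> (forall n, n <> m1 -> n <> m2 -> f n <= g n) ->
  (forall n, 0 <= g n) -> f m1 <= d -> f m2 <= d ->
  iter Rplus 0 F f <= iter Rplus 0 F g + (d + d).
Proof.
  intros hF hd h hg h1 h2.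
  set (e := fun n => if Z.eq_dec n m1 then d else if Z.eq_dec n m2 then d else 0).
  apply Rle_trans with (iter Rplus 0 F (fun n => g n + e n)).
  - apply iter_Rplus_le. intros n _. specialize (hg n). unfold e.
    destruct (Z.eq_dec n m1) as [->|n1]; [lra|].
    destruct (Z.eq_dec n m2) as [->|n2]; [lra|]. specialize (h n n1 n2). lra.
  - rewrite iter_Rplus_plus. apply Rplus_le_compat_l.
    eapply Rle_trans; [apply (iter_Rplus_incl F (m1 :: m2 :: nil)); trivial|].
    + intros n. unfold e. destruct (Z.eq_dec n m1); [lra|]. destruct (Z.eq_dec n m2); lra.
    + intros n _ hn. unfold e. destruct (Z.eq_dec n m1) as [->|]; [destruct hn; now left|].
      destruct (Z.eq_dec n m2) as [->|]; [destruct hn; right; now left|]. trivial.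
    + simpl. unfold e. destruct (Z.eq_dec m1 m1); [|easy].
      destruct (Z.eq_dec m2 m1); [lra|]. destruct (Z.eq_dec m2 m2); [lra|easy].
Qed.

(** Superadditivity of the p-th power takes the place of Minkowski's inequality: r^p + 2 eps^p <= (r
    + 2 eps)^p. *)
Lemma lp_norm_two_points (p : R) (a a' : Z -> R) (m1 m2 : Z) (r eps : R) :
  1 <= p -> 0 <= eps -> Rbar_le (lp_norm p a) r ->
  (forall n, n <> m1 -> n <> m2 -> Rabs (a' n) <= Rabs (a n)) ->
  Rabs (a' m1) <= eps -> Rabs (a' m2) <= eps ->
  Rbar_le (lp_norm p a') (r + (eps + eps)).
Proof.
  intros hp he hr h h1 h2. assert (hp' : 0 < p) by lra.
  destruct (lp_sum_le p a r hp' hr) as [hr0 hs].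
  apply (lp_norm_le p a' (r + (eps + eps))); try lra. intros F hF.
  apply Rle_trans with (lp_sum p a F + (rpow eps p + rpow eps p)).
  - apply (iter_two_points F _ _ m1 m2); trivial.
    + apply rpow_ge_0.
    + intros n n1 n2. apply rpow_le; auto.
    + intros; apply rpow_ge_0.
    + now apply rpow_le.
    + now apply rpow_le.
  - specialize (hs F hF).
    pose proof (rpow_superadditive eps eps p hp he he).
    pose proof (rpow_superadditive r (eps + eps) p hp hr0 ltac:(lra)). lra.
Qed.

Lemma lp_norm_finite_support (p : R) (a : Z -> R) (N : Z) : 0 < p ->
  (forall n, (N < Z.abs n)%Z -> a n = 0) -> is_finite (lp_norm p a).
Proof.
  intros hp h.
  (* The interval [-N, N]; it is empty for negative N, and then [h] makes [a] vanish everywhere. *)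
  set (G := map (fun k => (Z.of_nat k - N)%Z) (List.seq 0 (Z.to_nat (2 * N + 1)))).
  assert (hle : Rbar_le (lp_norm p a) (rpow (lp_sum p a G) (/ p))).
  { apply lp_norm_le; trivial; [apply rpow_ge_0|]. intros F hF.
    rewrite rpow_rpow.
    - apply iter_Rplus_incl; trivial; [intros; apply rpow_ge_0|].
      intros n _ hn. rewrite h; [rewrite Rabs_R0; apply rpow_0|].
      apply Znot_ge_lt; intros hN. apply hn. apply in_map_iff.
      exists (Z.to_nat (n + N)). split; [lia|]. apply in_seq. lia.
    - apply iter_Rplus_ge_0. intros; apply rpow_ge_0.
    - field; lra. }
  pose proof (lp_norm_ge_0 p a) as h0. destruct (lp_norm p a); easy.
Qed.

Lemma lp_norm_ext (p : R) (a b : Z -> R) : (forall n, a n = b n) -> lp_norm p a = lp_norm p b.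
Proof.
  intros h. f_equal. now apply functional_extensionality.
Qed.

Lemma NoDup_map_translate (F : list Z) (k : Z) : NoDup F -> NoDup (map (fun n => (n + k)%Z) F).
Proof. intros h. apply NoDup_map_NoDup_ForallPairs; trivial. intros x y _ _; lia. Qed.

(** An inequality for all translations is enough for isometry, since the inverse of a translation is
    another one. *)
Lemma lp_norm_translate_le (p : R) (a : Z -> R) (k : Z) :
  Rbar_le (lp_norm p (fun n => a (n + k)%Z)) (lp_norm p a).
Proof.
  apply Rbar_lub_le. intros r [F [hF ->]]. apply Rbar_lub_ub.
  exists (map (fun n => (n + k)%Z) F). split; [now apply NoDup_map_translate|].
  now rewrite iter_map.
Qed.

Lemma lp_norm_shift (p : R) (a : Z -> R) : lp_norm p (shiftZ a) = lp_norm p a.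
Proof.
  apply Rbar_le_antisym; [apply (lp_norm_translate_le p a (-1))|].
  eapply Rbar_le_trans; [|apply (lp_norm_translate_le p (shiftZ a) 1)].

  rewrite (lp_norm_ext p (fun n => shiftZ a (n + 1)) a); [apply Rbar_le_refl|].
  intros n. unfold shiftZ. f_equal. lia.
Qed.

Lemma UC_norm_translate_le {V : CompleteNormedModule C_AbsRing} (b : Z -> V) (k : Z) :
  Rbar_le (UC_norm (fun n => b (n + k)%Z)) (UC_norm b).
Proof.
  apply Rbar_lub_le. intros r [F [lam [hF [hlam ->]]]]. apply Rbar_lub_ub.
  exists (map (fun n => (n + k)%Z) F), (fun n => lam (n - k)%Z).
  split; [now apply NoDup_map_translate|]. split; [intros; apply hlam|].
  rewrite iter_map. do 3 f_equal. extensionality n. do 2 f_equal. lia.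
Qed.

Lemma UC_norm_shift {V : CompleteNormedModule C_AbsRing} (b : Z -> V) :
  UC_norm (shiftZ b) = UC_norm b.
Proof.
  apply Rbar_le_antisym; [apply (UC_norm_translate_le b (-1))|].
  eapply Rbar_le_trans; [|apply (UC_norm_translate_le (shiftZ b) 1)].
  replace (fun n => shiftZ b (n + 1)%Z) with b; [apply Rbar_le_refl|].
  extensionality n. unfold shiftZ. f_equal. lia.
Qed.

(** The shift moves the entry at -1 from the negative half to the start of the other half, so the
    two sums change by c(-1) in opposite directions. *)
Lemma ex_sumZ_shift {V : NormedModule C_AbsRing} (c : Z -> V) : ex_sumZ c -> ex_sumZ (shiftZ c).
Proof.
  intros [x [s [t [hs [ht _]]]]].
  exists (plus (plus s (c (-1)%Z)) (plus t (opp (c (-1)%Z)))).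
  exists (plus s (c (-1)%Z)), (plus t (opp (c (-1)%Z))). repeat split.
  - apply is_series_decr_1. unfold shiftZ at 2. simpl (Z.of_nat 0 - 1)%Z.
    assert (e : plus (plus s (c (-1)%Z)) (opp (c (-1)%Z)) = s) by lin_C V. rewrite e.
    eapply is_series_ext; [|exact hs]. intros k. unfold shiftZ. f_equal. lia.
  - assert (h : is_series (fun k => c (- Z.of_nat (S (S k)))%Z) (plus t (opp (c (-1)%Z)))).
    { apply (is_series_incr_1 (fun k => c (- Z.of_nat (S k))%Z)).
      assert (e : plus (plus t (opp (c (-1)%Z))) (c (-1)%Z) = t) by lin_C V.
      simpl (- Z.of_nat 1)%Z. rewrite e. exact ht. }
    eapply is_series_ext; [|exact h]. intros k. unfold shiftZ. f_equal. lia.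
Qed.

Lemma in_UC_shift {V : CompleteNormedModule C_AbsRing} (b : Z -> V) :
  in_UC b -> in_UC (shiftZ b).
Proof.
  intros h lam hlam.
  destruct (ex_sumZ_shift _ (h (fun n => lam (n + 1)%Z) (fun n => hlam _))) as [x hx].
  exists x. eapply is_sumZ_ext; [|exact hx]. intros n. unfold shiftZ. do 2 f_equal. lia.
Qed.

(** With all multipliers equal to 1 both halves of the series converge, hence their terms tend to
    0. *)
Lemma in_UC_to_zero {V : CompleteNormedModule C_AbsRing} (b : Z -> V) : in_UC b ->
  forall eps, 0 < eps -> exists N, forall n, (N <= Z.abs_nat n)%nat -> norm (b n) <= eps.
Proof.
  intros h eps he.
  destruct (h (fun _ => RtoC 1)) as [x [s [t [hs [ht _]]]]]; [intros; rewrite Cmod_1; lra|].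
  destruct (is_series_terms_to_zero _ _ hs eps he) as [N1 hN1].
  destruct (is_series_terms_to_zero _ _ ht eps he) as [N2 hN2].
  exists (S (N1 + N2)). intros n hn.
  destruct (Z_le_dec 0 n) as [h0|h0].
  - specialize (hN1 (Z.abs_nat n) ltac:(lia)). cbv beta in hN1. rewrite (norm_scal_C (V := V)), Cmod_1, Rmult_1_l in hN1.
    replace (Z.of_nat (Z.abs_nat n)) with n in hN1 by lia. exact hN1.
  - specialize (hN2 (pred (Z.abs_nat n)) ltac:(lia)). cbv beta in hN2. rewrite (norm_scal_C (V := V)), Cmod_1, Rmult_1_l in hN2.
    replace (- Z.of_nat (S (pred (Z.abs_nat n))))%Z with n in hN2 by lia. exact hN2.
Qed.

Lemma in_UC_finite_support {V : CompleteNormedModule C_AbsRing} (b : Z -> V) (N : Z) :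
  (forall n, (N < Z.abs n)%Z -> b n = zero) -> in_UC b.
Proof.
  intros h lam hlam. eexists. apply (is_sumZ_finite _ (Z.to_nat N)).
  - intros n hn. rewrite h by lia. apply (scal_zero_r (V := V)).
  - intros n hn. rewrite h by lia. apply (scal_zero_r (V := V)).
Qed.

Lemma UC_norm_ge_0 {V : CompleteNormedModule C_AbsRing} (b : Z -> V) : Rbar_le 0 (UC_norm b).
Proof.
  apply Rbar_lub_ub. exists nil, (fun _ => RtoC 0). split; [constructor|]. split.
  - intros; rewrite Cmod_0; lra.
  - simpl. f_equal. symmetry. exact (norm_zero (V := V)).
Qed.

Lemma iter_plus_plus {V : NormedModule C_AbsRing} {I : Type} (F : list I) (f g : I -> V) :
  iter plus zero F (fun n => plus (f n) (g n)) = plus (iter plus zero F f) (iter plus zero F g).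
Proof.
  induction F as [|x F IH]; [symmetry; apply plus_zero_l|].
  cbn [iter]. rewrite IH. apply plus_swap4.
Qed.

Lemma norm_iter_plus_le {V : NormedModule C_AbsRing} {I : Type} (F : list I) (f : I -> V) :
  norm (iter plus zero F f) <= iter Rplus 0 F (fun n => norm (f n)).
Proof.
  induction F as [|x F IH]; simpl; [right; apply norm_zero|].
  eapply Rle_trans; [apply (norm_triangle (V := V))|]. now apply Rplus_le_compat_l.
Qed.

(** Multipliers may be 0, so setting them to 0 at altered or deleted entries leaves an admissible
    sum for [b]; what is left over comes from m1 and m2 alone. *)
Lemma UC_norm_two_points {V : CompleteNormedModule C_AbsRing} (b b' : Z -> V)
  (m1 m2 : Z) (r eps : R) :
  0 <= eps -> Rbar_le (UC_norm b) r ->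
  (forall n, n <> m1 -> n <> m2 -> b' n = b n \/ b' n = zero) ->
  norm (b' m1) <= eps -> norm (b' m2) <= eps ->
  Rbar_le (UC_norm b') (r + (eps + eps)).
Proof.
  intros he hr h h1 h2. apply Rbar_lub_le. intros q [F [lam [hF [hlam ->]]]]. simpl.
  set (P := fun n => n <> m1 /\ n <> m2 /\ b' n = b n).
  set (lam' := fun n => if excluded_middle_informative (P n) then lam n else RtoC 0).
  set (d := fun n => if excluded_middle_informative (P n) then zero else scal (lam n) (b' n) : V).
  assert (e : iter plus zero F (fun n => scal (lam n) (b' n)) =
    plus (iter plus zero F (fun n => scal (lam' n) (b n))) (iter plus zero F d)).
  { rewrite <- (iter_plus_plus (V := V)). f_equal.
    extensionality n.
    unfold lam', d. destruct (excluded_middle_informative (P n)) as [[_ [_ ->]]|_].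
    - symmetry; apply plus_zero_r.
    - lin_C V. }
  eapply Rle_trans; [right; exact (f_equal norm e)|].
  eapply Rle_trans; [apply (norm_triangle (V := V))|]. apply Rplus_le_compat.
  - assert (h' : Rbar_le (Finite (norm (iter plus zero F (fun n => scal (lam' n) (b n))))) r);
      [|exact h'].
    eapply Rbar_le_trans; [|exact hr]. apply Rbar_lub_ub. exists F, lam'.
    split; [trivial|split; [|trivial]]. intros n. unfold lam'.
    destruct (excluded_middle_informative (P n)); [apply hlam|rewrite Cmod_0; lra].
  - eapply Rle_trans; [apply (norm_iter_plus_le (V := V))|].
    assert (hd : forall n, norm (b' n) <= eps -> norm (d n) <= eps).
    { intros n hn. unfold d. destruct (excluded_middle_informative (P n)).
      - eapply Rle_trans; [right; exact (norm_zero (V := V))|exact he].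
      - rewrite (norm_scal_C (V := V)). rewrite <- (Rmult_1_l eps).
        apply Rmult_le_compat; auto; [apply Cmod_ge_0|apply norm_ge_0]. }
    eapply Rle_trans; [apply (iter_two_points F _ (fun _ => 0) m1 m2 eps); trivial|].
    + intros n n1 n2. unfold d. destruct (excluded_middle_informative (P n)) as [|hP].
      * right. apply (norm_zero (V := V)).
      * destruct (h n n1 n2) as [hb|hb]; [destruct hP; now repeat split|].
        rewrite hb. right. etransitivity; [|exact (norm_zero (V := V))].
        f_equal. exact (scal_zero_r (V := V) (lam n)).
    + intros; lra.
    + auto.
    + auto.
    + rewrite iter_const. lra.
Qed.

(** * The real and the plus-minus method *)

Definition cap_scal {B : BanachPair} (a : C) (x : cap B) : cap B :=
  {| cap_at := fun j => scal a (x j);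
     cap_eq := eq_trans (bp_emb_scal B false a (x false))
       (eq_trans (f_equal (scal a) (cap_eq x)) (eq_sym (bp_emb_scal B true a (x true)))) |}.

Lemma cap_in_sum_scal {B : BanachPair} (a : C) (x : cap B) :
  cap_in_sum (cap_scal a x) = scal a (cap_in_sum x).
Proof. apply sumsp_eq. apply bp_emb_scal. Qed.

Lemma norm_weighted {B : BanachPair} (w : Z -> R) (c : Z -> cap B) j n :
  0 <= w n -> norm (weighted w c j n) = w n * norm (c n j).
Proof. apply (norm_scal_RtoC (V := B j)). Qed.

(** Multiplying the maximum through exhibits the J-functional sequence as the larger of the two
    weighted norms, the quantities that [truncate_representation] controls. *)
Lemma Rmax_weights (theta L : R) (n : Z) (a b : R) :
  exp (- theta * IZR n * L) * Rmax a (exp (IZR n * L) * b) =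
  Rmax (geom_weight theta L false n * a) (geom_weight theta L true n * b).
Proof.
  rewrite <- RmaxRmult by (left; apply exp_pos). unfold geom_weight, idx.
  rewrite <- Rmult_assoc, <- exp_plus.
  f_equal; f_equal; f_equal; ring.
Qed.

(** Both J-norms are instances, with L = ln q. The J-sequence dominates the weighted norms in B_0
    and in B_1, so its l^p bound yields the decay required for the cut. *)
Lemma J_norm_finite_support (B : BanachPair) (theta q p : R) (x : cap B) :
  0 < theta < 1 -> 1 < q -> 1 <= p ->
  J_norm q theta p (cap_in_sum x) =
    Rbar_glb (fun r => exists c : Z -> cap B,
      finitely_supported c /\
      represents (fun _ => 1) c (cap_in_sum x) /\
      r = lp_norm p (fun n => Rpower q (- theta * IZR n) * Jfun (Rpower q (IZR n)) (c n))).
Proof.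
  intros ht hq hp. assert (hp' : 0 < p) by lra.
  set (L := ln q). assert (hL : 0 < L) by (unfold L; rewrite <- ln_1; apply ln_increasing; lra).
  assert (hJ : forall n (y : cap B), Rpower q (- theta * IZR n) * Jfun (Rpower q (IZR n)) y =
    Rmax (geom_weight theta L false n * norm (y false)) (geom_weight theta L true n * norm (y true))).
  { intros n y. apply Rmax_weights. }
  assert (hJ0 : forall n y, 0 <= Rmax (geom_weight theta L false n * norm ((y : cap B) false))
      (geom_weight theta L true n * norm (y true))).
  { intros n y. eapply Rle_trans; [|apply Rmax_l].
    apply Rmult_le_pos; [left; apply exp_pos|apply norm_ge_0]. }
  assert (hJj : forall n (y : cap B) j, geom_weight theta L j n * norm (y j) <=
      Rmax (geom_weight theta L false n * norm (y false)) (geom_weight theta L true n * norm (y true))).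
  { intros n y [|]; [apply Rmax_r|apply Rmax_l]. }
  apply Rbar_glb_eq_approx.
  - intros r [c [[N hN] [hr ->]]]. eexists. split; [|apply Rbar_le_refl].
    exists c. split; [|now split]. intros j.
    apply (lp_norm_finite_support p _ N hp'). intros n hn.
    unfold weighted. rewrite hN by trivial.
    etransitivity; [|exact (norm_zero (V := B j))]. f_equal. exact (scal_zero_r (V := B j) _).
  - intros r [c [_ [_ ->]]]. apply Rbar_ge_0_not_m_infty, lp_norm_ge_0.
  - intros r [c [_ [hrep hr]]] eps he.
    assert (hle : Rbar_le (lp_norm p (fun n => Rpower q (- theta * IZR n) *
        Jfun (Rpower q (IZR n)) (c n))) r) by (rewrite <- hr; apply Rbar_le_refl).
    assert (he2 : 0 < eps / 2) by lra.
    destruct (truncate_representation B theta L x c ht hL hrep) with (eps := eps / 2)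
      as [c' [m [hfin [hrep' [hpt hout]]]]]; trivial.
    { intros j e hpos. destruct (lp_to_zero p _ r hp' hle e hpos) as [N hN].
      exists N. intros n hn. specialize (hN n hn). rewrite hJ in hN.
      rewrite Rabs_right in hN by (apply Rle_ge, hJ0).
      eapply Rle_trans; [apply hJj|exact hN]. }
    eexists. split; [exists c'; split; [trivial|split; [trivial|reflexivity]]|].
    (* One half for each of the two new entries. *)
    replace (r + eps) with (r + (eps / 2 + eps / 2)) by field.
    apply (lp_norm_two_points p _ _ m (- m - 1) r (eps / 2) hp (Rlt_le _ _ he2) hle).
    + intros n h1 h2. rewrite !hJ, !Rabs_right by (apply Rle_ge, hJ0).
      destruct (hout n h1 h2) as [h|h].
      * rewrite !h. apply Rle_refl.
      * rewrite !h, !bp_norm_zero, !Rmult_0_r, Rmax_left by lra. apply hJ0.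
    + rewrite hJ, Rabs_right by (apply Rle_ge, hJ0). apply Rmax_lub; apply hpt; now left.
    + rewrite hJ, Rabs_right by (apply Rle_ge, hJ0). apply Rmax_lub; apply hpt; now right.
Qed.

(** The definition is in terms of b_n, the claim in terms of c_n = e^(theta n) b_n. [hw] and [hr]
    carry the weighted norms and the represented vector across this substitution; then the cut with
    L = 1 applies. *)
Lemma real_norm_finite_support (B : BanachPair) (theta p : R) (x : cap B) :
  0 < theta < 1 -> 1 <= p ->
  real_norm theta p (cap_in_sum x) =
    Rbar_glb (fun r => exists c : Z -> cap B,
      finitely_supported c /\
      represents (fun _ => 1) c (cap_in_sum x) /\
      r = max_j (fun j =>
            lpV_norm p (weighted (fun n => exp ((idx j - theta) * IZR n)) c j))).
Proof.
  intros ht hp. assert (hp' : 0 < p) by lra.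
  assert (hw : forall (b c : Z -> cap B),
    (forall n j, c n j = scal (RtoC (exp (theta * IZR n))) (b n j)) ->
    forall j n, norm (weighted (fun n => exp ((idx j - theta) * IZR n)) c j n) =
      norm (weighted (fun n => exp (idx j * IZR n)) b j n)).
  { intros b c h j n. rewrite !norm_weighted by (left; apply exp_pos).
    rewrite h, (norm_scal_RtoC (V := B j)), <- Rmult_assoc, <- exp_plus by (left; apply exp_pos).
    f_equal. f_equal. ring. }
  assert (hr : forall (b c : Z -> cap B),
    (forall n, cap_in_sum (c n) = scal (RtoC (exp (theta * IZR n))) (cap_in_sum (b n))) ->
    represents (fun n => exp (theta * IZR n)) b (cap_in_sum x) <->
    represents (fun _ => 1) c (cap_in_sum x)).
  { intros b c h. rewrite represents_one. split; apply is_sumZ_ext; intros n; now rewrite h. }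
  apply Rbar_glb_eq_approx.
  - intros r [c [[N hN] [hrep ->]]].
    set (b := fun n => cap_scal (RtoC (exp (- theta * IZR n))) (c n)).
    assert (hcb : forall n j, c n j = scal (RtoC (exp (theta * IZR n))) (b n j)).
    { intros n j. simpl. rewrite scal_assoc. symmetry.
      change (mult (RtoC (exp (theta * IZR n))) (RtoC (exp (- theta * IZR n)))) with
        (RtoC (exp (theta * IZR n)) * RtoC (exp (- theta * IZR n)))%C.
      rewrite <- RtoC_mult, <- exp_plus.
      replace (theta * IZR n + - theta * IZR n) with 0 by ring.
      rewrite exp_0. exact (scal_one (c n j)). }
    assert (hbc : forall n, cap_in_sum (c n) = scal (RtoC (exp (theta * IZR n))) (cap_in_sum (b n))).
    { intros n. rewrite <- cap_in_sum_scal. apply sumsp_eq. simpl. f_equal. apply hcb. }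
    eexists. split; [|apply Rbar_le_refl].
    exists b. split; [|split].
    + intros j. apply (lp_norm_finite_support p _ N hp'). intros n hn.
      unfold weighted, b, cap_scal. cbn [cap_at]. rewrite hN by trivial.
      etransitivity; [|exact (norm_zero (V := B j))]. f_equal.
      etransitivity; [|exact (scal_zero_r (V := B j) (RtoC (exp (idx j * IZR n))))].
      f_equal. exact (scal_zero_r (V := B j) _).
    + now apply (hr b c hbc).
    + apply max_j_ext. intros j. apply lp_norm_ext. intros n. now apply hw.
  - intros r [b [_ [_ ->]]]. apply Rbar_ge_0_not_m_infty.
    refine (Rbar_le_trans _ _ _ (lp_norm_ge_0 p _) (max_j_ub (fun j => lpV_norm p _) true)).
  - intros r [b [_ [hrep hmax]]] eps he.
    set (c := fun n => cap_scal (RtoC (exp (theta * IZR n))) (b n)).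
    apply (hr b c (fun n => cap_in_sum_scal _ _)) in hrep.
    assert (hle : forall j, Rbar_le (lp_norm p (fun n => geom_weight theta 1 j n * norm (c n j))) r).
    { intros j. rewrite hmax. refine (Rbar_le_trans _ _ _ _ (max_j_ub (fun j => lpV_norm p _) j)).
      unfold lpV_norm. erewrite lp_norm_ext; [apply Rbar_le_refl|]. intros n.
      refine (eq_trans _ (hw b c (fun n j => eq_refl) j n)). rewrite norm_weighted by (left; apply exp_pos).
      unfold geom_weight. now rewrite Rmult_1_l. }
    assert (hpos : forall j n (y : cap B), 0 <= geom_weight theta 1 j n * norm (y j)).
    { intros j n y. apply Rmult_le_pos; [left; apply exp_pos|apply norm_ge_0]. }
    assert (he2 : 0 < eps / 2) by lra.
    destruct (truncate_representation B theta 1 x c ht Rlt_0_1 hrep) with (eps := eps / 2)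
      as [c' [m [hfin [hrep' [hpt hout]]]]]; trivial.
    { intros j e hpe. destruct (lp_to_zero p _ r hp' (hle j) e hpe) as [N hN].
      exists N. intros n hn. specialize (hN n hn). now rewrite Rabs_right in hN by (apply Rle_ge, hpos). }
    eexists. split; [exists c'; split; [trivial|split; [trivial|reflexivity]]|].
    replace (r + eps) with (r + (eps / 2 + eps / 2)) by field.
    apply max_j_le. intros j. unfold lpV_norm.
    rewrite (lp_norm_ext p _ (fun n => geom_weight theta 1 j n * norm (c' n j))).
    2:{ intros n. rewrite norm_weighted by (left; apply exp_pos).
        unfold geom_weight. now rewrite Rmult_1_l. }
    apply (lp_norm_two_points p _ _ m (- m - 1) r (eps / 2) hp (Rlt_le _ _ he2) (hle j)).
    + intros n h1 h2. rewrite !Rabs_right by (apply Rle_ge, hpos).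
      destruct (hout n h1 h2) as [h|h]; rewrite h.
      * apply Rle_refl.
      * rewrite bp_norm_zero, Rmult_0_r. apply hpos.
    + rewrite Rabs_right by (apply Rle_ge, hpos). apply hpt; now left.
    + rewrite Rabs_right by (apply Rle_ge, hpos). apply hpt; now right.
Qed.

(** Membership in UC makes the weighted entries tend to 0, which permits the cut;
    [UC_norm_two_points] then bounds the new norm in each space. *)
Lemma peetre_norm_finite_support (B : BanachPair) (theta : R) (x : cap B) :
  0 < theta < 1 ->
  peetre_norm theta (cap_in_sum x) =
    Rbar_glb (fun r => exists c : Z -> cap B,
      finitely_supported c /\
      represents (fun _ => 1) c (cap_in_sum x) /\
      r = max_j (fun j =>
            UC_norm (weighted (fun n => Rpower 2 ((idx j - theta) * IZR n)) c j))).
Proof.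
  intros ht. set (L := ln 2).
  assert (hL : 0 < L) by (unfold L; rewrite <- ln_1; apply ln_increasing; lra).
  assert (hw : forall j n, Rpower 2 ((idx j - theta) * IZR n) = geom_weight theta L j n).
  { intros j n. unfold Rpower, geom_weight. f_equal. fold L. ring. }
  assert (hn : forall j n (c : Z -> cap B),
    norm (weighted (fun n => Rpower 2 ((idx j - theta) * IZR n)) c j n) =
    geom_weight theta L j n * norm (c n j)).
  { intros j n c. rewrite norm_weighted by (left; apply exp_pos). now rewrite hw. }
  apply Rbar_glb_eq_approx.
  - intros r [c [[N hN] [hr ->]]]. eexists. split; [|apply Rbar_le_refl].
    exists c. split; [|now split]. intros j. apply (in_UC_finite_support _ N).
    intros n hn'. unfold weighted. rewrite hN by trivial. exact (scal_zero_r (V := B j) _).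
  - intros r [c [_ [_ ->]]]. apply Rbar_ge_0_not_m_infty.
    refine (Rbar_le_trans _ _ _ (UC_norm_ge_0 _) (max_j_ub (fun j => UC_norm _) true)).
  - intros r [c [hUC [hrep hr]]] eps he.
    assert (he2 : 0 < eps / 2) by lra.
    destruct (truncate_representation B theta L x c ht hL hrep) with (eps := eps / 2)
      as [c' [m [hfin [hrep' [hpt hout]]]]]; trivial.
    { intros j e hpe. destruct (in_UC_to_zero _ (hUC j) e hpe) as [N hN].
      exists N. intros n hn'. specialize (hN n hn'). now rewrite hn in hN. }
    eexists. split; [exists c'; split; [trivial|split; [trivial|reflexivity]]|].
    replace (r + eps) with (r + (eps / 2 + eps / 2)) by field.
    apply max_j_le. intros j.
    apply (UC_norm_two_points (weighted (fun n => Rpower 2 ((idx j - theta) * IZR n)) c j)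
      _ m (- m - 1)); [lra| | | |].
    + rewrite hr. exact (max_j_ub (fun j => UC_norm
        (weighted (fun n => Rpower 2 ((idx j - theta) * IZR n)) c j)) j).
    + intros n h1 h2. unfold weighted.
      destruct (hout n h1 h2) as [h|h]; rewrite h; [now left|right].
      exact (scal_zero_r (V := B j) _).
    + rewrite hn. apply hpt; now left.
    + rewrite hn. apply hpt; now right.
Qed.

(** * The shift on l^p and UC *)

Lemma lpV_shift_isometry (V : CompleteNormedModule C_AbsRing) (p : R) :
  isometry_on (V := V) (in_lpV p) (lpV_norm p) shiftZ.
Proof.
  intros b hb. pose proof (lp_norm_shift p (fun n => norm (b n))) as h.
  split; [|exact h]. unfold in_lpV.
  change (lpV_norm p (shiftZ b)) with (lp_norm p (shiftZ (fun n => norm (b n)))).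
  rewrite h. exact hb.
Qed.

Lemma UC_shift_isometry (V : CompleteNormedModule C_AbsRing) :
  isometry_on (V := V) in_UC UC_norm shiftZ.
Proof. intros b hb. split; [now apply in_UC_shift|apply UC_norm_shift]. Qed.

(** * Completeness of B_0 + B_1 *)

(** Radii 2^(-k) make successive differences summable. Decompositions of comparable size turn them
    into absolutely convergent series in B_0 and in B_1, whose sums together give the limit. *)
Lemma sumsp_cauchy_lim (B : BanachPair) (F : (sumsp B -> Prop) -> Prop) :
  ProperFilter F -> cauchy (T := sumsp_UniformSpace B) F ->
  exists x, forall eps : posreal, F (sumsp_ball B x eps).
Proof.
  intros HF hF.
  assert (hq : forall k, 0 < (/ 2) ^ k) by (intros; apply pow_lt; lra).
  destruct (choice (fun k x => F (sumsp_ball B x ((/ 2) ^ k)))) as [x hx].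
  { intros k. exact (hF (mkposreal _ (hq k))). }
  (* Two balls that belong to the proper filter intersect, so the centres are closer than the sum of
     the radii. *)
  assert (hd : forall k, exists b, decomposes B (sum_val B (minus (x (S k)) (x k))) b /\
    norm (b false) + norm (b true) < 2 * (/ 2) ^ k).
  { intros k. apply sumsp_norm_approx.
    destruct (filter_ex _ (filter_and _ _ (hx k) (hx (S k)))) as [y [h1 h2]].
    apply (sumsp_ball_sym B) in h2.
    pose proof (sumsp_ball_triangle B _ _ _ _ _ h1 h2) as h. unfold sumsp_ball in h.
    eapply Rlt_le_trans; [exact h|]. simpl. specialize (hq k). lra. }
  apply (choice (fun k b => decomposes B (sum_val B (minus (x (S k)) (x k))) b /\
    norm (b false) + norm (b true) < 2 * (/ 2) ^ k)) in hd.
  destruct hd as [b hb].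
  assert (hs : forall j, ex_series (fun k => b k j)).
  { intros j. apply (ex_series_le (V := B j) _ (fun k => 2 * (/ 2) ^ k)).
    - intros k. destruct (hb k) as [_ h].
      pose proof (norm_ge_0 (b k false)). pose proof (norm_ge_0 (b k true)).
      destruct j; simpl; lra.
    - apply (ex_series_scal_l 2 (fun k => (/ 2) ^ k)). apply ex_series_geom.
      rewrite Rabs_right; lra. }
  destruct (hs false) as [s0 h0], (hs true) as [s1 h1].
  set (l := plus (in_sum false s0) (in_sum true s1) : sumsp B).
  assert (hl : is_series (V := sumsp_NormedModule B) (fun k => minus (x (S k)) (x k)) l).
  { pose proof (is_series_plus _ _ _ _ (is_series_linear _ _ _ (is_linear_in_sum B false) h0)
      (is_series_linear _ _ _ (is_linear_in_sum B true) h1)) as h.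
    eapply is_series_ext; [|exact h]. intros k. apply sumsp_eq.
    destruct (hb k) as [hk _]. symmetry. exact hk. }
  (* The differences telescope, so the points [x k] tend to this vector. *)
  exists (plus (x O) l). intros eps.
  assert (he : 0 < eps / 2) by (destruct eps; simpl; lra).
  destruct (proj1 (filterlim_locally _ _) hl (mkposreal _ he)) as [N hN].
  destruct (pow_lt_1_zero (/ 2) ltac:(rewrite Rabs_right; lra) _ he) as [M hM].
  set (n := (N + M)%nat).
  specialize (hN n ltac:(lia)). specialize (hM (S n) ltac:(lia)).
  rewrite Rabs_right in hM by (left; apply hq).
  assert (hxn : forall n, sum_n (G := sumsp_AbelianMonoid B) (fun k => minus (x (S k)) (x k)) n = minus (x (S n)) (x O)).
  { clear. induction n as [|n IH]; [now rewrite sum_O|].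
    rewrite sum_Sn, IH. lin_C (sumsp_ModuleSpace B). }
  apply (filter_imp (sumsp_ball B (x (S n)) ((/ 2) ^ (S n)))); [|apply hx].
  intros y hy. replace (pos eps) with (eps / 2 + eps / 2) by field.
  apply (sumsp_ball_triangle B _ (x (S n))).
  - change (sumsp_ball B l (eps / 2) (sum_n (G := sumsp_AbelianMonoid B) (fun k => minus (x (S k)) (x k)) n)) in hN.
    rewrite hxn in hN. unfold sumsp_ball in *.
    replace (minus (x (S n)) (plus (x O) l)) with (minus (minus (x (S n)) (x O)) l)
      by lin_C (sumsp_ModuleSpace B). exact hN.
  - unfold sumsp_ball in *. lra.
Qed.

(** A total choice, unspecified on filters without a limit. It depends on the filter only as a
    predicate, so equivalent filters get the same value. *)
Definition sumsp_lim (B : BanachPair) (F : (sumsp B -> Prop) -> Prop) : sumsp B :=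
  epsilon (inhabits (sumsp_zero B)) (fun x => forall eps : posreal, F (sumsp_ball B x eps)).

Lemma sumsp_lim_close (B : BanachPair) (F1 F2 : (sumsp B -> Prop) -> Prop) :
  filter_le F1 F2 -> filter_le F2 F1 ->
  @close (sumsp_UniformSpace B) (sumsp_lim B F1) (sumsp_lim B F2).
Proof.
  intros h1 h2. replace F2 with F1.
  - apply close_refl.
  - extensionality P.
    apply propositional_extensionality. split; [apply h2|apply h1].
Qed.

Definition sumsp_CompleteNormedModule (B : BanachPair) : CompleteNormedModule C_AbsRing :=
  CompleteNormedModule.Pack C_AbsRing (sumsp B)
    (CompleteNormedModule.Class C_AbsRing (sumsp B)
       (NormedModule.class C_AbsRing (sumsp_NormedModule B))
       (CompleteSpace.Mixin (sumsp_UniformSpace B) (sumsp_lim B)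
          (fun F HF hF => epsilon_spec (inhabits (sumsp_zero B)) _ (sumsp_cauchy_lim B F HF hF))
          (sumsp_lim_close B)))
    (sumsp B).

(** * Goursat's theorem *)

Lemma Riemann_sum_linear {U V : NormedModule R_AbsRing} (L : U -> V) (f : R -> U) ptd :
  is_linear L -> Riemann_sum (fun t => L (f t)) ptd = L (Riemann_sum f ptd).
Proof.
  intros hL. apply (SF_cons_ind (fun ptd => Riemann_sum (fun t => L (f t)) ptd = L (Riemann_sum f ptd)));
    clear ptd.
  - intros x. symmetry. apply (linear_zero L hL).
  - intros h s IH. rewrite !Riemann_sum_cons, IH, (linear_plus L hL). f_equal.
    symmetry. apply (linear_scal L hL).
Qed.

(** Bounded linear maps commute with Riemann sums and with their limits. This carries integrals
    computed in B_j over to the sum. *)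
Lemma is_RInt_linear {U V : NormedModule R_AbsRing} (L : U -> V) (f : R -> U) (a b : R) (If : U) :
  is_linear L -> is_RInt f a b If -> is_RInt (fun t => L (f t)) a b (L If).
Proof.
  intros hL h. unfold is_RInt.
  apply filterlim_ext with (fun ptd => L (scal (sign (b - a)) (Riemann_sum f ptd))).
  - intros ptd. rewrite (linear_scal L hL). f_equal. symmetry. now apply Riemann_sum_linear.
  - eapply filterlim_comp; [exact h|]. apply (linear_cont L _ hL).
Qed.

Lemma nested_intervals (u v : nat -> R) :
  (forall n, u n <= u (S n)) -> (forall n, v (S n) <= v n) -> (forall n, u n <= v n) ->
  exists l, forall n, u n <= l <= v n.
Proof.
  intros hu hv huv.
  assert (hu' : forall n k, u n <= u (n + k)%nat).
  { intros n k. induction k as [|k IH]; [rewrite Nat.add_0_r; lra|].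
    rewrite Nat.add_succ_r. specialize (hu (n + k)%nat). lra. }
  assert (hv' : forall n k, v (n + k)%nat <= v n).
  { intros n k. induction k as [|k IH]; [rewrite Nat.add_0_r; lra|].
    rewrite Nat.add_succ_r. specialize (hv (n + k)%nat). lra. }
  assert (hm : forall n m, u m <= v n).
  { intros n m. specialize (hu' m n). specialize (hv' n m). specialize (huv (n + m)%nat).
    rewrite (Nat.add_comm m n) in hu'. lra. }
  destruct (completeness (fun x => exists n, x = u n)) as [l [h1 h2]].
  - exists (v O). intros x [n ->]. apply hm.
  - exists (u O). now exists O.
  - exists l. intros n. split.
    + apply h1. now exists n.
    + apply h2. intros x [m ->]. apply hm.
Qed.

Section Goursat.

Variable V : CompleteNormedModule R_AbsRing.

Lemma norm_add_le (x y : V) : norm (plus x y) <= norm x + norm y.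
Proof. apply (norm_triangle (V := V)). Qed.

Lemma norm_sub_le (x y : V) : norm (minus x y) <= norm x + norm y.
Proof.
  eapply Rle_trans; [apply norm_add_le|]. right. f_equal. apply (norm_opp (V := V)).
Qed.

Lemma norm_scal_le (k : R) (x : V) : norm (scal k x) <= Rabs k * norm x.
Proof. apply (norm_scal (V := V)). Qed.

(** More than existence of partial derivatives: this is total differentiability at the point, with
    error o(|s - s0| + |t - t0|). *)
Definition has_partials (f : R -> R -> V) (s0 t0 : R) (D D' : V) : Prop :=
  forall eps, 0 < eps -> exists delta, 0 < delta /\ forall s t,
    Rabs (s - s0) < delta -> Rabs (t - t0) < delta ->
    norm (minus (f s t) (plus (f s0 t0) (plus (scal (s - s0) D) (scal (t - t0) D'))))
      <= eps * (Rabs (s - s0) + Rabs (t - t0)).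

Lemma has_partials_near (f : R -> R -> V) (s0 t0 : R) (D D' : V) : has_partials f s0 t0 D D' ->
  forall eps, 0 < eps -> exists delta, 0 < delta /\ forall s t,
    Rabs (s - s0) < delta -> Rabs (t - t0) < delta -> norm (minus (f s t) (f s0 t0)) < eps.
Proof.
  intros h eps he. destruct (h 1 Rlt_0_1) as [d [hd hd']].
  set (K := 1 + norm D + norm D').
  assert (hK : 0 < K) by (pose proof (norm_ge_0 D); pose proof (norm_ge_0 D'); unfold K; lra).
  set (e := eps / (4 * K)).
  assert (hee : 0 < e) by (apply Rdiv_lt_0_compat; lra).
  exists (Rmin d e). split; [now apply Rmin_pos|]. intros s t hs ht.
  Rmin_bounds d e.
  specialize (hd' s t ltac:(lra) ltac:(lra)).
  set (E := minus (f s t) _) in hd'.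
  replace (minus (f s t) (f s0 t0)) with (plus E (plus (scal (s - s0) D) (scal (t - t0) D')))
    by (unfold E; lin_R V).
  pose proof (Rabs_pos (s - s0)). pose proof (Rabs_pos (t - t0)).
  apply Rle_lt_trans with (e * (4 * K) / 2); [|unfold e; field_simplify; lra].
  eapply Rle_trans; [apply norm_add_le|].
  eapply Rle_trans; [apply Rplus_le_compat_l, norm_add_le|].
  pose proof (norm_scal_le (s - s0) D) as h1. pose proof (norm_scal_le (t - t0) D') as h2.
  assert (Rabs (s - s0) * norm D <= e * norm D) by (apply Rmult_le_compat_r; [apply norm_ge_0|lra]).
  assert (Rabs (t - t0) * norm D' <= e * norm D') by (apply Rmult_le_compat_r; [apply norm_ge_0|lra]).
  replace (e * (4 * K) / 2) with (2 * e + 2 * (e * norm D) + 2 * (e * norm D')) by (unfold K; field).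
  assert (0 <= e * norm D) by (apply Rmult_le_pos; [lra|apply norm_ge_0]).
  assert (0 <= e * norm D') by (apply Rmult_le_pos; [lra|apply norm_ge_0]).
  rewrite Rmult_1_l in hd'. lra.
Qed.

Lemma continuous_ball_norm (g : R -> V) (x : R) :
  (forall eps, 0 < eps -> exists delta, 0 < delta /\ forall y, Rabs (y - x) < delta ->
     norm (minus (g y) (g x)) < eps) -> continuous g x.
Proof.
  intros h. apply (proj2 (filterlim_locally_ball_norm (U := V) g (g x))). intros eps.
  destruct (h eps (cond_pos eps)) as [d [hd h']]. exists (mkposreal d hd). intros y hy. apply h', hy.
Qed.

Lemma has_partials_continuous (f : R -> R -> V) (s0 t0 : R) (D D' : V) :
  has_partials f s0 t0 D D' -> continuous (f s0) t0 /\ continuous (fun s => f s t0) s0.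
Proof.
  intros h. pose proof (has_partials_near f s0 t0 D D' h) as h'.
  split; apply continuous_ball_norm; intros eps he; destruct (h' eps he) as [d [hd hd']];
    exists d; split; trivial; intros y hy; apply hd'; trivial;
    rewrite Rminus_eq_0, Rabs_R0; trivial.
Qed.

Lemma RInt_near_const (g : R -> V) (c d M : R) (K : V) : c <= d -> ex_RInt g c d ->
  (forall t, c <= t <= d -> norm (minus (g t) K) <= M) ->
  norm (minus (RInt g c d) (scal (d - c) K)) <= (d - c) * M.
Proof.
  intros hcd hg h.
  apply (norm_RInt_le (fun t => minus (g t) K) (fun _ => M) c d); trivial.
  - apply (is_RInt_minus (V := V)); [now apply (RInt_correct (V := V))|].
    apply (is_RInt_const (V := V)).
  - apply (is_RInt_const (V := R_NormedModule)).
Qed.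

(** The integral of P ds + Q dt along the counterclockwise boundary of [a, b] x [c, d], with
    opposite sides paired so that each integrand is a difference. *)
Definition green (P Q : R -> R -> V) (a b c d : R) : V :=
  minus (RInt (fun t => minus (Q b t) (Q a t)) c d)
        (RInt (fun s => minus (P s d) (P s c)) a b).

Variables (P Q : R -> R -> V) (a0 b0 c0 d0 : R).
(** The shared [D] says that dQ/ds = dP/dt, so the form P ds + Q dt is closed; the derivatives are
    not assumed continuous. *)
Hypothesis hPQ : forall s t, a0 <= s <= b0 -> c0 <= t <= d0 ->
  exists D D1 D2, has_partials Q s t D D1 /\ has_partials P s t D2 D.

Lemma ex_RInt_Q s c d : a0 <= s <= b0 -> c0 <= c -> c <= d -> d <= d0 -> ex_RInt (Q s) c d.
Proof.
  intros hs hc hcd hd. apply (ex_RInt_continuous (V := V)). intros t ht.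
  rewrite Rmin_left, Rmax_right in ht by lra.
  destruct (hPQ s t hs ltac:(lra)) as [D [D1 [D2 [h _]]]].
  apply (has_partials_continuous Q s t D D1 h).
Qed.

Lemma ex_RInt_P t a b : c0 <= t <= d0 -> a0 <= a -> a <= b -> b <= b0 ->
  ex_RInt (fun s => P s t) a b.
Proof.
  intros ht ha hab hb. apply (ex_RInt_continuous (V := V)). intros s hs.
  rewrite Rmin_left, Rmax_right in hs by lra.
  destruct (hPQ s t ltac:(lra) ht) as [D [D1 [D2 [_ h]]]].
  apply (has_partials_continuous P s t D2 D h).
Qed.

Lemma green_expand a b c d : a0 <= a -> a <= b -> b <= b0 -> c0 <= c -> c <= d -> d <= d0 ->
  green P Q a b c d =
  minus (minus (RInt (Q b) c d) (RInt (Q a) c d))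
        (minus (RInt (fun s => P s d) a b) (RInt (fun s => P s c) a b)).
Proof.
  intros. unfold green. f_equal; [|f_equal]; apply (RInt_minus (V := V)).
  - apply ex_RInt_Q; lra.
  - apply ex_RInt_Q; lra.
  - apply ex_RInt_P; lra.
  - apply ex_RInt_P; lra.
Qed.

Lemma green_split_s a m b c d : a0 <= a -> a <= m -> m <= b -> b <= b0 ->
  c0 <= c -> c <= d -> d <= d0 ->
  green P Q a b c d = plus (green P Q a m c d) (green P Q m b c d).
Proof.
  intros. rewrite !green_expand by lra.
  rewrite <- (RInt_Chasles (V := V) (fun s => P s d) a m b) by (apply ex_RInt_P; lra).
  rewrite <- (RInt_Chasles (V := V) (fun s => P s c) a m b) by (apply ex_RInt_P; lra).
  lin_R V.
Qed.

Lemma green_split_t a b c m d : a0 <= a -> a <= b -> b <= b0 ->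
  c0 <= c -> c <= m -> m <= d -> d <= d0 ->
  green P Q a b c d = plus (green P Q a b c m) (green P Q a b m d).
Proof.
  intros. rewrite !green_expand by lra.
  rewrite <- (RInt_Chasles (V := V) (Q b) c m d) by (apply ex_RInt_Q; lra).
  rewrite <- (RInt_Chasles (V := V) (Q a) c m d) by (apply ex_RInt_Q; lra).
  lin_R V.
Qed.

(** Differences across opposite sides keep only the shared derivative, so both integrals are (b -
    a)(d - c) D up to an error controlled by eps times the square of the half perimeter. The main
    terms cancel. *)
Lemma green_local s0 t0 eps : a0 <= s0 <= b0 -> c0 <= t0 <= d0 -> 0 < eps ->
  exists delta, 0 < delta /\ forall a b c d, a0 <= a -> b <= b0 -> c0 <= c -> d <= d0 ->
    a <= s0 <= b -> c <= t0 <= d -> b - a < delta -> d - c < delta ->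
    norm (green P Q a b c d) <= 2 * eps * (b - a + (d - c)) * (b - a + (d - c)).
Proof.
  intros hs ht he. destruct (hPQ s0 t0 hs ht) as [D [D1 [D2 [hQ hP]]]].
  destruct (hQ eps he) as [d1 [hd1 hQ']]. destruct (hP eps he) as [d2 [hd2 hP']].
  exists (Rmin d1 d2). split; [now apply Rmin_pos|].
  intros a b c d ha hb hc hd has hct hab hcd.
  Rmin_bounds d1 d2.
  set (l := b - a + (d - c)).
  assert (hl : 0 <= l) by (unfold l; lra).
  assert (habs : forall x y, a <= x <= b -> a <= y <= b -> Rabs (x - y) <= b - a).
  { intros x y hx hy. apply Rabs_le. lra. }
  assert (habs' : forall x y, c <= x <= d -> c <= y <= d -> Rabs (x - y) <= d - c).
  { intros x y hx hy. apply Rabs_le. lra. }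
  set (EQ := fun s t => minus (Q s t) (plus (Q s0 t0) (plus (scal (s - s0) D) (scal (t - t0) D1)))).
  set (EP := fun s t => minus (P s t) (plus (P s0 t0) (plus (scal (s - s0) D2) (scal (t - t0) D)))).
  assert (hEQ : forall s t, a <= s <= b -> c <= t <= d -> norm (EQ s t) <= eps * l).
  { intros s t hss htt. pose proof (habs s s0 hss has). pose proof (habs' t t0 htt hct).
    eapply Rle_trans; [apply hQ'; lra|]. apply Rmult_le_compat_l; [lra|unfold l; lra]. }
  assert (hEP : forall s t, a <= s <= b -> c <= t <= d -> norm (EP s t) <= eps * l).
  { intros s t hss htt. pose proof (habs s s0 hss has). pose proof (habs' t t0 htt hct).
    eapply Rle_trans; [apply hP'; lra|]. apply Rmult_le_compat_l; [lra|unfold l; lra]. }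
  assert (h1 : norm (minus (RInt (fun t => minus (Q b t) (Q a t)) c d) (scal (d - c) (scal (b - a) D)))
    <= (d - c) * (2 * (eps * l))).
  { apply RInt_near_const; [lra| |].
    - apply (ex_RInt_minus (V := V)); apply ex_RInt_Q; lra.
    - intros t htt. replace (minus (minus (Q b t) (Q a t)) (scal (b - a) D)) with
        (minus (EQ b t) (EQ a t)) by (unfold EQ; lin_R V).
      eapply Rle_trans; [apply norm_sub_le|].
      pose proof (hEQ a t ltac:(lra) htt). pose proof (hEQ b t ltac:(lra) htt). lra. }
  assert (h2 : norm (minus (RInt (fun s => minus (P s d) (P s c)) a b) (scal (b - a) (scal (d - c) D)))
    <= (b - a) * (2 * (eps * l))).
  { apply RInt_near_const; [lra| |].
    - apply (ex_RInt_minus (V := V)); apply ex_RInt_P; lra.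
    - intros s hss. replace (minus (minus (P s d) (P s c)) (scal (d - c) D)) with
        (minus (EP s d) (EP s c)) by (unfold EP; lin_R V).
      eapply Rle_trans; [apply norm_sub_le|].
      pose proof (hEP s c hss ltac:(lra)). pose proof (hEP s d hss ltac:(lra)). lra. }
  unfold green. set (I1 := RInt (fun t => _) c d) in *. set (I2 := RInt (fun s => _) a b) in *.
  replace (minus I1 I2) with
    (minus (minus I1 (scal (d - c) (scal (b - a) D))) (minus I2 (scal (b - a) (scal (d - c) D))))
    by lin_R V.
  eapply Rle_trans; [apply norm_sub_le|].
  replace (2 * eps * l * l) with ((d - c) * (2 * (eps * l)) + (b - a) * (2 * (eps * l)))
    by (unfold l; ring).
  lra.
Qed.

(** Stage n of the bisection: [p] is the lower left corner of a rectangle with sides halved n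
    times. *)
Definition green_bad (G : R) (n : nat) (p : R * R) : Prop :=
  a0 <= fst p /\ fst p + (b0 - a0) * (/ 2) ^ n <= b0 /\
  c0 <= snd p /\ snd p + (d0 - c0) * (/ 2) ^ n <= d0 /\
  G * (/ 4) ^ n <= norm (green P Q (fst p) (fst p + (b0 - a0) * (/ 2) ^ n)
                                   (snd p) (snd p + (d0 - c0) * (/ 2) ^ n)).

Definition green_next (G : R) (n : nat) (p p' : R * R) : Prop :=
  green_bad G (S n) p' /\
  fst p <= fst p' <= fst p + (b0 - a0) * (/ 2) ^ (S n) /\
  snd p <= snd p' <= snd p + (d0 - c0) * (/ 2) ^ (S n).

(** The boundary integrals of the four quarters add up to that of the rectangle, so they cannot all
    fall below a quarter of the bound. *)
Lemma green_bad_next G n p : a0 <= b0 -> c0 <= d0 -> green_bad G n p ->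
  exists p', green_next G n p p'.
Proof.
  intros hab hcd [h1 [h2 [h3 [h4 h5]]]]. destruct p as [x y]. simpl fst in *. simpl snd in *.
  set (w := (b0 - a0) * (/ 2) ^ (S n)). set (h := (d0 - c0) * (/ 2) ^ (S n)).
  assert (hw2 : (b0 - a0) * (/ 2) ^ n = w + w) by (unfold w; simpl; field).
  assert (hh2 : (d0 - c0) * (/ 2) ^ n = h + h) by (unfold h; simpl; field).
  assert (hw : 0 <= w) by (apply Rmult_le_pos; [lra|apply pow_le; lra]).
  assert (hh : 0 <= h) by (apply Rmult_le_pos; [lra|apply pow_le; lra]).
  rewrite hw2 in *. rewrite hh2 in *.
  apply NNPP; intros hn.
  assert (hc : forall p', x <= fst p' <= x + w -> y <= snd p' <= y + h ->
    norm (green P Q (fst p') (fst p' + w) (snd p') (snd p' + h)) < G * (/ 4) ^ (S n)).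
  { intros p' hx hy. apply Rnot_le_lt. intros hle. apply hn. exists p'.
    unfold green_next, green_bad. fold w. fold h. simpl fst; simpl snd. repeat split; try lra. }
  pose proof (hc (x, y)) as c1. pose proof (hc (x + w, y)) as c2.
  pose proof (hc (x, y + h)) as c3. pose proof (hc (x + w, y + h)) as c4.
  simpl fst in *. simpl snd in *.
  specialize (c1 ltac:(lra) ltac:(lra)). specialize (c2 ltac:(lra) ltac:(lra)).
  specialize (c3 ltac:(lra) ltac:(lra)). specialize (c4 ltac:(lra) ltac:(lra)).
  rewrite (green_split_s x (x + w) (x + (w + w))) in h5 by lra.
  rewrite (green_split_t x (x + w) y (y + h) (y + (h + h))) in h5 by lra.
  rewrite (green_split_t (x + w) (x + (w + w)) y (y + h) (y + (h + h))) in h5 by lra.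
  replace (x + (w + w)) with (x + w + w) in h5 by ring.
  replace (y + (h + h)) with (y + h + h) in h5 by ring.
  set (g1 := green P Q x (x + w) y (y + h)) in *.
  set (g2 := green P Q (x + w) (x + w + w) y (y + h)) in *.
  set (g3 := green P Q x (x + w) (y + h) (y + h + h)) in *.
  set (g4 := green P Q (x + w) (x + w + w) (y + h) (y + h + h)) in *.
  pose proof (norm_add_le (plus g1 g3) (plus g2 g4)) as t1.
  pose proof (norm_add_le g1 g3) as t2. pose proof (norm_add_le g2 g4) as t3.
  assert (e : G * (/ 4) ^ n = 4 * (G * (/ 4) ^ S n)) by (simpl; field).
  lra.
Qed.

Lemma goursat : a0 <= b0 -> c0 <= d0 -> green P Q a0 b0 c0 d0 = zero.
Proof.
  intros hab hcd. apply NNPP; intros hne.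
  set (G := norm (green P Q a0 b0 c0 d0)).
  assert (hG : 0 < G).
  { destruct (norm_ge_0 (green P Q a0 b0 c0 d0)) as [h|h]; [exact h|].
    destruct hne. apply (norm_eq_zero (V := V)). symmetry; exact h. }
  (* A choice of successive bad quarters; since [green_bad_next] always provides one, the default
     (0, 0) is never a fallback. *)
  set (g := fix g n := match n with
    | O => (a0, c0)
    | S n' => epsilon (inhabits (0, 0)) (green_next G n' (g n'))
    end).
  assert (hbad : forall n, green_bad G n (g n)).
  { induction n as [|n IH].
    - unfold green_bad; simpl. rewrite !Rmult_1_r.
      replace (a0 + (b0 - a0)) with b0 by ring. replace (c0 + (d0 - c0)) with d0 by ring.
      unfold G. repeat split; lra.
    - apply (epsilon_spec (inhabits (0, 0)) _ (green_bad_next G n (g n) hab hcd IH)). }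
  assert (hnext : forall n, green_next G n (g n) (g (S n))).
  { intros n. apply (epsilon_spec (inhabits (0, 0)) _ (green_bad_next G n (g n) hab hcd (hbad n))). }
  assert (hq : forall n, 0 < (/ 2) ^ n) by (intros; apply pow_lt; lra).
  assert (hS : forall z n, z * (/ 2) ^ n = z * (/ 2) ^ S n + z * (/ 2) ^ S n) by (intros; simpl; field).
  assert (hw0 : forall n, 0 <= (b0 - a0) * (/ 2) ^ n) by (intros n; apply Rmult_le_pos; [lra|left; apply hq]).
  assert (hh0 : forall n, 0 <= (d0 - c0) * (/ 2) ^ n) by (intros n; apply Rmult_le_pos; [lra|left; apply hq]).
  destruct (nested_intervals (fun n => fst (g n)) (fun n => fst (g n) + (b0 - a0) * (/ 2) ^ n))
    as [s0 hs0].
  { intros n. destruct (hnext n) as [_ [h _]]. lra. }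
  { intros n. destruct (hnext n) as [_ [h _]]. rewrite (hS _ n). lra. }
  { intros n. specialize (hw0 n). lra. }
  destruct (nested_intervals (fun n => snd (g n)) (fun n => snd (g n) + (d0 - c0) * (/ 2) ^ n))
    as [t0 ht0].
  { intros n. destruct (hnext n) as [_ [_ h]]. lra. }
  { intros n. destruct (hnext n) as [_ [_ h]]. rewrite (hS _ n). lra. }
  { intros n. specialize (hh0 n). lra. }
  set (l := b0 - a0 + (d0 - c0)). assert (hl : 0 <= l) by (unfold l; lra).
  (* This makes 2 eps l^2 < G, even for a degenerate rectangle with l = 0. Both sides of the final
     comparison scale like 4^(-N), hence the contradiction. *)
  set (eps := G / (4 * (l * l + 1))).
  assert (hl2 : 0 <= l * l) by now apply Rmult_le_pos.
  assert (heps : 0 < eps) by (apply Rdiv_lt_0_compat; lra).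
  assert (hs : a0 <= s0 <= b0).
  { specialize (hs0 O). simpl in hs0. lra. }
  assert (ht : c0 <= t0 <= d0).
  { specialize (ht0 O). simpl in ht0. lra. }
  destruct (green_local s0 t0 eps hs ht heps) as [delta [hd hloc]].
  destruct (pow_lt_1_zero (/ 2) ltac:(rewrite Rabs_right; lra) (delta / (l + 1))) as [N hN].
  { apply Rdiv_lt_0_compat; lra. }
  specialize (hN N (le_n N)). rewrite Rabs_right in hN by (left; apply hq).
  apply (Rmult_lt_compat_r (l + 1)) in hN; [|lra].
  replace (delta / (l + 1) * (l + 1)) with delta in hN by (field; lra).
  pose proof (hq N) as hqN.
  assert (hwl : (b0 - a0) * (/ 2) ^ N <= (/ 2) ^ N * (l + 1)).
  { rewrite Rmult_comm. apply Rmult_le_compat_l; unfold l; lra. }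
  assert (hhl : (d0 - c0) * (/ 2) ^ N <= (/ 2) ^ N * (l + 1)).
  { rewrite Rmult_comm. apply Rmult_le_compat_l; unfold l; lra. }
  destruct (hbad N) as [h1 [h2 [h3 [h4 h5]]]].
  specialize (hs0 N). specialize (ht0 N). specialize (hw0 N). specialize (hh0 N).
  cbv beta in hs0, ht0.
  specialize (hloc _ _ _ _ h1 h2 h3 h4 hs0 ht0 ltac:(lra) ltac:(lra)).
  apply (Rle_trans _ _ _ h5) in hloc.
  replace (fst (g N) + (b0 - a0) * (/ 2) ^ N - fst (g N) +
      (snd (g N) + (d0 - c0) * (/ 2) ^ N - snd (g N))) with (l * (/ 2) ^ N) in hloc
    by (unfold l; ring).
  replace ((/ 4) ^ N) with ((/ 2) ^ N * (/ 2) ^ N) in hloc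
    by (rewrite <- Rpow_mult_distr; f_equal; field).
  assert (hfin : 2 * eps * (l * l) < G).
  { apply Rle_lt_trans with (2 * eps * (l * l + 1)); [apply Rmult_le_compat_l; lra|].
    unfold eps. replace (2 * (G / (4 * (l * l + 1))) * (l * l + 1)) with (G / 2) by (field; lra). lra. }
  apply (Rmult_lt_compat_r ((/ 2) ^ N * (/ 2) ^ N)) in hfin; [|now apply Rmult_lt_0_compat].
  replace (2 * eps * (l * (/ 2) ^ N) * (l * (/ 2) ^ N)) with
    (2 * eps * (l * l) * ((/ 2) ^ N * (/ 2) ^ N)) in hloc by ring.
  lra.
Qed.

End Goursat.

(** * Complex differentiability *)

Lemma norm_plus_le {V : NormedModule C_AbsRing} (x y : V) : norm (plus x y) <= norm x + norm y.
Proof. apply (norm_triangle (V := V)). Qed.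

Lemma norm_minus_le {V : NormedModule C_AbsRing} (x y : V) : norm (minus x y) <= norm x + norm y.
Proof.
  eapply Rle_trans; [apply norm_plus_le|]. right. f_equal. apply (norm_opp (V := V)).
Qed.

Lemma norm_eq_lt {V : NormedModule C_AbsRing} (x y : V) (b : R) : x = y -> norm y < b -> norm x < b.
Proof. now intros ->. Qed.

Lemma norm_eq_le {V : NormedModule C_AbsRing} (x y : V) (b : R) : x = y -> norm y <= b -> norm x <= b.
Proof. now intros ->. Qed.

Lemma eq_plus_of_minus {V : NormedModule C_AbsRing} (x y z : V) : minus x y = z -> x = plus y z.
Proof. intros <-. lin_C V. Qed.

Lemma ball_C_Cmod (z w : C) (eps : posreal) : Cmod (w - z)%C < eps ->
  ball (M := C_UniformSpace) z eps w.
Proof. intros h. apply (C_NormedModule_mixin_compat1 z w eps). exact h. Qed.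

(** The uniform structure on C is that of a product, with squares as balls; the modulus exceeds the
    radius by a factor of at most sqrt 2, rounded up to 2. *)
Lemma ball_Cmod (z w : C) (eps : posreal) : ball (M := C_UniformSpace) z eps w ->
  Cmod (w - z)%C < 2 * eps.
Proof.
  intros h. pose proof (C_NormedModule_mixin_compat2 z w eps h) as h'.
  change (minus w z) with (w - z)%C in h'.
  eapply Rlt_le_trans; [exact h'|]. apply Rmult_le_compat_r; [left; apply cond_pos|].
  apply Rle_trans with (sqrt (2 * 2)); [apply sqrt_le_1_alt; lra|].
  right; apply sqrt_square; lra.
Qed.

Lemma locally_Cmod (z : C) (P : C -> Prop) :
  locally (T := C_UniformSpace) z P <->
  exists delta, 0 < delta /\ forall w, Cmod (w - z)%C < delta -> P w.
Proof.
  split.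
  - intros [d hd]. exists d. split; [apply cond_pos|]. intros w hw. apply hd.
    now apply ball_C_Cmod.
  - intros [d [hd h]]. assert (hd2 : 0 < d / 2) by lra.
    exists (mkposreal _ hd2). intros w hw. apply h. apply ball_Cmod in hw. simpl in hw. lra.
Qed.

(** Relative to [D], because at the boundary the functions are continuous only from inside the
    annulus or along the circle. *)
Definition cont_at {V : NormedModule C_AbsRing} (D : C -> Prop) (f : C -> V) (z : C) : Prop :=
  forall eps, 0 < eps -> exists delta, 0 < delta /\
    forall w, D w -> Cmod (w - z)%C < delta -> norm (minus (f w) (f z)) < eps.

Lemma continuous_on_cont_at {V : NormedModule C_AbsRing} (D : C -> Prop) (f : C -> V) :
  continuous_on (T := C_UniformSpace) D f <-> forall z, D z -> cont_at D f z.
Proof.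
  split; intros h z hz; specialize (h z hz).
  - intros eps he.
    pose proof (proj1 (filterlim_locally_ball_norm (U := V) f (f z)) h (mkposreal eps he)) as h'.
    unfold within in h'. apply locally_Cmod in h'. destruct h' as [d [hd h']].
    exists d. split; trivial. intros w hD hw. exact (h' w hw hD).
  - apply (proj2 (filterlim_locally_ball_norm (U := V) f (f z))). intros eps.
    destruct (h eps (cond_pos eps)) as [d [hd h']]. unfold within. apply locally_Cmod.
    exists d. split; trivial. intros w hw hD. now apply h'.
Qed.

Lemma cont_at_sub {V : NormedModule C_AbsRing} (D E : C -> Prop) (f : C -> V) (z : C) :
  (forall w, E w -> D w) -> cont_at D f z -> cont_at E f z.
Proof.
  intros h hf eps he. destruct (hf eps he) as [d [hd h']]. exists d. split; trivial.
  intros w hD hw. apply h'; auto.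
Qed.

Lemma cont_at_const {V : NormedModule C_AbsRing} (D : C -> Prop) (v : V) (z : C) :
  cont_at D (fun _ => v) z.
Proof.
  intros eps he. exists 1. split; [lra|]. intros w _ _.
  eapply Rle_lt_trans; [right|exact he].
  etransitivity; [|exact (norm_zero (V := V))]. f_equal. apply (minus_eq_zero (G := V)).
Qed.

Lemma cont_at_plus {V : NormedModule C_AbsRing} (D : C -> Prop) (f g : C -> V) (z : C) :
  cont_at D f z -> cont_at D g z -> cont_at D (fun w => plus (f w) (g w)) z.
Proof.
  intros hf hg eps he.
  destruct (hf (eps / 2) ltac:(lra)) as [d [hd h]], (hg (eps / 2) ltac:(lra)) as [d' [hd' h']].
  exists (Rmin d d'). split; [now apply Rmin_pos|]. intros w hD hw.
  Rmin_bounds d d'.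
  specialize (h w hD ltac:(lra)). specialize (h' w hD ltac:(lra)).
  apply (norm_eq_lt _ (plus (minus (f w) (f z)) (minus (g w) (g z)))); [lin_C V|].
  eapply Rle_lt_trans; [apply norm_plus_le|]. lra.
Qed.

Notation CC := (AbsRing_NormedModule C_AbsRing).

Lemma cont_at_scal {V : NormedModule C_AbsRing} (D : C -> Prop) (k : C -> C) (f : C -> V) (z : C) :
  cont_at (V := CC) D k z -> cont_at D f z -> cont_at D (fun w => scal (k w) (f w)) z.
Proof.
  intros hk hf eps he.
  set (K := Cmod (k z) + 1). assert (hK : 1 <= K) by (pose proof (Cmod_ge_0 (k z)); unfold K; lra).
  set (F := norm (f z) + 1). assert (hF : 1 <= F) by (pose proof (norm_ge_0 (f z)); unfold F; lra).
  assert (h1 : 0 < eps / (2 * K)) by (apply Rdiv_lt_0_compat; lra).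
  assert (h2 : 0 < eps / (2 * F)) by (apply Rdiv_lt_0_compat; lra).
  assert (h3 : 0 < Rmin 1 (eps / (2 * F))) by (apply Rmin_pos; lra).
  destruct (hf _ h1) as [d [hd h]], (hk _ h3) as [d' [hd' h']].
  exists (Rmin d d'). split; [now apply Rmin_pos|]. intros w hD hw.
  Rmin_bounds d d'.
  specialize (h w hD ltac:(lra)). specialize (h' w hD ltac:(lra)).
  change (Cmod (k w - k z)%C < Rmin 1 (eps / (2 * F))) in h'.
  Rmin_bounds 1 (eps / (2 * F)).
  apply (norm_eq_lt _ (plus (scal (k w) (minus (f w) (f z))) (scal (k w - k z)%C (f z))));
    [lin_C V|].
  eapply Rle_lt_trans; [apply norm_plus_le|]. rewrite !norm_scal_C.
  assert (hkw : Cmod (k w) <= K).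
  { replace (k w) with (k z + (k w - k z))%C by ring.
    eapply Rle_trans; [apply Cmod_triangle|]. unfold K. lra. }
  assert (a1 : Cmod (k w) * norm (minus (f w) (f z)) <= K * norm (minus (f w) (f z)))
    by (apply Rmult_le_compat_r; [apply norm_ge_0|trivial]).
  assert (a2 : K * norm (minus (f w) (f z)) < K * (eps / (2 * K))) by (apply Rmult_lt_compat_l; lra).
  replace (K * (eps / (2 * K))) with (eps / 2) in a2 by (field; lra).
  assert (a3 : Cmod (k w - k z) * norm (f z) <= eps / (2 * F) * F).
  { apply Rmult_le_compat; [apply Cmod_ge_0|apply norm_ge_0|lra|unfold F; lra]. }
  replace (eps / (2 * F) * F) with (eps / 2) in a3 by (field; lra). lra.
Qed.

Lemma cont_at_id (D : C -> Prop) (z : C) : cont_at (V := CC) D (fun w => w) z.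
Proof. intros eps he. exists eps. split; trivial. Qed.

Lemma cont_at_inv (D : C -> Prop) (k : C -> C) (z : C) : k z <> 0 ->
  cont_at (V := CC) D k z -> cont_at (V := CC) D (fun w => / k w)%C z.
Proof.
  intros hz hk eps he. set (a := Cmod (k z)).
  assert (ha : 0 < a) by now apply Cmod_gt_0.
  (* The first bound keeps |k w| above a/2, so the denominator |k w| a is at least a^2/2; the second
     bound is made for that denominator. *)
  assert (h2 : 0 < Rmin (a / 2) (eps * (a * a / 2))).
  { apply Rmin_pos; [lra|]. apply Rmult_lt_0_compat; trivial.
    assert (0 < a * a) by now apply Rmult_lt_0_compat. lra. }
  destruct (hk _ h2) as [d [hd h]]. exists d. split; trivial. intros w hD hw.
  specialize (h w hD hw). change (Cmod (k w - k z)%C < Rmin (a / 2) (eps * (a * a / 2))) in h.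
  change (Cmod (/ k w - / k z)%C < eps).
  Rmin_bounds (a / 2) (eps * (a * a / 2)).
  assert (hw2 : a / 2 <= Cmod (k w)).
  { assert (a <= Cmod (k w) + Cmod (k w - k z)); [|lra].
    unfold a. replace (k z) with (k w + - (k w - k z))%C at 1 by ring.
    eapply Rle_trans; [apply Cmod_triangle|]. rewrite Cmod_opp. lra. }
  assert (hkw : k w <> 0) by (apply Cmod_gt_0; lra).
  replace (/ k w - / k z)%C with (- ((k w - k z) / (k w * k z)))%C by (field; now split).
  rewrite Cmod_opp, Cmod_div by now apply Cmult_neq_0.
  rewrite Cmod_mult. fold a.
  assert (hp : 0 < Cmod (k w) * a) by (apply Rmult_lt_0_compat; lra).
  apply Rmult_lt_reg_r with (Cmod (k w) * a); trivial.
  unfold Rdiv. rewrite Rmult_assoc, Rinv_l, Rmult_1_r by lra.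
  eapply Rlt_le_trans; [exact h|]. eapply Rle_trans; [apply Rmin_r|].
  apply Rmult_le_compat_l; [lra|].
  replace (a * a / 2) with (a / 2 * a) by field. apply Rmult_le_compat_r; lra.
Qed.

(** Caratheodory's form of differentiability: [phi] is the difference quotient, continuous at z with
    the derivative as its value there. Product and inverse rules become algebra with continuous
    functions. *)
Definition cdiff {V : NormedModule C_AbsRing} (f : C -> V) (z : C) : Prop :=
  exists phi : C -> V, cont_at (fun _ => True) phi z /\
  exists delta, 0 < delta /\ forall w, Cmod (w - z)%C < delta ->
    minus (f w) (f z) = scal (w - z)%C (phi w).

Lemma cdiff_cont_at {V : NormedModule C_AbsRing} (f : C -> V) (z : C) :
  cdiff f z -> cont_at (fun _ => True) f z.
Proof.
  intros [phi [hphi [d [hd h]]]] eps he.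
  assert (hc : cont_at (fun _ => True) (fun w => scal (w + - z)%C (phi w)) z).
  { apply (cont_at_scal _ (fun w => w + - z)%C); trivial.
    apply (cont_at_plus (V := CC)); [apply cont_at_id|apply cont_at_const]. }
  destruct (hc eps he) as [d' [hd' h']].
  exists (Rmin d d'). split; [now apply Rmin_pos|]. intros w _ hw.
  Rmin_bounds d d'.
  rewrite h by lra. specialize (h' w I ltac:(lra)).
  eapply norm_eq_lt; [|exact h']. lin_C V.
Qed.

Lemma cdiff_const {V : NormedModule C_AbsRing} (v : V) (z : C) : cdiff (fun _ => v) z.
Proof.
  exists (fun _ => zero). split; [apply cont_at_const|]. exists 1. split; [lra|].
  intros w _. lin_C V.
Qed.

Lemma cdiff_plus {V : NormedModule C_AbsRing} (f g : C -> V) (z : C) :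
  cdiff f z -> cdiff g z -> cdiff (fun w => plus (f w) (g w)) z.
Proof.
  intros [phi [hphi [d [hd h]]]] [psi [hpsi [d' [hd' h']]]].
  exists (fun w => plus (phi w) (psi w)). split; [now apply cont_at_plus|].
  exists (Rmin d d'). split; [now apply Rmin_pos|]. intros w hw.
  Rmin_bounds d d'.
  specialize (h w ltac:(lra)). specialize (h' w ltac:(lra)).
  transitivity (plus (minus (f w) (f z)) (minus (g w) (g z))); [lin_C V|].
  rewrite h, h'. lin_C V.
Qed.

Lemma cdiff_scal {V : NormedModule C_AbsRing} (k : C -> C) (f : C -> V) (z : C) :
  cdiff (V := CC) k z -> cdiff f z -> cdiff (fun w => scal (k w) (f w)) z.
Proof.
  intros hk hf. pose proof (cdiff_cont_at (V := CC) k z hk) as hkc.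
  destruct hk as [phi [hphi [d [hd h]]]], hf as [psi [hpsi [d' [hd' h']]]].
  exists (fun w => plus (scal (k w) (psi w)) (scal (phi w) (f z))). split.
  - apply cont_at_plus; [now apply cont_at_scal|].
    apply cont_at_scal; [trivial|apply cont_at_const].
  - exists (Rmin d d'). split; [now apply Rmin_pos|]. intros w hw.
    Rmin_bounds d d'.
    specialize (h w ltac:(lra)). specialize (h' w ltac:(lra)).
    change (k w - k z = (w - z) * phi w)%C in h.
    transitivity (plus (scal (k w) (minus (f w) (f z))) (scal (k w - k z)%C (f z)));
      [lin_C V|].
    rewrite h, h'. lin_C V.
Qed.

Lemma cdiff_id (z : C) : cdiff (V := CC) (fun w => w) z.
Proof.
  exists (fun _ => RtoC 1). split; [apply cont_at_const|]. exists 1. split; [lra|].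
  intros w _. change (w - z = (w - z) * 1)%C. ring.
Qed.

Lemma cdiff_inv (k : C -> C) (z : C) : k z <> 0 ->
  cdiff (V := CC) k z -> cdiff (V := CC) (fun w => / k w)%C z.
Proof.
  intros hz hk. pose proof (cdiff_cont_at (V := CC) k z hk) as hkc.
  assert (hne : exists d, 0 < d /\ forall w, Cmod (w - z) < d -> k w <> 0).
  { destruct (hkc (Cmod (k z))) as [d [hd h]]; [now apply Cmod_gt_0|].
    exists d. split; trivial. intros w hw hw0. specialize (h w I hw).
    rewrite hw0 in h. change (Cmod (RtoC 0 - k z)%C < Cmod (k z)) in h.
    replace (RtoC 0 - k z)%C with (- k z)%C in h by ring. rewrite Cmod_opp in h. lra. }
  destruct hk as [phi [hphi [d [hd h]]]]. destruct hne as [d' [hd' h']].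
  exists (fun w => (/ k w) * (- / k z * phi w))%C. split.
  - apply (cont_at_scal (V := CC) _ (fun w => / k w)%C (fun w => - / k z * phi w)%C).
    + now apply cont_at_inv.
    + apply (cont_at_scal (V := CC) _ (fun w => - / k z)%C phi); trivial. apply cont_at_const.
  - exists (Rmin d d'). split; [now apply Rmin_pos|]. intros w hw.
    Rmin_bounds d d'.
    specialize (h w ltac:(lra)). specialize (h' w ltac:(lra)).
    change (k w - k z = (w - z) * phi w)%C in h.
    change (/ k w - / k z = (w - z) * (/ k w * (- / k z * phi w)))%C.
    replace ((w - z) * (/ k w * (- / k z * phi w)))%C with (/ k w * - / k z * ((w - z) * phi w))%C
      by ring.
    rewrite <- h. field. now split.
Qed.

(** * Cauchy's theorem on the annulus *)

Lemma Cmod_cis (t : R) : Cmod (cis t) = 1.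
Proof.
  unfold Cmod, cis; simpl. transitivity (sqrt 1); [f_equal|apply sqrt_1].
  pose proof (sin2_cos2 t) as h. unfold Rsqr in h. lra.
Qed.

Lemma cis_plus (s t : R) : cis (s + t) = (cis s * cis t)%C.
Proof. unfold cis, Cmult; simpl. rewrite cos_plus, sin_plus. f_equal; ring. Qed.

Lemma cis_0 : cis 0 = 1.
Proof. unfold cis. now rewrite cos_0, sin_0. Qed.

Lemma cis_2PI (t : R) : cis (t + 2 * PI) = cis t.
Proof. rewrite cis_plus. unfold cis. rewrite cos_2PI, sin_2PI. unfold Cmult; simpl. f_equal; ring. Qed.

Lemma cis_neq_0 (t : R) : cis t <> 0.
Proof. apply Cmod_gt_0. rewrite Cmod_cis. lra. Qed.

Lemma cis_opp (t : R) : cis (- t) = (/ cis t)%C.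
Proof.
  assert (h : (cis (- t) * cis t)%C = 1) by (rewrite <- cis_plus, Rplus_opp_l; apply cis_0).
  pose proof (cis_neq_0 t).
  transitivity (cis (- t) * cis t * / cis t)%C; [field; trivial|rewrite h; ring].
Qed.

(** The exponential e^(s+it). It maps the strip 0 <= s <= 1 onto the annulus, with period 2 pi in
    t. *)
Definition polar (s t : R) : C := (RtoC (exp s) * cis t)%C.

Lemma Cmod_polar (s t : R) : Cmod (polar s t) = exp s.
Proof.
  unfold polar. rewrite Cmod_mult, Cmod_cis, Cmod_R, Rabs_right; [ring|].
  left; apply exp_pos.
Qed.

Lemma polar_plus (s t s' t' : R) : polar (s + s') (t + t') = (polar s t * polar s' t')%C.
Proof. unfold polar. rewrite exp_plus, RtoC_mult, cis_plus. ring. Qed.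

Lemma polar_neq_0 (s t : R) : polar s t <> 0.
Proof. apply Cmod_gt_0. rewrite Cmod_polar. apply exp_pos. Qed.

Lemma polar_0_l (t : R) : polar 0 t = cis t.
Proof. unfold polar. rewrite exp_0. apply Cmult_1_l. Qed.

Lemma polar_0_r (s : R) : polar s 0 = RtoC (exp s).
Proof. unfold polar. rewrite cis_0. apply Cmult_1_r. Qed.

Lemma polar_2PI (s t : R) : polar s (t + 2 * PI) = polar s t.
Proof. unfold polar. now rewrite cis_2PI. Qed.

Lemma Cmod_Ci : Cmod Ci = 1.
Proof. unfold Cmod, Ci; simpl. transitivity (sqrt 1); [f_equal; ring|apply sqrt_1]. Qed.

Lemma Cmod_le_Rabs (z : C) : Cmod z <= Rabs (fst z) + Rabs (snd z).
Proof.
  destruct z as [x y]. simpl.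
  replace (x, y) with (RtoC x + Ci * RtoC y)%C by (unfold Cplus, Cmult, Ci, RtoC; simpl; f_equal; ring).
  eapply Rle_trans; [apply Cmod_triangle|]. rewrite Cmod_mult, !Cmod_R, Cmod_Ci. lra.
Qed.

Lemma derivable_at_0_eps (f : R -> R) (l : R) : derivable_pt_lim f 0 l ->
  forall eps, 0 < eps -> exists delta, 0 < delta /\ forall h, Rabs h < delta ->
    Rabs (f h - f 0 - l * h) <= eps * Rabs h.
Proof.
  intros hf eps he. destruct (hf eps he) as [d hd]. exists d. split; [apply cond_pos|].
  intros h hh. destruct (Req_dec h 0) as [->|h0].
  - replace (f 0 - f 0 - l * 0) with 0 by ring. rewrite Rabs_R0. lra.
  - specialize (hd h h0 hh). rewrite Rplus_0_l in hd.
    replace (f h - f 0 - l * h) with (((f h - f 0) / h - l) * h) by (field; trivial).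
    rewrite Rabs_mult. apply Rmult_le_compat_r; [apply Rabs_pos|lra].
Qed.

Lemma polar_near_0 (eps : R) : 0 < eps -> exists delta, 0 < delta /\ forall x y,
  Rabs x < delta -> Rabs y < delta ->
  Cmod (polar x y - 1 - (RtoC x + Ci * RtoC y))%C <= eps * (Rabs x + Rabs y).
Proof.
  intros he. set (e := Rmin 1 (eps / 5)).
  assert (hee : 0 < e) by (apply Rmin_pos; lra).
  pose proof (Rmin_l 1 (eps / 5)) as he1. pose proof (Rmin_r 1 (eps / 5)) as he2. fold e in he1, he2.
  destruct (derivable_at_0_eps exp 1 derivable_pt_lim_exp_0 e hee) as [d1 [hd1 h1]].
  pose proof (derivable_pt_lim_cos 0) as hc. rewrite sin_0, Ropp_0 in hc.
  destruct (derivable_at_0_eps cos 0 hc e hee) as [d2 [hd2 h2]].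
  pose proof (derivable_pt_lim_sin 0) as hs. rewrite cos_0 in hs.
  destruct (derivable_at_0_eps sin 1 hs e hee) as [d3 [hd3 h3]].
  rewrite exp_0 in h1. rewrite cos_0 in h2. rewrite sin_0 in h3.
  set (d := Rmin (e / 2) (Rmin d1 (Rmin d2 d3))).
  exists d. split; [unfold d; repeat apply Rmin_pos; lra|]. intros x y hx hy.
  assert (hd : d <= e / 2 /\ d <= d1 /\ d <= d2 /\ d <= d3).
  { unfold d. repeat split.
    - apply Rmin_l.
    - eapply Rle_trans; [apply Rmin_r|apply Rmin_l].
    - eapply Rle_trans; [apply Rmin_r|]. eapply Rle_trans; [apply Rmin_r|apply Rmin_l].
    - eapply Rle_trans; [apply Rmin_r|]. eapply Rle_trans; [apply Rmin_r|apply Rmin_r]. }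
  specialize (h1 x ltac:(lra)). specialize (h2 y ltac:(lra)). specialize (h3 y ltac:(lra)).
  rewrite Rmult_1_l in h1, h3. rewrite Rmult_0_l in h2.
  pose proof (Rabs_pos x) as px. pose proof (Rabs_pos y) as py.
  assert (hex : Rabs (exp x - 1) <= e).
  { replace (exp x - 1) with ((exp x - 1 - x) + x) by ring.
    eapply Rle_trans; [apply Rabs_triang|].
    assert (e * Rabs x <= 1 * Rabs x) by (apply Rmult_le_compat_r; lra). lra. }
  assert (hex2 : Rabs (exp x) <= 2).
  { replace (exp x) with ((exp x - 1) + 1) by ring.
    eapply Rle_trans; [apply Rabs_triang|]. rewrite Rabs_R1. lra. }
  eapply Rle_trans; [apply Cmod_le_Rabs|].
  unfold polar, cis, Cminus, Cplus, Copp, Cmult, Ci, RtoC; simpl.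
  replace (exp x * cos y - 0 * sin y + - (1) + - (x + (0 * y - 1 * 0))) with
    ((exp x - 1 - x) + exp x * (cos y - 1 - 0)) by ring.
  replace (exp x * sin y + 0 * cos y + - 0 + - (0 + (0 * 0 + 1 * y))) with
    (exp x * (sin y - 0 - y) + (exp x - 1) * y) by ring.
  eapply Rle_trans; [apply Rplus_le_compat; apply Rabs_triang|]. rewrite !Rabs_mult.
  assert (a1 : Rabs (exp x) * Rabs (cos y - 1 - 0) <= 2 * (e * Rabs y))
    by (apply Rmult_le_compat; trivial; apply Rabs_pos).
  assert (a2 : Rabs (exp x) * Rabs (sin y - 0 - y) <= 2 * (e * Rabs y))
    by (apply Rmult_le_compat; trivial; apply Rabs_pos).
  assert (a3 : Rabs (exp x - 1) * Rabs y <= e * Rabs y) by (apply Rmult_le_compat_r; trivial).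
  assert (a4 : e * Rabs x <= eps / 5 * Rabs x) by (apply Rmult_le_compat_r; trivial).
  assert (a5 : e * Rabs y <= eps / 5 * Rabs y) by (apply Rmult_le_compat_r; trivial).
  assert (a6 : 0 <= eps / 5 * Rabs x) by (apply Rmult_le_pos; lra).
  replace (eps * (Rabs x + Rabs y)) with (5 * (eps / 5 * Rabs x) + 5 * (eps / 5 * Rabs y)) by field.
  lra.
Qed.

(** The group law reduces the expansion at any point to the one at 0, at the price of the factor
    e^(s0). *)
Lemma polar_expand (s0 t0 eps : R) : 0 < eps -> exists delta, 0 < delta /\ forall s t,
  Rabs (s - s0) < delta -> Rabs (t - t0) < delta ->
  Cmod (polar s t - polar s0 t0 - (RtoC (s - s0) + Ci * RtoC (t - t0)) * polar s0 t0)%C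
    <= eps * (Rabs (s - s0) + Rabs (t - t0)).
Proof.
  intros he. pose proof (exp_pos s0) as hp.
  destruct (polar_near_0 (eps / exp s0)) as [d [hd h]]; [now apply Rdiv_lt_0_compat|].
  exists d. split; trivial. intros s t hs ht. specialize (h _ _ hs ht).
  replace (polar s t) with (polar (s - s0) (t - t0) * polar s0 t0)%C
    by (rewrite <- polar_plus; f_equal; ring).
  replace (polar (s - s0) (t - t0) * polar s0 t0 - polar s0 t0 -
      (RtoC (s - s0) + Ci * RtoC (t - t0)) * polar s0 t0)%C with
    ((polar (s - s0) (t - t0) - 1 - (RtoC (s - s0) + Ci * RtoC (t - t0))) * polar s0 t0)%C by ring.
  rewrite Cmod_mult, Cmod_polar.
  apply Rle_trans with (eps / exp s0 * (Rabs (s - s0) + Rabs (t - t0)) * exp s0).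
  - apply Rmult_le_compat_r; [lra|exact h].
  - right. field. lra.
Qed.

Lemma polar_lipschitz (s0 t0 : R) : exists K delta, 0 < K /\ 0 < delta /\ forall s t,
  Rabs (s - s0) < delta -> Rabs (t - t0) < delta ->
  Cmod (polar s t - polar s0 t0)%C <= K * (Rabs (s - s0) + Rabs (t - t0)).
Proof.
  destruct (polar_expand s0 t0 1 Rlt_0_1) as [d [hd h]].
  pose proof (exp_pos s0) as hp.
  exists (1 + exp s0), d. split; [lra|split; [trivial|]]. intros s t hs ht. specialize (h s t hs ht).
  set (x := (RtoC (s - s0) + Ci * RtoC (t - t0))%C) in *.
  replace (polar s t - polar s0 t0)%C with
    ((polar s t - polar s0 t0 - x * polar s0 t0) + x * polar s0 t0)%C by ring.
  eapply Rle_trans; [apply Cmod_triangle|]. rewrite Cmod_mult, Cmod_polar.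
  assert (hx : Cmod x <= Rabs (s - s0) + Rabs (t - t0)).
  { unfold x. eapply Rle_trans; [apply Cmod_triangle|]. rewrite Cmod_mult, Cmod_Ci, !Cmod_R. lra. }
  assert (Cmod x * exp s0 <= (Rabs (s - s0) + Rabs (t - t0)) * exp s0)
    by (apply Rmult_le_compat_r; lra).
  lra.
Qed.

Lemma polar_near (s0 t0 eps : R) : 0 < eps -> exists delta, 0 < delta /\ forall s t,
  Rabs (s - s0) < delta -> Rabs (t - t0) < delta -> Cmod (polar s t - polar s0 t0)%C < eps.
Proof.
  intros he. destruct (polar_lipschitz s0 t0) as [K [d [hK [hd h]]]].
  assert (h2 : 0 < eps / (2 * K)) by (apply Rdiv_lt_0_compat; lra).
  exists (Rmin d (eps / (2 * K))). split; [now apply Rmin_pos|]. intros s t hs ht.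
  Rmin_bounds d (eps / (2 * K)).
  eapply Rle_lt_trans; [apply h; lra|].
  apply Rlt_le_trans with (K * (eps / (2 * K) + eps / (2 * K))).
  - apply Rmult_lt_compat_l; lra.
  - right. field. lra.
Qed.

(** * Equality of the circle means *)

Section CauchyAnnulus.

Variable V : CompleteNormedModule C_AbsRing.

Lemma is_linear_restr_scal (a : C) :
  is_linear (U := restr_R V) (V := restr_R V) (fun x : V => scal a x).
Proof.
  apply Build_is_linear.
  - intros x y. apply (scal_distr_l (V := V) a x y).
  - intros k x. change (scal a (scal (RtoC k) x) = scal (RtoC k) (scal a x)). lin_C V.
  - exists (Cmod a + 1). split; [pose proof (Cmod_ge_0 a); lra|]. intros x.
    change (norm (scal a x) <= (Cmod a + 1) * norm x).
    eapply Rle_trans; [right; exact (norm_scal_C (V := V) a x)|].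
    apply Rmult_le_compat_r; [apply norm_ge_0|lra].
Qed.

(** The chain rule for F(e^(s+it)), with D = z0 F'(z0). That the t-derivative is i times the
    s-derivative is the Cauchy-Riemann equation in these coordinates. *)
Lemma polar_partials (F : C -> V) (s0 t0 : R) : cdiff F (polar s0 t0) ->
  exists D : V, has_partials (restr_R V) (fun s t => F (polar s t)) s0 t0 D (scal Ci D).
Proof.
  intros [phi [hphi [d1 [hd1 h1]]]].
  set (z0 := polar s0 t0) in *. set (l := phi z0).
  exists (scal z0 l). intros eps he.
  destruct (polar_lipschitz s0 t0) as [K [d2 [hK [hd2 h2]]]].
  assert (hn : 0 <= norm l) by apply norm_ge_0.
  assert (he1 : 0 < eps / (2 * K)) by (apply Rdiv_lt_0_compat; lra).
  assert (he2 : 0 < eps / (2 * (norm l + 1))) by (apply Rdiv_lt_0_compat; lra).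
  destruct (hphi _ he1) as [d3 [hd3 h3]].
  destruct (polar_expand s0 t0 _ he2) as [d4 [hd4 h4]].
  destruct (polar_near s0 t0 (Rmin d1 d3)) as [d5 [hd5 h5]]; [now apply Rmin_pos|].
  set (d := Rmin (Rmin d2 d4) d5).
  exists d. split; [unfold d; repeat apply Rmin_pos; trivial|]. intros s t hs ht.
  assert (hd : d <= d2 /\ d <= d4 /\ d <= d5).
  { unfold d. repeat split.
    - eapply Rle_trans; [apply Rmin_l|apply Rmin_l].
    - eapply Rle_trans; [apply Rmin_l|apply Rmin_r].
    - apply Rmin_r. }
  specialize (h2 s t ltac:(lra) ltac:(lra)). specialize (h4 s t ltac:(lra) ltac:(lra)).
  specialize (h5 s t ltac:(lra) ltac:(lra)).
  Rmin_bounds d1 d3.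
  set (w := polar s t) in *. fold z0 in h2, h4, h5.
  specialize (h1 w ltac:(lra)). specialize (h3 w I ltac:(lra)). fold l in h3.
  set (r := (w - z0 - (RtoC (s - s0) + Ci * RtoC (t - t0)) * z0)%C) in *.
  set (A := Rabs (s - s0) + Rabs (t - t0)) in *.
  assert (hA : 0 <= A) by (unfold A; pose proof (Rabs_pos (s - s0)); pose proof (Rabs_pos (t - t0)); lra).
  change (norm (minus (F w) (plus (F z0) (plus (scal (RtoC (s - s0)) (scal z0 l))
    (scal (RtoC (t - t0)) (scal Ci (scal z0 l)))))) <= eps * A).
  apply (norm_eq_le (V := V) _ (plus (scal (w - z0)%C (minus (phi w) l)) (scal r l))).
  { apply (eq_plus_of_minus (V := V)) in h1. rewrite h1. unfold r. lin_C V. }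
  eapply Rle_trans; [apply (norm_plus_le (V := V))|]. rewrite !(norm_scal_C (V := V)).
  assert (a1 : Cmod (w - z0) * norm (minus (phi w) l) <= K * A * (eps / (2 * K))).
  { apply Rmult_le_compat; [apply Cmod_ge_0|apply norm_ge_0|exact h2|left; exact h3]. }
  assert (a2 : Cmod r * norm l <= eps / (2 * (norm l + 1)) * A * (norm l + 1)).
  { apply Rmult_le_compat; [apply Cmod_ge_0|apply norm_ge_0|exact h4|lra]. }
  replace (K * A * (eps / (2 * K))) with (eps * A / 2) in a1 by (field; lra).
  replace (eps / (2 * (norm l + 1)) * A * (norm l + 1)) with (eps * A / 2) in a2 by (field; lra).
  eapply Rle_trans; [apply Rplus_le_compat; [exact a1|exact a2]|]. lra.
Qed.

Lemma minus_Ci_Ci (v : V) : scal (- Ci)%C (scal Ci v) = v.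
Proof.
  rewrite (scal_assoc (V := V)). change (mult (- Ci)%C Ci) with (- Ci * Ci)%C.
  replace (- Ci * Ci)%C with (RtoC 1) by (unfold Cmult, Copp, Ci, RtoC; simpl; f_equal; ring).
  exact (scal_one v).
Qed.

(** With P = -iH and Q = H the form P ds + Q dt is -i F(z) dz/z; the rotation by -i makes its mixed
    derivatives match, as [goursat] demands. *)
Lemma has_partials_rotate (H : R -> R -> V) (s0 t0 : R) (D : V) :
  has_partials (restr_R V) H s0 t0 D (scal Ci D) ->
  has_partials (restr_R V) (fun s t => scal (- Ci)%C (H s t)) s0 t0 (scal (- Ci)%C D) D.
Proof.
  intros h eps he. destruct (h eps he) as [d [hd h']]. exists d. split; trivial.
  intros s t hs ht. specialize (h' s t hs ht).
  change (norm (minus (H s t) (plus (H s0 t0) (plus (scal (RtoC (s - s0)) D)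
    (scal (RtoC (t - t0)) (scal Ci D))))) <= eps * (Rabs (s - s0) + Rabs (t - t0))) in h'.
  change (norm (minus (scal (- Ci)%C (H s t)) (plus (scal (- Ci)%C (H s0 t0))
    (plus (scal (RtoC (s - s0)) (scal (- Ci)%C D)) (scal (RtoC (t - t0)) D))))
    <= eps * (Rabs (s - s0) + Rabs (t - t0))).
  refine (norm_eq_le (V := V) _ (scal (- Ci)%C (minus (H s t) (plus (H s0 t0)
    (plus (scal (RtoC (s - s0)) D) (scal (RtoC (t - t0)) (scal Ci D)))))) _ _ _).
  - rewrite <- (minus_Ci_Ci D) at 2. lin_C V.
  - rewrite (norm_scal_C (V := V)), Cmod_opp, Cmod_Ci, Rmult_1_l. exact h'.
Qed.

Variable F : C -> V.
Hypothesis Fcont : forall z, annulus z -> cont_at annulus F z.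
Hypothesis Fdiff : forall z, 1 < Cmod z < exp 1 -> cdiff F z.

Let H (s t : R) : restr_R V := F (polar s t).

Lemma polar_annulus s t : 0 <= s <= 1 -> annulus (polar s t).
Proof.
  intros h. unfold annulus. rewrite Cmod_polar, <- exp_0.
  assert (hm : forall a b, a <= b -> exp a <= exp b).
  { intros a b [hab| ->]; [left; now apply exp_increasing|apply Rle_refl]. }
  rewrite exp_0 at 2. split; apply hm; lra.
Qed.

Lemma H_near s0 t0 eps : 0 <= s0 <= 1 -> 0 < eps -> exists delta, 0 < delta /\ forall s t,
  0 <= s <= 1 -> Rabs (s - s0) < delta -> Rabs (t - t0) < delta ->
  norm (minus (H s t) (H s0 t0)) < eps.
Proof.
  intros hs0 he. destruct (Fcont _ (polar_annulus s0 t0 hs0) eps he) as [d [hd h]].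
  destruct (polar_near s0 t0 d hd) as [d' [hd' h']]. exists d'. split; trivial.
  intros s t hs hs' ht. exact (h _ (polar_annulus s t hs) (h' s t hs' ht)).
Qed.

Lemma H_ex_RInt s a b : 0 <= s <= 1 -> ex_RInt (H s) a b.
Proof.
  intros hs. apply (ex_RInt_continuous (V := restr_R V)). intros t _.
  apply continuous_ball_norm. intros eps he. destruct (H_near s t eps hs he) as [d [hd h]].
  exists d. split; trivial. intros y hy. apply h; trivial. rewrite Rminus_eq_0, Rabs_R0. trivial.
Qed.

(** Compactness of a period makes continuity in s uniform in t. It includes the boundary values s0 =
    0 and s0 = 1, where F is continuous but not assumed differentiable. *)
Lemma H_uniform s0 eps : 0 <= s0 <= 1 -> 0 < eps -> exists delta, 0 < delta /\ forall s,
  0 <= s <= 1 -> Rabs (s - s0) < delta -> forall t, 0 <= t <= 2 * PI ->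
  norm (minus (H s t) (H s0 t)) <= eps.
Proof.
  intros hs0 he.
  assert (hch : forall t0, exists d : posreal, forall s t, 0 <= s <= 1 ->
    Rabs (s - s0) < d -> Rabs (t - t0) < d -> norm (minus (H s t) (H s0 t0)) < eps / 2).
  { intros t0. destruct (H_near s0 t0 (eps / 2) hs0 ltac:(lra)) as [d [hd h]].
    exists (mkposreal d hd). exact h. }
  apply choice in hch. destruct hch as [delta hdelta].
  destruct (compactness_value_1d 0 (2 * PI) delta) as [d hd].
  exists d. split; [apply cond_pos|]. intros s hs hs' t ht.
  destruct (NNPP _ (hd t ht)) as [t0 [_ [h1 h2]]].
  pose proof (hdelta t0 s t hs ltac:(lra) h1) as b1.
  pose proof (hdelta t0 s0 t hs0 ltac:(rewrite Rminus_eq_0, Rabs_R0; apply cond_pos) h1) as b2.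
  change (norm (minus (F (polar s t)) (F (polar s0 t))) <= eps).
  refine (norm_eq_le (V := V) _ (minus (minus (F (polar s t)) (F (polar s0 t0)))
    (minus (F (polar s0 t)) (F (polar s0 t0)))) _ _ _); [lin_C V|].
  eapply Rle_trans; [apply (norm_minus_le (V := V))|].
  change (norm (minus (F (polar s t)) (F (polar s0 t0))) < eps / 2) in b1.
  change (norm (minus (F (polar s0 t)) (F (polar s0 t0))) < eps / 2) in b2. lra.
Qed.

(** Goursat's theorem on [a, b] x [0, 2 pi]: the sides t = 0 and t = 2 pi cancel by periodicity, and
    the two remaining sides are the circle integrals. *)
Lemma circle_integral_interior a b : 0 < a -> a <= b -> b < 1 ->
  RInt (H a) 0 (2 * PI) = RInt (H b) 0 (2 * PI).
Proof.
  intros ha hab hb. pose proof PI_RGT_0 as hpi.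
  assert (hg : green (restr_R V) (fun s t => scal (- Ci)%C (F (polar s t))) H a b 0 (2 * PI) = zero).
  { apply goursat; [|lra|lra]. intros s t hs ht.
    destruct (polar_partials F s t) as [D hD].
    - apply Fdiff. rewrite Cmod_polar. rewrite <- exp_0 at 1. split; apply exp_increasing; lra.
    - exists D, (scal Ci D), (scal (- Ci)%C D). split; [exact hD|].
      exact (has_partials_rotate _ s t D hD). }
  unfold green in hg.
  rewrite (RInt_minus (V := restr_R V)) in hg by (apply H_ex_RInt; lra).
  rewrite (RInt_ext (V := restr_R V) _ (fun _ => zero) a b) in hg.
  2:{ intros s _. rewrite <- (Rplus_0_l (2 * PI)), polar_2PI. apply (minus_eq_zero (G := restr_R V)). }
  rewrite (RInt_const (V := restr_R V)) in hg.
  set (A := RInt (H a) 0 (2 * PI)) in *. set (B := RInt (H b) 0 (2 * PI)) in *.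
  assert (h1 : B = plus A (minus (minus B A) (scal (b - a) zero))) by lin_R (restr_R V).
  transitivity (plus A zero); [|symmetry]; [|etransitivity; [exact h1|]].
  - symmetry. apply (plus_zero_r (G := restr_R V)).
  - exact (f_equal (plus A) hg).
Qed.

Lemma circle_integral_near s0 eps : 0 <= s0 <= 1 -> 0 < eps -> exists delta, 0 < delta /\ forall s,
  0 <= s <= 1 -> Rabs (s - s0) < delta ->
  norm (minus (RInt (H s) 0 (2 * PI)) (RInt (H s0) 0 (2 * PI))) <= eps.
Proof.
  intros hs0 he. pose proof PI_RGT_0 as hpi.
  destruct (H_uniform s0 (eps / (2 * PI)) hs0) as [d [hd h]]; [apply Rdiv_lt_0_compat; lra|].
  exists d. split; trivial. intros s hs hs'. specialize (h s hs hs').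
  replace eps with ((2 * PI - 0) * (eps / (2 * PI))) by (field; lra).
  apply (norm_RInt_le (V := restr_R V) (fun t => minus (H s t) (H s0 t)) (fun _ => eps / (2 * PI)) 0 (2 * PI)).
  - lra.
  - exact h.
  - apply (is_RInt_minus (V := restr_R V)); apply (RInt_correct (V := restr_R V)); now apply H_ex_RInt.
  - apply (is_RInt_const (V := R_NormedModule)).
Qed.

(** The circle integrals agree in the open annulus and depend continuously on s up to both boundary
    circles. *)
Lemma cauchy_annulus :
  RInt (V := restr_R V) (fun t => F (polar 0 t)) 0 (2 * PI) =
  RInt (V := restr_R V) (fun t => F (polar 1 t)) 0 (2 * PI).
Proof.
  set (I0 := RInt (H 0) 0 (2 * PI)). set (I1 := RInt (H 1) 0 (2 * PI)).
  change (I0 = I1).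
  assert (h : norm (minus I0 I1) = 0).
  { apply Rle_antisym; [|apply norm_ge_0]. apply le_epsilon. intros eps he. rewrite Rplus_0_l.
    destruct (circle_integral_near 0 (eps / 2) ltac:(lra) ltac:(lra)) as [d0 [hd0 h0]].
    destruct (circle_integral_near 1 (eps / 2) ltac:(lra) ltac:(lra)) as [d1 [hd1 h1]].
    (* At most 1/2, so that a <= 1 - a, and within reach of both boundary estimates. *)
    set (a := Rmin (Rmin d0 d1) 1 / 2).
    assert (ha : 0 < Rmin (Rmin d0 d1) 1) by (repeat apply Rmin_pos; lra).
    assert (ha1 : Rmin (Rmin d0 d1) 1 <= 1) by apply Rmin_r.
    assert (ha2 : Rmin (Rmin d0 d1) 1 <= d0) by (eapply Rle_trans; [apply Rmin_l|apply Rmin_l]).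
    assert (ha3 : Rmin (Rmin d0 d1) 1 <= d1) by (eapply Rle_trans; [apply Rmin_l|apply Rmin_r]).
    specialize (h0 a ltac:(unfold a; lra) ltac:(rewrite Rabs_right; unfold a; lra)).
    specialize (h1 (1 - a) ltac:(unfold a; lra) ltac:(rewrite Rabs_left; unfold a; lra)).
    rewrite (circle_integral_interior a (1 - a)) in h0 by (unfold a; lra).
    fold I0 in h0. fold I1 in h1. set (J := RInt (H (1 - a)) 0 (2 * PI)) in *.
    assert (e : minus I0 I1 = minus (minus J I1) (minus J I0)) by lin_R (restr_R V).
    rewrite e. eapply Rle_trans; [apply norm_sub_le|]. lra. }
  apply (norm_eq_zero (V := restr_R V)) in h.
  transitivity (plus (minus I0 I1) I1).
  - lin_R (restr_R V).
  - rewrite h. apply (plus_zero_l (G := restr_R V)).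
Qed.

End CauchyAnnulus.

(** * Fejer sums *)

Definition zpow (z : C) (n : Z) : C :=
  match n with
  | Z0 => RtoC 1
  | Zpos p => Cpow z (Pos.to_nat p)
  | Zneg p => Cpow (/ z) (Pos.to_nat p)
  end.

Lemma zpow_nat (z : C) (k : nat) : zpow z (Z.of_nat k) = Cpow z k.
Proof. destruct k; simpl; trivial. now rewrite SuccNat2Pos.id_succ. Qed.

Lemma zpow_neg_nat (z : C) (k : nat) : zpow z (- Z.of_nat k) = Cpow (/ z) k.
Proof. destruct k; simpl; trivial. now rewrite SuccNat2Pos.id_succ. Qed.

Lemma Z_nat_cases (n : Z) : exists k, n = Z.of_nat k \/ n = (- Z.of_nat k)%Z.
Proof. exists (Z.abs_nat n). lia. Qed.

Lemma Cpow_polar (s t : R) (k : nat) : Cpow (polar s t) k = polar (INR k * s) (INR k * t).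
Proof.
  induction k as [|k IH].
  - simpl Cpow. rewrite !Rmult_0_l, polar_0_l, cis_0. reflexivity.
  - rewrite Cpow_S, IH, <- polar_plus, S_INR. f_equal; ring.
Qed.

Lemma polar_inv (s t : R) : (/ polar s t)%C = polar (- s) (- t).
Proof.
  pose proof (polar_neq_0 s t) as h.
  assert (e : (polar (- s) (- t) * polar s t)%C = 1).
  { rewrite <- polar_plus, !Rplus_opp_l, polar_0_l. apply cis_0. }
  transitivity (polar (- s) (- t) * polar s t * / polar s t)%C; [rewrite e; ring|field; trivial].
Qed.

Lemma zpow_polar (s t : R) (n : Z) : zpow (polar s t) n = polar (IZR n * s) (IZR n * t).
Proof.
  destruct (Z_nat_cases n) as [k [->| ->]].
  - rewrite zpow_nat, Cpow_polar, <- INR_IZR_INZ. reflexivity.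
  - rewrite zpow_neg_nat, polar_inv, Cpow_polar, opp_IZR, <- INR_IZR_INZ. f_equal; ring.
Qed.

Lemma zpow_cis (t : R) (n : Z) : zpow (cis t) n = cis (IZR n * t).
Proof. rewrite <- polar_0_l, zpow_polar, Rmult_0_r. apply polar_0_l. Qed.

Lemma cis_2PI_mult (t : R) (n : Z) : cis (t + IZR n * (2 * PI)) = cis t.
Proof.
  rewrite cis_plus, <- zpow_cis.
  replace (cis (2 * PI)) with (RtoC 1).
  - replace (zpow 1 n) with (RtoC 1); [apply Cmult_1_r|].
    replace (RtoC 1) with (cis 0) at 2 by apply cis_0.
    rewrite zpow_cis, Rmult_0_r. symmetry; apply cis_0.
  - rewrite <- (Rplus_0_l (2 * PI)), cis_2PI. symmetry; apply cis_0.
Qed.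

(** Removing whole periods; this links suprema over all real angles with those over [0, 2 pi). *)
Lemma cis_reduce (t : R) : exists t', 0 <= t' < 2 * PI /\ cis t' = cis t.
Proof.
  pose proof PI_RGT_0 as hpi. set (k := Int_part (t / (2 * PI))).
  exists (t + IZR (- k) * (2 * PI)). split; [|apply cis_2PI_mult].
  destruct (base_Int_part (t / (2 * PI))) as [h1 h2]. fold k in h1, h2.
  rewrite opp_IZR. replace t with (t / (2 * PI) * (2 * PI)) at 1 2 by (field; lra).
  replace (t / (2 * PI) * (2 * PI) + - IZR k * (2 * PI)) with ((t / (2 * PI) - IZR k) * (2 * PI)) by ring.
  split.
  - apply Rmult_le_pos; lra.
  - apply Rlt_le_trans with (1 * (2 * PI)); [apply Rmult_lt_compat_r; lra|lra].
Qed.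

Lemma circle_cis (z : C) : circle z -> exists t, z = cis t.
Proof.
  destruct z as [a b]. unfold circle, Cmod. simpl fst; simpl snd. intros h.
  assert (h1 : a ^ 2 + b ^ 2 = 1).
  { rewrite <- (sqrt_sqrt (a ^ 2 + b ^ 2)); [rewrite h; ring|].
    pose proof (pow2_ge_0 a). pose proof (pow2_ge_0 b). lra. }
  assert (ha : -1 <= a <= 1).
  { pose proof (pow2_ge_0 b). assert (a ^ 2 <= 1) by lra. split; nra. }
  assert (hb : sqrt (1 - a²) = Rabs b).
  { replace (1 - a²) with (b²) by (unfold Rsqr; lra). apply sqrt_Rsqr_abs. }
  destruct (Rle_dec 0 b) as [h0|h0].
  - exists (acos a). unfold cis. rewrite cos_acos, sin_acos, hb, Rabs_right by lra. reflexivity.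
  - exists (- acos a). unfold cis. rewrite cos_neg, sin_neg, cos_acos, sin_acos, hb, Rabs_left by lra.
    now rewrite Ropp_involutive.
Qed.

Lemma circle_is_cis (t : R) : circle (cis t).
Proof. apply Cmod_cis. Qed.

Lemma cont_at_Cpow (D : C -> Prop) (k : C -> C) (n : nat) (z : C) :
  cont_at (V := CC) D k z -> cont_at (V := CC) D (fun w => Cpow (k w) n) z.
Proof.
  intros hk. induction n as [|n IH]; [exact (cont_at_const (V := CC) D (RtoC 1) z)|].
  exact (cont_at_scal (V := CC) D k (fun w => Cpow (k w) n) z hk IH).
Qed.

Lemma cont_at_zpow (D : C -> Prop) (n : Z) (z : C) : z <> 0 ->
  cont_at (V := CC) D (fun w => zpow w n) z.
Proof.
  intros hz. destruct n; simpl.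
  - exact (cont_at_const (V := CC) D (RtoC 1) z).
  - apply (cont_at_Cpow D (fun w => w)), cont_at_id.
  - apply (cont_at_Cpow D (fun w => / w)%C).
    apply (cont_at_inv D (fun w => w)); [trivial|apply cont_at_id].
Qed.

Lemma cdiff_zpow (n : Z) (z : C) : z <> 0 -> cdiff (V := CC) (fun w => zpow w n) z.
Proof.
  intros hz.
  assert (hp : forall (k : C -> C) m, cdiff (V := CC) k z -> cdiff (V := CC) (fun w => Cpow (k w) m) z).
  { intros k m hk. induction m as [|m IH]; [exact (cdiff_const (V := CC) (RtoC 1) z)|].
    exact (cdiff_scal (V := CC) k (fun w => Cpow (k w) m) z hk IH). }
  destruct n; simpl.
  - exact (cdiff_const (V := CC) (RtoC 1) z).
  - apply (hp (fun w => w)), cdiff_id.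
  - apply (hp (fun w => / w)%C). apply (cdiff_inv (fun w => w)); [trivial|apply cdiff_id].
Qed.

Lemma iter_app {I T : Type} (op : T -> T -> T) (x0 : T) (F G : list I) (f : I -> T) :
  (forall x, op x0 x = x) -> (forall x y z, op x (op y z) = op (op x y) z) ->
  iter op x0 (F ++ G) f = op (iter op x0 F f) (iter op x0 G f).
Proof.
  intros h0 hA. induction F as [|x F IH]; simpl; [now rewrite h0|]. now rewrite IH, hA.
Qed.

Lemma iter_list_prod {I J T : Type} (op : T -> T -> T) (x0 : T) (F : list I) (G : list J)
  (f : I * J -> T) :
  (forall x, op x0 x = x) -> (forall x y z, op x (op y z) = op (op x y) z) ->
  iter op x0 (list_prod F G) f = iter op x0 F (fun i => iter op x0 G (fun j => f (i, j))).
Proof.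
  intros h0 hA. induction F as [|x F IH]; simpl; trivial.
  rewrite iter_app, IH, iter_map by trivial. reflexivity.
Qed.

Lemma iter_morph {I S T : Type} (op : S -> S -> S) (x0 : S) (op' : T -> T -> T) (x0' : T)
  (h : S -> T) (F : list I) (f : I -> S) :
  h x0 = x0' -> (forall x y, h (op x y) = op' (h x) (h y)) ->
  h (iter op x0 F f) = iter op' x0' F (fun i => h (f i)).
Proof. intros h0 hop. induction F as [|x F IH]; simpl; trivial. now rewrite hop, IH. Qed.

Lemma is_RInt_iter {V : NormedModule R_AbsRing} {I : Type} (F : list I) (f : I -> R -> V)
  (a b : R) (If : I -> V) :
  (forall i, In i F -> is_RInt (f i) a b (If i)) ->
  is_RInt (fun t => iter plus zero F (fun i => f i t)) a b (iter plus zero F If).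
Proof.
  induction F as [|x F IH]; intros h.
  - cbn [iter]. pose proof (is_RInt_const (V := V) a b zero) as h0.
    assert (e : scal (b - a) (zero : V) = zero) by exact (scal_zero_r (V := V) (b - a)).
    rewrite e in h0. exact h0.
  - cbn [iter]. apply is_RInt_plus; [apply h; now left|]. apply IH. intros; apply h; now right.
Qed.

(** Fejer means are indexed by pairs (k, l) with frequency k - l: frequency n then occurs N + 1 -
    |n| times, the usual triangular weight, and the kernel is visibly a squared modulus. *)
Definition square_indices (N : nat) : list (nat * nat) := list_prod (seq 0 (S N)) (seq 0 (S N)).

Definition index_diff (kl : nat * nat) : Z := (Z.of_nat (fst kl) - Z.of_nat (snd kl))%Z.

(** The one-sided geometric sum; its squared modulus is N + 1 times the Fejer kernel. *)
Definition dirichlet (N : nat) (u : R) : C := iter Cplus (RtoC 0) (seq 0 (S N)) (fun k => cis (INR k * u)).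

Lemma dirichlet_geometric (N : nat) (u : R) :
  ((1 - cis u) * dirichlet N u)%C = (1 - cis (INR (S N) * u))%C.
Proof.
  unfold dirichlet. induction N as [|N IH].
  - simpl. rewrite Rmult_0_l, Rmult_1_l, cis_0. ring.
  - rewrite seq_S, iter_app by (intros; ring). rewrite Nat.add_0_l.
    rewrite Cmult_plus_distr_l, IH. cbn [iter].
    replace (INR (S (S N)) * u) with (u + INR (S N) * u) by (rewrite (S_INR (S N)); ring).
    rewrite cis_plus. ring.
Qed.

(** Away from u = 0 modulo 2 pi the closed form of the geometric sum gives a bound independent of
    N. *)
Lemma dirichlet_bound (N : nat) (u delta : R) : 0 < delta -> delta <= Cmod (1 - cis u)%C ->
  Cmod (dirichlet N u) ^ 2 <= 4 / (delta * delta).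
Proof.
  intros hd h.
  assert (h2 : Cmod (1 - cis u)%C * Cmod (dirichlet N u) <= 2).
  { rewrite <- Cmod_mult, dirichlet_geometric. unfold Cminus.
    eapply Rle_trans; [apply Cmod_triangle|]. rewrite Cmod_opp, Cmod_1, Cmod_cis. lra. }
  pose proof (Cmod_ge_0 (dirichlet N u)) as h0. set (d := Cmod (dirichlet N u)) in *.
  assert (h3 : delta * d <= 2) by (eapply Rle_trans; [apply Rmult_le_compat_r; eassumption|trivial]).
  assert (hdd : 0 < delta * delta) by now apply Rmult_lt_0_compat.
  apply Rmult_le_reg_r with (delta * delta); trivial.
  unfold Rdiv. rewrite Rmult_assoc, Rinv_l, Rmult_1_r by lra.
  assert (0 <= delta * d) by (apply Rmult_le_pos; lra). simpl. nra.
Qed.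

(* Both sides are N + 1 times the Fejer kernel. *)
Lemma dirichlet_square (N : nat) (u : R) :
  iter Cplus (RtoC 0) (square_indices N) (fun kl => cis (IZR (index_diff kl) * u)) =
  RtoC (Cmod (dirichlet N u) ^ 2).
Proof.
  rewrite Cmod2_conj. unfold square_indices. rewrite iter_list_prod by (intros; ring).
  assert (hm : forall F (b : C), (iter Cplus (RtoC 0) F (fun k => cis (INR k * u)) * b)%C =
    iter Cplus (RtoC 0) F (fun k => cis (INR k * u) * b)%C).
  { intros F b. apply (iter_morph Cplus (RtoC 0) Cplus (RtoC 0) (fun z => z * b)%C);
      intros; ring. }
  unfold dirichlet at 1. rewrite hm. f_equal.
  extensionality k.
  unfold dirichlet.
  rewrite (iter_morph Cplus (RtoC 0) Cplus (RtoC 0) Cconj).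
  - rewrite (iter_morph Cplus (RtoC 0) Cplus (RtoC 0) (fun z => cis (INR k * u) * z)%C)
      by (intros; ring).
    f_equal. extensionality l.
    unfold index_diff. simpl fst; simpl snd. rewrite minus_IZR, <- !INR_IZR_INZ.
    replace ((INR k - INR l) * u) with (INR k * u + - (INR l * u)) by ring.
    rewrite cis_plus. f_equal. unfold cis, Cconj; simpl. now rewrite cos_neg, sin_neg.
  - unfold Cconj, RtoC; simpl. f_equal. ring.
  - intros x y. unfold Cconj, Cplus; simpl. f_equal. ring.
Qed.

Lemma is_RInt_eq {V : NormedModule R_AbsRing} (f : R -> V) (a b : R) (v w : V) :
  v = w -> is_RInt f a b v -> is_RInt f a b w.
Proof. now intros ->. Qed.

Lemma is_RInt_cos_sin (m : Z) :
  is_RInt (V := R_NormedModule) (fun t => cos (IZR m * t)) 0 (2 * PI) (if Z.eq_dec m 0 then 2 * PI else 0) /\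
  is_RInt (V := R_NormedModule) (fun t => sin (IZR m * t)) 0 (2 * PI) 0.
Proof.
  destruct (Z.eq_dec m 0) as [->|hm].
  - split.
    + apply (is_RInt_ext (V := R_NormedModule) (fun _ => 1)).
      { intros t _. now rewrite Rmult_0_l, cos_0. }
      eapply is_RInt_eq; [|apply (is_RInt_const (V := R_NormedModule))].
      change ((2 * PI - 0) * 1 = 2 * PI). ring.
    + apply (is_RInt_ext (V := R_NormedModule) (fun _ => 0)).
      { intros t _. now rewrite Rmult_0_l, sin_0. }
      eapply is_RInt_eq; [|apply (is_RInt_const (V := R_NormedModule))].
      change ((2 * PI - 0) * 0 = 0). ring.
  - assert (hm' : IZR m <> 0) by now apply IZR_neq.
    pose proof (cis_2PI_mult 0 m) as hc. rewrite Rplus_0_l, cis_0 in hc.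
    unfold cis, RtoC in hc. injection hc as hc hs.
    split.
    + eapply (is_RInt_eq (V := R_NormedModule)).
      2:{ apply (is_RInt_derive (V := R_CompleteNormedModule) (fun t => sin (IZR m * t) / IZR m)).
        -- intros t _. auto_derive; trivial. field; trivial.
        -- intros t _. apply (ex_derive_continuous (fun t => cos (IZR m * t))). auto_derive; trivial. }
      change (sin (IZR m * (2 * PI)) / IZR m - sin (IZR m * 0) / IZR m = 0).
        rewrite hs, Rmult_0_r, sin_0. field; trivial.
    + eapply (is_RInt_eq (V := R_NormedModule)).
      2:{ apply (is_RInt_derive (V := R_CompleteNormedModule) (fun t => - cos (IZR m * t) / IZR m)).
        -- intros t _. auto_derive; trivial. field; trivial.
        -- intros t _. apply (ex_derive_continuous (fun t => sin (IZR m * t))). auto_derive; trivial. }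
      change (- cos (IZR m * (2 * PI)) / IZR m - - cos (IZR m * 0) / IZR m = 0).
        rewrite hc, Rmult_0_r, cos_0. field; trivial.
Qed.

Lemma is_RInt_cos_translate (m : Z) (s : R) :
  is_RInt (V := R_NormedModule) (fun t => cos (IZR m * (s - t))) 0 (2 * PI)
    (if Z.eq_dec m 0 then 2 * PI else 0).
Proof.
  destruct (is_RInt_cos_sin m) as [hc hs].
  pose proof (is_RInt_plus (V := R_NormedModule) _ _ _ _ _ _
    (is_RInt_scal (V := R_NormedModule) _ _ _ (cos (IZR m * s)) _ hc)
    (is_RInt_scal (V := R_NormedModule) _ _ _ (sin (IZR m * s)) _ hs)) as h.
  eapply (is_RInt_eq (V := R_NormedModule)).
  2:{ eapply is_RInt_ext; [|exact h]. intros t _. simpl.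
    change (cos (IZR m * s) * cos (IZR m * t) + sin (IZR m * s) * sin (IZR m * t) = cos (IZR m * (s - t))).
    rewrite <- cos_minus. f_equal. ring. }
  change (cos (IZR m * s) * (if Z.eq_dec m 0 then 2 * PI else 0) + sin (IZR m * s) * 0 =
      (if Z.eq_dec m 0 then 2 * PI else 0)).
    destruct (Z.eq_dec m 0) as [->|]; [rewrite Rmult_0_l, cos_0|]; ring.
Qed.

Lemma iter_delta {I T : Type} (op : T -> T -> T) (x0 : T) (F : list I) (k : I) (v : T)
  (dec : forall i, {i = k} + {i <> k}) :
  (forall x, op x0 x = x) -> (forall x, op x x0 = x) -> NoDup F ->
  iter op x0 F (fun i => if dec i then v else x0) =
  if excluded_middle_informative (In k F) then v else x0.
Proof.
  intros h0 h0' hF. induction hF as [|x F hx hF IH]; simpl iter.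
  - destruct (excluded_middle_informative (In k nil)); [easy|trivial].
  - rewrite IH. destruct (dec x) as [->|hxk].
    + destruct (excluded_middle_informative (In k F)); [easy|].
      destruct (excluded_middle_informative (In k (k :: F))) as [|hn]; [apply h0'|].
      destruct hn; now left.
    + rewrite h0. destruct (excluded_middle_informative (In k F)) as [i1|hn1];
        destruct (excluded_middle_informative (In k (x :: F))) as [i2|hn2]; trivial.
      * destruct hn2; now right.
      * destruct i2; easy.
Qed.

(** By orthogonality only the N + 1 diagonal pairs contribute to the integral. *)
Lemma is_RInt_fejer_kernel (N : nat) (s : R) :
  is_RInt (V := R_NormedModule) (fun t => Cmod (dirichlet N (s - t)) ^ 2) 0 (2 * PI)
    (INR (S N) * (2 * PI)).
Proof.
  pose proof (is_RInt_iter (V := R_NormedModule) (square_indices N)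
    (fun kl t => cos (IZR (index_diff kl) * (s - t))) 0 (2 * PI)
    (fun kl => if Z.eq_dec (index_diff kl) 0 then 2 * PI else 0)
    (fun kl _ => is_RInt_cos_translate (index_diff kl) s)) as h.
  eapply (is_RInt_eq (V := R_NormedModule)); cycle 1.
  - eapply is_RInt_ext; [|exact h]. intros t _.
    transitivity (fst (RtoC (Cmod (dirichlet N (s - t)) ^ 2))); [|reflexivity].
    rewrite <- dirichlet_square.
    symmetry. exact (iter_morph Cplus (RtoC 0) Rplus 0 fst _ _ eq_refl (fun _ _ => eq_refl)).
  - change (iter Rplus 0 (square_indices N) (fun kl => if Z.eq_dec (index_diff kl) 0 then 2 * PI else 0)
      = INR (S N) * (2 * PI)).
    unfold square_indices. rewrite iter_list_prod by (intros; ring).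
    rewrite (iter_ext Rplus 0 (seq 0 (S N)) _ (fun _ => 2 * PI)).
    + rewrite iter_const, length_seq. reflexivity.
    + intros k hk.
      transitivity (iter Rplus 0 (seq 0 (S N)) (fun l => if Nat.eq_dec l k then 2 * PI else 0)).
      * f_equal. extensionality l.
        unfold index_diff; simpl fst; simpl snd.
        destruct (Z.eq_dec _ 0); destruct (Nat.eq_dec l k); trivial; lia.
      * rewrite (iter_delta Rplus 0 _ k (2 * PI) (fun l => Nat.eq_dec l k)); try (intros; ring).
        -- destruct (excluded_middle_informative _) as [_|n]; [trivial|easy].
        -- apply seq_NoDup.
Qed.

Section Fejer.

Variable V : CompleteNormedModule C_AbsRing.

Definition cont_circle (g : C -> V) : Prop := forall z, circle z -> cont_at circle g z.

Lemma cont_circle_path (g : C -> V) t0 eps : cont_circle g -> 0 < eps ->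
  exists delta, 0 < delta /\ forall t, Rabs (t - t0) < delta ->
    norm (minus (g (cis t)) (g (cis t0))) < eps.
Proof.
  intros hg he. destruct (hg _ (circle_is_cis t0) eps he) as [d [hd h]].
  destruct (polar_near 0 t0 d hd) as [d' [hd' h']]. exists d'. split; trivial.
  intros t ht. apply h; [apply circle_is_cis|].
  rewrite <- !polar_0_l. apply h'; trivial. rewrite Rminus_eq_0, Rabs_R0. trivial.
Qed.

Lemma cont_circle_continuous (g : C -> V) t0 : cont_circle g ->
  continuous (U := restr_R V) (fun t => g (cis t)) t0.
Proof.
  intros hg. apply (continuous_ball_norm (restr_R V)). intros eps he.
  exact (cont_circle_path g t0 eps hg he).
Qed.

Lemma cont_circle_ex_RInt (g : C -> V) a b : cont_circle g ->
  ex_RInt (V := restr_R V) (fun t => g (cis t)) a b.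
Proof.
  intros hg. apply (ex_RInt_continuous (V := restr_R V)). intros t _.
  now apply cont_circle_continuous.
Qed.

Lemma cont_circle_zpow_scal (g : C -> V) (n : Z) : cont_circle g ->
  cont_circle (fun z => scal (zpow z n) (g z)).
Proof.
  intros hg z hz. apply (cont_at_scal (V := V) circle (fun z => zpow z n)); [|now apply hg].
  apply cont_at_zpow. apply Cmod_gt_0. rewrite hz. lra.
Qed.

Lemma fourier_ex_RInt (g : C -> V) (n : Z) : cont_circle g ->
  ex_RInt (V := restr_R V) (fun t => scal (cis (- (IZR n * t))) (g (cis t))) 0 (2 * PI).
Proof.
  intros hg. pose proof (cont_circle_ex_RInt _ 0 (2 * PI) (cont_circle_zpow_scal g (- n) hg)) as h.
  eapply ex_RInt_ext; [|exact h]. intros t _. cbv beta. f_equal.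
  rewrite zpow_cis, opp_IZR. f_equal. ring.
Qed.

Lemma two_PI_scal (v : V) : scal (RtoC (2 * PI)) (scal (RtoC (/ (2 * PI))) v) = v.
Proof.
  rewrite (scal_assoc (V := V)).
  change (mult (RtoC (2 * PI)) (RtoC (/ (2 * PI)))) with (RtoC (2 * PI) * RtoC (/ (2 * PI)))%C.
  rewrite <- RtoC_mult, Rinv_r; [exact (scal_one v)|]. pose proof PI_RGT_0. lra.
Qed.

(** Convolution with the character of frequency m picks out the m-th Fourier coefficient, because
    cis(m(s - t)) factors. *)
Lemma is_RInt_fourier (g : C -> V) (m : Z) (s : R) : cont_circle g ->
  is_RInt (V := restr_R V) (fun t => scal (cis (IZR m * (s - t))) (g (cis t))) 0 (2 * PI)
    (scal (RtoC (2 * PI)) (scal (cis (IZR m * s)) (fourier_coef g m))).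
Proof.
  intros hg.
  pose proof (is_RInt_linear (V := restr_R V) _ _ _ _ _ (is_linear_restr_scal V (cis (IZR m * s)))
    (RInt_correct (V := restr_R V) _ _ _ (fourier_ex_RInt g m hg))) as h.
  eapply (is_RInt_eq (V := restr_R V)); cycle 1.
  - eapply is_RInt_ext; [|exact h]. intros t _. cbv beta.
    rewrite (scal_assoc (V := V)). f_equal.
    change (mult (cis (IZR m * s)) (cis (- (IZR m * t)))) with (cis (IZR m * s) * cis (- (IZR m * t)))%C.
    rewrite <- cis_plus. f_equal. ring.
  - unfold fourier_coef.
    rewrite <- (two_PI_scal (scal (cis (IZR m * s)) _)). f_equal. lin_C V.
Qed.

Lemma is_linear_restr_vec (v : V) :
  is_linear (U := R_NormedModule) (V := restr_R V) (fun r : R => scal (RtoC r) v).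
Proof. exact (is_linear_scal_l (V := restr_R V) v). Qed.

(** Measured by chords, so that angles near 0 and near 2 pi count as close; only [s] has to be
    reduced to a compact period. *)
Lemma cont_circle_uniform (g : C -> V) eps : cont_circle g -> 0 < eps ->
  exists delta, 0 < delta /\ forall s t, Cmod (cis t - cis s)%C < delta ->
    norm (minus (g (cis t)) (g (cis s))) <= eps.
Proof.
  intros hg he.
  (* The factor 2 leaves room for [t], whose distance to the centre [t0] is bounded through [s]. *)
  assert (hch : forall t0, exists d : posreal, forall t, Cmod (cis t - cis t0)%C < 2 * d ->
    norm (minus (g (cis t)) (g (cis t0))) < eps / 2).
  { intros t0. destruct (hg _ (circle_is_cis t0) (eps / 2) ltac:(lra)) as [d [hd h]].
    assert (hd2 : 0 < d / 2) by lra. exists (mkposreal _ hd2). intros t ht.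
    simpl in ht. apply h; [apply circle_is_cis|]. lra. }
  apply choice in hch. destruct hch as [delta hdelta].
  (* Compactness is available for intervals of angles, so chord radii are converted into angle
     radii. *)
  assert (hch : forall t0, exists d : posreal, d <= delta t0 /\ forall t, Rabs (t - t0) < d ->
    Cmod (cis t - cis t0)%C < delta t0).
  { intros t0. destruct (polar_near 0 t0 (delta t0) (cond_pos _)) as [d [hd h]].
    assert (hd2 : 0 < Rmin d (delta t0)) by (apply Rmin_pos; [trivial|apply cond_pos]).
    exists (mkposreal _ hd2). simpl. split; [apply Rmin_r|]. intros t ht.
    pose proof (Rmin_l d (delta t0)).
    rewrite <- !polar_0_l. apply h; [rewrite Rminus_eq_0, Rabs_R0; trivial|lra]. }
  apply choice in hch. destruct hch as [delta' hdelta'].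
  destruct (compactness_value_1d 0 (2 * PI) delta') as [d hd].
  exists d. split; [apply cond_pos|]. intros s t hst.
  destruct (cis_reduce s) as [s' [hs' hss]]. rewrite <- hss in *.
  destruct (NNPP _ (hd s' ltac:(lra))) as [t0 [_ [h1 h2]]].
  destruct (hdelta' t0) as [h3 h4]. specialize (h4 s' h1).
  pose proof (cond_pos (delta t0)).
  pose proof (hdelta t0 s' ltac:(lra)) as b1.
  assert (b2 : norm (minus (g (cis t)) (g (cis t0))) < eps / 2).
  { apply hdelta. replace (cis t - cis t0)%C with ((cis t - cis s') + (cis s' - cis t0))%C by ring.
    eapply Rle_lt_trans; [apply Cmod_triangle|]. lra. }
  apply (norm_eq_le (V := V) _ (minus (minus (g (cis t)) (g (cis t0))) (minus (g (cis s')) (g (cis t0)))));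
    [lin_C V|].
  eapply Rle_trans; [apply (norm_minus_le (V := V))|]. lra.
Qed.

Lemma cont_circle_bounded (g : C -> V) : cont_circle g ->
  exists M, 0 <= M /\ forall t, norm (g (cis t)) <= M.
Proof.
  intros hg.
  assert (hch : forall t0, exists d : posreal, forall t, Rabs (t - t0) < d ->
    norm (minus (g (cis t)) (g (cis t0))) < 1).
  { intros t0. destruct (cont_circle_path g t0 1 hg Rlt_0_1) as [d [hd h]]. exists (mkposreal d hd). exact h. }
  pose proof PI_RGT_0 as hpi.
  destruct (continuity_ab_maj (fun t => norm (g (cis t))) 0 (2 * PI)) as [tm [hm _]]; [lra| |].
  - intros t _. apply continuity_pt_filterlim.
    eapply (filterlim_comp _ _ _ (fun t => g (cis t)) norm);
      [exact (cont_circle_continuous g t hg)|apply (filterlim_norm (V := restr_R V))].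
  - exists (norm (g (cis tm))). split; [apply norm_ge_0|]. intros t.
    destruct (cis_reduce t) as [t' [ht' <-]]. apply hm. lra.
Qed.

Definition fejer_sum (g : C -> V) (N : nat) (s : R) : V :=
  scal (RtoC (/ INR (S N))) (iter plus zero (square_indices N)
    (fun kl => scal (cis (IZR (index_diff kl) * s)) (fourier_coef g (index_diff kl)))).

(** The kernel has total mass 2 pi (N + 1), so subtracting the constant g(s) under the integral
    subtracts it from the mean. *)
Lemma is_RInt_fejer (g : C -> V) (N : nat) (s : R) : cont_circle g ->
  is_RInt (V := restr_R V)
    (fun t => scal (RtoC (Cmod (dirichlet N (s - t)) ^ 2)) (minus (g (cis t)) (g (cis s))))
    0 (2 * PI) (scal (RtoC (INR (S N) * (2 * PI))) (minus (fejer_sum g N s) (g (cis s)))).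
Proof.
  intros hg.
  pose proof (is_RInt_iter (V := restr_R V) (square_indices N) _ _ _ _
    (fun kl _ => is_RInt_fourier g (index_diff kl) s hg)) as h1.
  pose proof (is_RInt_linear (V := restr_R V) _ _ _ _ _ (is_linear_restr_vec (g (cis s)))
    (is_RInt_fejer_kernel N s)) as h2.
  pose proof (is_RInt_minus (V := restr_R V) _ _ _ _ _ _ h1 h2) as h.
  eapply (is_RInt_eq (V := restr_R V)); cycle 1.
  - eapply is_RInt_ext; [|exact h]. intros t _. cbv beta.
    assert (e : iter plus (zero : V) (square_indices N)
      (fun kl => scal (cis (IZR (index_diff kl) * (s - t))) (g (cis t))) =
      scal (RtoC (Cmod (dirichlet N (s - t)) ^ 2)) (g (cis t))).
    { rewrite <- dirichlet_square. symmetry.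
      apply (iter_morph Cplus (RtoC 0) plus zero (fun z : C => scal z (g (cis t)))).
      - apply (scal_zero_l (V := V)).
      - intros x y. apply (scal_distr_r (V := V) x y). }
    transitivity (minus (scal (RtoC (Cmod (dirichlet N (s - t)) ^ 2)) (g (cis t)))
      (scal (RtoC (Cmod (dirichlet N (s - t)) ^ 2)) (g (cis s)))).
    + exact (f_equal (fun v : V => minus v _) e).
    + lin_C V.
  - unfold fejer_sum.
    set (I0 := iter plus (zero : V) (square_indices N)
      (fun kl => scal (cis (IZR (index_diff kl) * s)) (fourier_coef g (index_diff kl)))).
    assert (e : iter plus zero (square_indices N) (fun kl => scal (RtoC (2 * PI))
      (scal (cis (IZR (index_diff kl) * s)) (fourier_coef g (index_diff kl)))) = scal (RtoC (2 * PI)) I0).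
    { symmetry. apply (iter_morph plus zero plus zero (fun v : V => scal (RtoC (2 * PI)) v)).
      - apply (scal_zero_r (V := V)).
      - intros x y. apply (scal_distr_l (V := V)). }
    transitivity (minus (scal (RtoC (2 * PI)) I0) (scal (RtoC (INR (S N) * (2 * PI))) (g (cis s)))).
    + exact (f_equal (fun v : V => minus v _) e).
    + assert (hN : (RtoC (INR (S N) * (2 * PI)) * RtoC (/ INR (S N)) = RtoC (2 * PI))%C).
      { rewrite <- RtoC_mult. f_equal. field. apply not_0_INR; lia. }
      rewrite <- hN.
      change (minus (scal (RtoC (INR (S N) * (2 * PI)) * RtoC (/ INR (S N)))%C I0)
          (scal (RtoC (INR (S N) * (2 * PI))) (g (cis s))) =
        scal (RtoC (INR (S N) * (2 * PI))) (minus (scal (RtoC (/ INR (S N))) I0) (g (cis s)))).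
      clearbody I0. lin_C V.
Qed.

(** Near s uniform continuity makes the integrand at most eps/2 times the kernel; far from s the
    kernel is bounded independently of N, and division by N + 1 makes that part small. *)
Lemma fejer (g : C -> V) eps : cont_circle g -> 0 < eps ->
  exists N0, forall N, (N0 <= N)%nat -> forall s,
    norm (minus (fejer_sum g N s) (g (cis s))) <= eps.
Proof.
  intros hg he. pose proof PI_RGT_0 as hpi.
  destruct (cont_circle_uniform g (eps / 2) hg ltac:(lra)) as [d [hd hu]].
  destruct (cont_circle_bounded g hg) as [M [hM hb]].
  (* Bound for the integrand at chord distance at least d: twice the supremum of g times the bound
     of [dirichlet_bound]. *)
  set (K := 2 * M * (4 / (d * d))).
  assert (hdd : 0 < d * d) by now apply Rmult_lt_0_compat.
  assert (h4 : 0 < 4 / (d * d)) by (apply Rdiv_lt_0_compat; lra).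
  assert (hK : 0 <= K) by (apply Rmult_le_pos; lra).
  destruct (INR_unbounded (2 * K / eps)) as [N0 hN0].
  exists N0. intros N hN s.
  assert (hNpos : 0 < INR (S N)) by (apply lt_0_INR; lia).
  assert (hbig : K <= eps / 2 * INR (S N)).
  { assert (INR N0 <= INR (S N)) by (apply le_INR; lia).
    apply (Rmult_le_reg_l (2 / eps)); [apply Rdiv_lt_0_compat; lra|].
    replace (2 / eps * K) with (2 * K / eps) by (field; lra).
    replace (2 / eps * (eps / 2 * INR (S N))) with (INR (S N)) by (field; lra). lra. }
  assert (hpt : forall t, Cmod (dirichlet N (s - t)) ^ 2 * norm (minus (g (cis t)) (g (cis s))) <=
    eps / 2 * Cmod (dirichlet N (s - t)) ^ 2 + K).
  { intros t. set (q := Cmod (dirichlet N (s - t)) ^ 2).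
    assert (hq : 0 <= q) by apply pow2_ge_0.
    destruct (Rlt_dec (Cmod (cis t - cis s)%C) d) as [h|h].
    - specialize (hu s t h).
      assert (q * norm (minus (g (cis t)) (g (cis s))) <= q * (eps / 2)) by (now apply Rmult_le_compat_l).
      lra.
    - assert (hq' : q <= 4 / (d * d)).
      { apply dirichlet_bound; trivial. apply Rnot_lt_le in h. eapply Rle_trans; [exact h|].
        right. replace (cis t - cis s)%C with (cis t * (1 - cis (s - t)))%C.
        - rewrite Cmod_mult, Cmod_cis. ring.
        - unfold Rminus. rewrite cis_plus, cis_opp. field. apply cis_neq_0. }
      assert (hn : norm (minus (g (cis t)) (g (cis s))) <= 2 * M).
      { eapply Rle_trans; [apply (norm_minus_le (V := V))|].
        pose proof (hb t). pose proof (hb s). lra. }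
      assert (q * norm (minus (g (cis t)) (g (cis s))) <= 4 / (d * d) * (2 * M)).
      { apply Rmult_le_compat; trivial. apply norm_ge_0. }
      assert (0 <= eps / 2 * q) by (apply Rmult_le_pos; lra).
      unfold K. lra. }
  assert (hle' : norm (scal (RtoC (INR (S N) * (2 * PI))) (minus (fejer_sum g N s) (g (cis s)))) <=
    plus (scal (eps / 2) (INR (S N) * (2 * PI))) (scal (2 * PI - 0) K)).
  { refine (norm_RInt_le (V := restr_R V) _
      (fun t => plus (scal (eps / 2) (Cmod (dirichlet N (s - t)) ^ 2)) K) 0 (2 * PI) _ _ _ _
      (is_RInt_fejer g N s hg) _); [lra| |].
    - intros t _. eapply Rle_trans; [right; exact (norm_scal_RtoC (V := V) _ _ (pow2_ge_0 _))|]. apply hpt.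
    - apply (is_RInt_plus (V := R_NormedModule)).
      + apply (is_RInt_scal (V := R_NormedModule)). apply is_RInt_fejer_kernel.
      + apply (is_RInt_const (V := R_NormedModule)). }
  rewrite (norm_scal_RtoC (V := V)) in hle' by (apply Rmult_le_pos; lra).
  change (INR (S N) * (2 * PI) * norm (minus (fejer_sum g N s) (g (cis s))) <=
    eps / 2 * (INR (S N) * (2 * PI)) + (2 * PI - 0) * K) in hle'.
  assert (hp : 0 < INR (S N) * (2 * PI)) by (apply Rmult_lt_0_compat; lra).
  apply Rmult_le_reg_l with (INR (S N) * (2 * PI)); trivial.
  eapply Rle_trans; [exact hle'|].
  assert ((2 * PI) * K <= (2 * PI) * (eps / 2 * INR (S N))) by (apply Rmult_le_compat_l; lra).
  replace (INR (S N) * (2 * PI) * eps) with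
    (eps / 2 * (INR (S N) * (2 * PI)) + 2 * PI * (eps / 2 * INR (S N))) by field.
  lra.
Qed.

(** Equal coefficients give equal Fejer means, which converge to both functions. *)
Lemma fourier_unique (g h : C -> V) : cont_circle g -> cont_circle h ->
  (forall n, fourier_coef g n = fourier_coef h n) -> forall t, g (cis t) = h (cis t).
Proof.
  intros hg hh e t.
  assert (hs : forall N, fejer_sum g N t = fejer_sum h N t).
  { intros N. unfold fejer_sum. do 2 f_equal.
    extensionality kl. now rewrite e. }
  assert (hn : norm (minus (g (cis t)) (h (cis t))) = 0).
  { apply Rle_antisym; [|apply norm_ge_0]. apply le_epsilon. intros eps he. rewrite Rplus_0_l.
    destruct (fejer g (eps / 2) hg ltac:(lra)) as [N1 h1].
    destruct (fejer h (eps / 2) hh ltac:(lra)) as [N2 h2].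
    specialize (h1 (N1 + N2)%nat ltac:(lia) t). specialize (h2 (N1 + N2)%nat ltac:(lia) t).
    rewrite hs in h1. set (S0 := fejer_sum h (N1 + N2) t) in *.
    apply (norm_eq_le (V := V) _ (minus (minus S0 (h (cis t))) (minus S0 (g (cis t))))); [lin_C V|].
    eapply Rle_trans; [apply (norm_minus_le (V := V))|]. lra. }
  apply (norm_eq_zero (V := V)) in hn. apply (eq_plus_of_minus (V := V)) in hn.
  etransitivity; [exact hn|]. apply (plus_zero_r (G := V)).
Qed.

End Fejer.

(** * Power series *)

Definition analytic {V : NormedModule C_AbsRing} (f : C -> V) (z : C) : Prop :=
  exists a : nat -> V, locally (T := C_UniformSpace) z (fun w => is_pseries a (Cminus w z) (f w)).

Lemma is_pseries_series {V : NormedModule C_AbsRing} (a : nat -> V) (h : C) (l : V) :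
  is_pseries a h l <-> is_series (fun k => scal (Cpow h k) (a k)) l.
Proof.
  split; intros H; exact H.
Qed.

Lemma analytic_eps {V : NormedModule C_AbsRing} (f : C -> V) (z : C) :
  analytic f z <-> exists (a : nat -> V) delta, 0 < delta /\ forall h, Cmod h < delta ->
    is_series (fun k => scal (Cpow h k) (a k)) (f (z + h)%C).
Proof.
  split.
  - intros [a ha]. apply locally_Cmod in ha. destruct ha as [d [hd h]].
    exists a, d. split; trivial. intros u hu.
    specialize (h (z + u)%C). replace (z + u - z)%C with u in h by ring.
    now apply is_pseries_series, h.
  - intros [a [d [hd h]]]. exists a. apply locally_Cmod. exists d. split; trivial.
    intros w hw. apply is_pseries_series. specialize (h _ hw).
    now replace (z + (w - z))%C with w in h by ring.
Qed.

Lemma series_coef_bound {V : NormedModule C_AbsRing} (a : nat -> V) (r : R) (l : V) : 0 <= r ->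
  is_series (fun k => scal (Cpow (RtoC r) k) (a k)) l ->
  exists M, 0 <= M /\ forall k, r ^ k * norm (a k) <= M.
Proof.
  intros hr h. destruct (is_series_terms_to_zero _ _ h 1 Rlt_0_1) as [N hN].
  assert (hk : forall k, norm (scal (Cpow (RtoC r) k) (a k)) = r ^ k * norm (a k)).
  { intros k. rewrite norm_scal_C, Cmod_pow, Cmod_R, Rabs_right by lra. reflexivity. }
  assert (hb : forall n, exists M, 0 <= M /\ forall k, (k < n)%nat -> r ^ k * norm (a k) <= M).
  { induction n as [|n [M [hM IH]]].
    - exists 0. split; [lra|]. intros; lia.
    - exists (M + r ^ n * norm (a n)).
      assert (0 <= r ^ n * norm (a n)) by (apply Rmult_le_pos; [now apply pow_le|apply norm_ge_0]).
      split; [lra|]. intros k hk'. destruct (Nat.eq_dec k n) as [->|]; [lra|].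
      specialize (IH k ltac:(lia)). lra. }
  destruct (hb N) as [M [hM hM']]. exists (M + 1). split; [lra|]. intros k.
  destruct (lt_dec k N) as [hlt|hge].
  - specialize (hM' k hlt). lra.
  - specialize (hN k ltac:(lia)). rewrite hk in hN. lra.
Qed.

(** Second order is needed because the quotient (f(w) - f(z))/(w - z) must itself be differentiable
    at z, and forming it loses one order. *)
Lemma analytic_taylor {V : NormedModule C_AbsRing} (f : C -> V) (z : C) : analytic f z ->
  exists (a0 a1 a2 : V) K delta, 0 < delta /\ 0 <= K /\ forall h, Cmod h < delta ->
    norm (minus (f (z + h)%C) (plus a0 (plus (scal h a1) (scal (h * h)%C a2)))) <= K * Cmod h ^ 3.
Proof.
  intros hf. apply analytic_eps in hf. destruct hf as [a [d [hd ha]]].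
  (* Convergence at the point r bounds r^k |a_k| by M; for |h| < r/2 the remainder is dominated by a
     geometric series of ratio 1/2, whence the constant 2M/r^3. *)
  set (r := d / 2). assert (hr : 0 < r) by (unfold r; lra).
  destruct (series_coef_bound a r (f (z + RtoC r)%C)) as [M [hM hM']]; [lra|apply ha|].
  { rewrite Cmod_R, Rabs_right; unfold r; lra. }
  exists (a O), (a 1%nat), (a 2%nat), (2 * M / r ^ 3), (r / 2).
  assert (hr3 : 0 < r ^ 3) by now apply pow_lt.
  split; [lra|split].
  { apply Rmult_le_pos; [lra|]. left; now apply Rinv_0_lt_compat. }
  intros h hh. set (q := Cmod h / r).
  assert (hq : 0 <= q <= / 2).
  { unfold q. split; [apply Rmult_le_pos; [apply Cmod_ge_0|left; now apply Rinv_0_lt_compat]|].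
    apply Rmult_le_reg_r with r; trivial. unfold Rdiv. rewrite Rmult_assoc, Rinv_l, Rmult_1_r; lra. }
  pose proof (is_series_tail _ _ 2 (ha h ltac:(unfold r in hh; lra))) as ht.
  assert (hle : norm (minus (f (z + h)%C) (sum_n (fun k => scal (Cpow h k) (a k)) 2)) <=
    M * q ^ 3 / (1 - / 2)).
  { apply (is_series_norm_le (fun k => scal (Cpow h (3 + k)) (a (3 + k)%nat))); [|lra| |exact ht].
    - apply Rmult_le_pos; [trivial|apply pow_le; lra].
    - intros k. rewrite norm_scal_C, Cmod_pow.
      replace (Cmod h) with (q * r) by (unfold q; field; lra).
      rewrite Rpow_mult_distr, Rmult_assoc.
      apply Rle_trans with (q ^ (3 + k) * M).
      + apply Rmult_le_compat_l; [apply pow_le; lra|]. apply hM'.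
      + rewrite pow_add, (Rmult_comm M), !Rmult_assoc.
        apply Rmult_le_compat_l; [apply pow_le; lra|]. rewrite Rmult_comm.
        apply Rmult_le_compat_l; trivial. apply pow_incr; lra. }
  refine (norm_eq_le _ _ _ _ (Rle_trans _ _ _ hle _)).
  - rewrite !sum_Sn, sum_O. simpl Cpow. lin_C V.
  - right. unfold q. field. lra.
Qed.

(** The removable singularity: [a1] is the derivative of f. The Caratheodory function of the
    quotient is the second difference quotient, completed by the next Taylor coefficient. *)
Lemma analytic_quotient {V : NormedModule C_AbsRing} (f : C -> V) (z : C) : analytic f z ->
  exists a1 : V,
    cdiff (fun w => if Ceq_dec w z then a1 else scal (/ (w - z))%C (minus (f w) (f z))) z.
Proof.
  intros hf. destruct (analytic_taylor f z hf) as [a0 [a1 [a2 [K [d [hd [hK h]]]]]]].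
  assert (hz : f z = a0).
  { pose proof (h (RtoC 0)) as h0. rewrite Cmod_0 in h0. specialize (h0 hd).
    replace (K * 0 ^ 3) with 0 in h0 by ring. rewrite Cplus_0_r in h0.
    apply Rle_antisym in h0; [|apply norm_ge_0].
    symmetry in h0. apply norm_eq_zero in h0. apply eq_plus_of_minus in h0. rewrite h0. lin_C V. }
  exists a1. set (g := fun w => if Ceq_dec w z then a1 else scal (/ (w - z))%C (minus (f w) (f z))).
  exists (fun w => if Ceq_dec w z then a2 else scal (/ (w - z))%C (minus (g w) a1)).
  assert (hgz : g z = a1) by (unfold g; now destruct (Ceq_dec z z)).
  split.
  - intros eps he. exists (Rmin d (eps / (K + 1))).
    assert (hek : 0 < eps / (K + 1)) by (apply Rdiv_lt_0_compat; lra).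
    split; [now apply Rmin_pos|]. intros w _ hw.
    Rmin_bounds d (eps / (K + 1)).
    destruct (Ceq_dec z z) as [_|]; [|easy].
    destruct (Ceq_dec w z) as [->|hwz].
    { refine (norm_eq_lt _ zero _ _ _); [lin_C V|]. now rewrite (norm_zero (V := V)). }
    unfold g. destruct (Ceq_dec w z) as [|_]; [easy|].
    set (u := (w - z)%C) in *.
    assert (hu : u <> 0).
    { intros hu. apply hwz. replace w with (z + u)%C by (unfold u; ring). rewrite hu. ring. }
    specialize (h u ltac:(lra)). replace (z + u)%C with w in h by (unfold u; ring).
    set (E := minus (f w) _) in h.
    assert (hfw : f w = plus (plus a0 (plus (scal u a1) (scal (u * u)%C a2))) E) by (unfold E; lin_C V).
    apply (norm_eq_lt _ (scal (/ (u * u))%C E)).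
    { rewrite hfw, hz. lin_C V; field; trivial. }
    assert (hup : 0 < Cmod u) by now apply Cmod_gt_0.
    rewrite norm_scal_C, Cmod_inv, Cmod_mult by now apply Cmult_neq_0.
    assert (huu : 0 < Cmod u * Cmod u) by now apply Rmult_lt_0_compat.
    apply Rle_lt_trans with (K * Cmod u).
    + apply Rmult_le_reg_l with (Cmod u * Cmod u); trivial.
      rewrite <- Rmult_assoc, Rinv_r, Rmult_1_l by lra.
      eapply Rle_trans; [exact h|]. right. ring.
    + apply Rle_lt_trans with ((K + 1) * Cmod u); [lra|].
      apply Rlt_le_trans with ((K + 1) * (eps / (K + 1))).
      * apply Rmult_lt_compat_l; lra.
      * right. field. lra.
  - exists 1. split; [lra|]. intros w _. rewrite hgz.
    destruct (Ceq_dec w z) as [->|hwz].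
    + rewrite hgz. lin_C V.
    + assert (hu : (w - z)%C <> 0).
      { intros hu. apply hwz. replace w with (z + (w - z))%C by ring. rewrite hu. ring. }
      lin_C V; field; trivial.
Qed.

(** The completed quotient is continuous at z, so it serves as the Caratheodory function. *)
Lemma analytic_cdiff {V : NormedModule C_AbsRing} (f : C -> V) (z : C) : analytic f z -> cdiff f z.
Proof.
  intros hf. destruct (analytic_quotient f z hf) as [a1 hg].
  eexists. split; [apply (cdiff_cont_at _ _ hg)|]. exists 1. split; [lra|]. intros w _. cbv beta.
  destruct (Ceq_dec w z) as [->|hwz]; [lin_C V|].
  assert (hu : (w - z)%C <> 0).
  { intros hu. apply hwz. replace w with (z + (w - z))%C by ring. rewrite hu. ring. }
  lin_C V; field; trivial.
Qed.

Lemma analytic_ext {V : NormedModule C_AbsRing} (f g : C -> V) (z : C) :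
  (forall w, f w = g w) -> analytic f z -> analytic g z.
Proof.
  intros h [a ha]. exists a. eapply filter_imp; [|exact ha]. intros w hw. now rewrite <- h.
Qed.

Lemma analytic_const {V : NormedModule C_AbsRing} (v : V) (z : C) : analytic (fun _ => v) z.
Proof.
  apply analytic_eps. exists (fun k => match k with O => v | S _ => zero end), 1. split; [lra|].
  intros h _. set (a := fun k => scal (Cpow h k) (match k with O => v | S _ => zero end)).
  assert (e : sum_n a 0 = v) by (rewrite sum_O; unfold a; exact (scal_one v)).
  assert (hs : is_series a (sum_n a 0)).
  { apply is_series_eventually_zero. intros [|k] hk; [lia|]. exact (scal_zero_r (V := V) _). }
  rewrite e in hs. exact hs.
Qed.

Lemma analytic_plus {V : NormedModule C_AbsRing} (f g : C -> V) (z : C) :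
  analytic f z -> analytic g z -> analytic (fun w => plus (f w) (g w)) z.
Proof.
  intros hf hg. apply analytic_eps in hf. apply analytic_eps in hg. apply analytic_eps.
  destruct hf as [a [d [hd ha]]], hg as [b [d' [hd' hb]]].
  exists (fun k => plus (a k) (b k)), (Rmin d d'). split; [now apply Rmin_pos|]. intros h hh.
  Rmin_bounds d d'.
  eapply is_series_ext; [|exact (is_series_plus _ _ _ _ (ha h ltac:(lra)) (hb h ltac:(lra)))].
  intros k. symmetry. apply (scal_distr_l (V := V)).
Qed.

(** Multiplying or dividing a power series by z + h changes its partial sums by a factor and one end
    term that tends to 0. *)
Lemma filterlim_lin_comb {V : NormedModule C_AbsRing} (u v : nat -> V) (a b : C) (l : V) :
  filterlim u eventually (locally l) ->
  (forall eps, 0 < eps -> exists N, forall n, (N <= n)%nat -> norm (v n) <= eps) ->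
  filterlim (fun n => plus (scal a (u n)) (scal b (v n))) eventually (locally (scal a l)).
Proof.
  intros hu hv.
  assert (hv' : filterlim v eventually (locally (zero : V))).
  { apply (proj2 (filterlim_locally_ball_norm (U := V) v (zero : V))). intros eps.
    destruct (hv (eps / 2)) as [N hN]; [destruct eps; simpl; lra|].
    exists N. intros n hn. specialize (hN n hn). unfold ball_norm.
    apply (norm_eq_lt _ (v n)); [lin_C V|]. pose proof (cond_pos eps). lra. }
  assert (e : scal a l = plus (scal a l) (scal b (zero : V))) by lin_C V. rewrite e.
  eapply filterlim_comp_2; [| |apply (filterlim_plus (V := V))].
  - eapply filterlim_comp; [exact hu|apply (filterlim_scal_r (V := V))].
  - eapply filterlim_comp; [exact hv'|apply (filterlim_scal_r (V := V))].
Qed.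

Lemma analytic_mul {V : NormedModule C_AbsRing} (f : C -> V) (z : C) :
  analytic f z -> analytic (fun w => scal w (f w)) z.
Proof.
  intros hf. apply analytic_eps in hf. apply analytic_eps. destruct hf as [a [d [hd ha]]].
  set (b := fun k => match k with O => scal z (a O) | S k' => plus (scal z (a k)) (a k') end).
  exists b, d. split; trivial. intros h hh. specialize (ha h hh). unfold is_series.
  (* Partial sums of the product are (z + h) times those of f, minus the overshooting term h h^n
     a_n. *)
  apply filterlim_ext with (fun n => plus (scal (z + h)%C (sum_n (fun k => scal (Cpow h k) (a k)) n))
    (scal (- h)%C (scal (Cpow h n) (a n)))).
  - intros n. induction n as [|n IH].
    + rewrite !sum_O. simpl Cpow. unfold b. lin_C V.
    + rewrite !sum_Sn, <- IH. unfold b. simpl Cpow. lin_C V.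
  - apply filterlim_lin_comb; [exact ha|]. apply (is_series_terms_to_zero _ _ ha).
Qed.

(* The coefficients of the quotient solve (z + h) g(h) = a(h); their growth is
   geometric because those of a are and the recursion divides by z. *)
Lemma analytic_div {V : NormedModule C_AbsRing} (f : C -> V) (z : C) : z <> 0 ->
  analytic f z -> analytic (fun w => scal (/ w)%C (f w)) z.
Proof.
  intros hz hf. apply analytic_eps in hf. apply analytic_eps. destruct hf as [a [d [hd ha]]].
  set (g := fix g k := match k with
    | O => scal (/ z)%C (a O)
    | S k' => scal (/ z)%C (minus (a k) (g k')) end).
  assert (hzp : 0 < Cmod z) by now apply Cmod_gt_0.
  (* With r <= |z|/2 the recursion preserves the bound K = 2M/|z|, since M + rK <= M + |z|K/2 = 2M =
     |z|K. *)
  set (r := Rmin (d / 2) (Cmod z / 2)).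
  assert (hr : 0 < r) by (apply Rmin_pos; lra).
  pose proof (Rmin_l (d / 2) (Cmod z / 2)) as hr1. fold r in hr1.
  pose proof (Rmin_r (d / 2) (Cmod z / 2)) as hr2. fold r in hr2.
  destruct (series_coef_bound a r (f (z + RtoC r)%C)) as [M [hM hM']]; [lra|apply ha|].
  { rewrite Cmod_R, Rabs_right; lra. }
  set (K := 2 * M / Cmod z).
  assert (hK : 0 <= K) by (apply Rmult_le_pos; [lra|left; now apply Rinv_0_lt_compat]).
  assert (hKz : Cmod z * K = 2 * M) by (unfold K; field; lra).
  assert (hg : forall k, r ^ k * norm (g k) <= K).
  { induction k as [|k IH]; apply Rmult_le_reg_l with (Cmod z); trivial; rewrite hKz.
    - specialize (hM' O). simpl in *.
      rewrite norm_scal_C, Cmod_inv by trivial. field_simplify; lra.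
    - change (g (S k)) with (scal (/ z)%C (minus (a (S k)) (g k))).
      rewrite norm_scal_C, Cmod_inv by trivial.
      replace (Cmod z * (r ^ S k * (/ Cmod z * norm (minus (a (S k)) (g k)))))
        with (r ^ S k * norm (minus (a (S k)) (g k))) by (field; lra).
      assert (hrk : 0 <= r ^ S k) by (apply pow_le; lra).
      apply Rle_trans with (r ^ S k * (norm (a (S k)) + norm (g k))).
      { apply Rmult_le_compat_l; trivial. apply norm_minus_le. }
      specialize (hM' (S k)). rewrite Rmult_plus_distr_l.
      assert (r * (r ^ k * norm (g k)) <= Cmod z / 2 * K).
      { apply Rmult_le_compat; trivial; [lra|]. apply Rmult_le_pos; [apply pow_le; lra|apply norm_ge_0]. }
      simpl in *. lra. }
  exists g, r. split; trivial. intros h hh.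
  specialize (ha h ltac:(lra)). unfold is_series.
  set (w := (z + h)%C) in *.
  assert (hw : w <> 0).
  { intros hw. assert (e : z = (- h)%C) by (replace z with (w - h)%C by (unfold w; ring); rewrite hw; ring).
    rewrite e, Cmod_opp in hr2. lra. }
  apply filterlim_ext with (fun n => plus (scal (/ w)%C (sum_n (fun k => scal (Cpow h k) (a k)) n))
    (scal (h / w)%C (scal (Cpow h n) (g n)))).
  - intros n.
    (* Multiplying back by w telescopes the recursion up to one end term. *)
    assert (e : scal w (sum_n (fun k => scal (Cpow h k) (g k)) n) =
      plus (sum_n (fun k => scal (Cpow h k) (a k)) n) (scal h (scal (Cpow h n) (g n)))).
    { induction n as [|n IH].
      - rewrite !sum_O. simpl Cpow. simpl g. unfold w. lin_C V; field; trivial.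
      - rewrite !sum_Sn.
        transitivity (plus (scal w (sum_n (fun k => scal (Cpow h k) (g k)) n))
          (scal w (scal (Cpow h (S n)) (g (S n))))); [lin_C V|].
        rewrite IH. simpl Cpow.
        change (g (S n)) with (scal (/ z)%C (minus (a (S n)) (g n))). unfold w.
        set (gn := g n). lin_C V; field; trivial. }
    transitivity (scal (/ w)%C (plus (sum_n (fun k => scal (Cpow h k) (a k)) n)
      (scal h (scal (Cpow h n) (g n))))); [lin_C V; field; trivial|].
    assert (e2 : forall X : V, scal (/ w)%C (scal w X) = X) by (intros X; lin_C V; field; trivial).
    etransitivity; [exact (f_equal (scal (/ w)%C) (eq_sym e))|exact (e2 _)].
  - apply filterlim_lin_comb; [exact ha|]. intros eps he.
    set (q := Cmod h / r).
    assert (hq : 0 <= q < 1).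
    { unfold q. split; [apply Rmult_le_pos; [apply Cmod_ge_0|left; now apply Rinv_0_lt_compat]|].
      apply Rmult_lt_reg_r with r; trivial. unfold Rdiv. rewrite Rmult_assoc, Rinv_l; lra. }
    destruct (pow_lt_1_zero q ltac:(rewrite Rabs_right; lra) (eps / (K + 1))) as [N hN].
    { apply Rdiv_lt_0_compat; lra. }
    exists N. intros n hn. specialize (hN n hn).
    rewrite Rabs_right in hN by (apply Rle_ge, pow_le; lra).
    rewrite norm_scal_C, Cmod_pow. replace (Cmod h) with (q * r) by (unfold q; field; lra).
    rewrite Rpow_mult_distr, Rmult_assoc.
    apply Rle_trans with (q ^ n * K).
    + apply Rmult_le_compat_l; [apply pow_le; lra|apply hg].
    + apply Rle_trans with (eps / (K + 1) * (K + 1)); [|right; field; lra].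
      apply Rmult_le_compat; try lra. apply pow_le; lra.
Qed.

Lemma analytic_zpow_scal {V : NormedModule C_AbsRing} (n : Z) (v : V) (z : C) : z <> 0 ->
  analytic (fun w => scal (zpow w n) v) z.
Proof.
  intros hz.
  assert (hp : forall k, analytic (fun w => scal (Cpow w k) v) z).
  { induction k as [|k IH].
    - eapply analytic_ext; [|apply (analytic_const v)]. intros w. symmetry. exact (scal_one v).
    - eapply analytic_ext; [|apply analytic_mul, IH]. intros w. cbv beta; simpl Cpow. lin_C V. }
  assert (hm : forall k, analytic (fun w => scal (Cpow (/ w) k) v) z).
  { induction k as [|k IH].
    - eapply analytic_ext; [|apply (analytic_const v)]. intros w. symmetry. exact (scal_one v).
    - eapply analytic_ext; [|exact (analytic_div _ _ hz IH)]. intros w. cbv beta; simpl Cpow. lin_C V. }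
  destruct n; simpl; [apply (hp O)|apply hp|apply hm].
Qed.

(** * Laurent polynomials *)

Lemma cont_at_comp_mul {V : NormedModule C_AbsRing} (D E : C -> Prop) (f : C -> V) (a z : C) :
  (forall w, E w -> D (a * w)%C) -> cont_at D f (a * z)%C -> cont_at E (fun w => f (a * w)%C) z.
Proof.
  intros h hf eps he. destruct (hf eps he) as [d [hd h']].
  pose proof (Cmod_ge_0 a) as ha.
  assert (hd' : 0 < d / (Cmod a + 1)) by (apply Rdiv_lt_0_compat; lra).
  exists (d / (Cmod a + 1)). split; trivial. intros w hw hwz. apply h'; [auto|].
  replace (a * w - a * z)%C with (a * (w - z))%C by ring. rewrite Cmod_mult.
  apply Rle_lt_trans with ((Cmod a + 1) * Cmod (w - z)).
  - apply Rmult_le_compat_r; [apply Cmod_ge_0|lra].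
  - apply Rlt_le_trans with ((Cmod a + 1) * (d / (Cmod a + 1))).
    + apply Rmult_lt_compat_l; lra.
    + right. field. lra.
Qed.

(* Laurent polynomials as lists of monomials; the same list is evaluated in B_0,
   B_1 and B_0 + B_1 by varying [v]. *)
Definition leval {V : NormedModule C_AbsRing} {T : Type} (v : T -> V) (L : list (Z * T)) (z : C) : V :=
  iter plus zero L (fun mv => scal (zpow z (fst mv)) (v (snd mv))).

(** A sum, because the same exponent may occur several times in the list. *)
Definition lcoef {V : NormedModule C_AbsRing} {T : Type} (v : T -> V) (L : list (Z * T)) (n : Z) : V :=
  iter plus zero L (fun mv => if Z.eq_dec (fst mv) n then v (snd mv) else zero).

Lemma leval_analytic {V : NormedModule C_AbsRing} {T : Type} (v : T -> V) (L : list (Z * T)) (z : C) :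
  z <> 0 -> analytic (leval v L) z.
Proof.
  intros hz. induction L as [|mv L IH].
  - apply (analytic_const (zero : V)).
  - exact (analytic_plus _ _ z (analytic_zpow_scal (fst mv) (v (snd mv)) z hz) IH).
Qed.

Lemma leval_cont_at {V : NormedModule C_AbsRing} {T : Type} (v : T -> V) (L : list (Z * T))
  (D : C -> Prop) (z : C) : z <> 0 -> cont_at D (leval v L) z.
Proof.
  intros hz. apply (cont_at_sub (fun _ => True)); trivial.
  now apply cdiff_cont_at, analytic_cdiff, leval_analytic.
Qed.

Lemma leval_linear {U V : NormedModule C_AbsRing} {T : Type} (A : U -> V) (v : T -> U)
  (L : list (Z * T)) (z : C) : is_linear A -> A (leval v L z) = leval (fun x => A (v x)) L z.
Proof.
  intros hA. unfold leval. rewrite (iter_morph plus zero plus zero A).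
  - f_equal. extensionality mv.
    apply (linear_scal A hA).
  - apply (linear_zero A hA).
  - apply (linear_plus A hA).
Qed.

Lemma is_series_eq {V : NormedModule C_AbsRing} (a : nat -> V) (l l' : V) :
  l = l' -> is_series a l -> is_series a l'.
Proof. now intros ->. Qed.

Lemma is_series_delta {V : NormedModule C_AbsRing} (k0 : nat) (v : V) :
  is_series (fun k => if Nat.eq_dec k k0 then v else zero) v.
Proof.
  induction k0 as [|k0 IH].
  - set (a := fun k => if Nat.eq_dec k 0 then v else zero).
    apply (is_series_eq _ (sum_n a 0)); [now rewrite sum_O|].
    apply is_series_eventually_zero. intros [|k] hk; [lia|]. reflexivity.
  - apply is_series_decr_1. destruct (Nat.eq_dec 0 (S k0)); [lia|].
    apply (is_series_eq _ v); [lin_C V|].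
    eapply is_series_ext; [|exact IH]. intros k. cbv beta.
    destruct (Nat.eq_dec k k0), (Nat.eq_dec (S k) (S k0)); trivial; lia.
Qed.

Lemma is_series_zero {V : NormedModule C_AbsRing} (a : nat -> V) :
  (forall k, a k = zero) -> is_series a zero.
Proof.
  intros h. apply (is_series_eq _ (sum_n a 0)); [now rewrite sum_O|].
  apply is_series_eventually_zero. intros; apply h.
Qed.

Lemma is_sumZ_delta {V : NormedModule C_AbsRing} (m : Z) (v : V) :
  is_sumZ (fun n => if Z.eq_dec m n then v else zero) v.
Proof.
  destruct (Z_le_dec 0 m) as [h|h].
  - exists v, zero. repeat split.
    + eapply is_series_ext; [|apply (is_series_delta (Z.to_nat m))]. intros k. cbv beta.
      destruct (Nat.eq_dec k (Z.to_nat m)), (Z.eq_dec m (Z.of_nat k)); trivial; lia.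
    + apply is_series_zero. intros k. destruct (Z.eq_dec m _); [lia|trivial].
    + symmetry; apply plus_zero_r.
  - exists zero, v. repeat split.
    + apply is_series_zero. intros k. destruct (Z.eq_dec m _); [lia|trivial].
    (* The negative half starts at index -1, so the exponent m is its entry -m - 1. *)
    + eapply is_series_ext; [|apply (is_series_delta (Z.to_nat (- m - 1)))]. intros k. cbv beta.
      destruct (Nat.eq_dec k (Z.to_nat (- m - 1))), (Z.eq_dec m (- Z.of_nat (S k))); trivial; lia.
    + symmetry; apply plus_zero_l.
Qed.

(** Each monomial contributes a series with a single nonzero term; adding these series regroups the
    list by exponents. *)
Lemma is_sumZ_lcoef {V : NormedModule C_AbsRing} {T : Type} (v : T -> V) (L : list (Z * T)) (s : R) :
  is_sumZ (fun n => scal (RtoC (exp (s * IZR n))) (lcoef v L n)) (leval v L (RtoC (exp s))).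
Proof.
  induction L as [|mv L IH].
  - exists zero, zero. repeat split.
    + apply is_series_zero. intros k. apply (scal_zero_r (V := V)).
    + apply is_series_zero. intros k. apply (scal_zero_r (V := V)).
    + symmetry; apply plus_zero_l.
  - eapply is_sumZ_ext; [|exact (is_sumZ_plus _ _ _ _ (is_sumZ_delta (fst mv)
      (scal (zpow (RtoC (exp s)) (fst mv)) (v (snd mv)))) IH)].
    intros n. cbv beta. unfold lcoef at 2. cbn [iter]. fold (lcoef v L n).
    destruct (Z.eq_dec (fst mv) n) as [->|].
    + rewrite <- polar_0_r, zpow_polar, Rmult_0_r, polar_0_r, (Rmult_comm (IZR n)).
      symmetry. apply (scal_distr_l (V := V)).
    + lin_C V.
Qed.

Section FourierLaurent.

Variable V : CompleteNormedModule C_AbsRing.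

Lemma is_RInt_cis (m : Z) (v : V) :
  is_RInt (V := restr_R V) (fun t => scal (cis (IZR m * t)) v) 0 (2 * PI)
    (if Z.eq_dec m 0 then scal (RtoC (2 * PI)) v else zero).
Proof.
  destruct (is_RInt_cos_sin m) as [hc hs].
  pose proof (is_RInt_plus (V := restr_R V) _ _ _ _ _ _
    (is_RInt_linear (V := restr_R V) _ _ _ _ _ (is_linear_restr_vec V v) hc)
    (is_RInt_linear (V := restr_R V) _ _ _ _ _ (is_linear_restr_vec V (scal Ci v)) hs)) as h.
  eapply (is_RInt_eq (V := restr_R V)); cycle 1.
  - eapply is_RInt_ext; [|exact h]. intros t _. cbv beta.
    replace (cis (IZR m * t)) with (RtoC (cos (IZR m * t)) + RtoC (sin (IZR m * t)) * Ci)%C.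
    + transitivity (plus (scal (RtoC (cos (IZR m * t))) v) (scal (RtoC (sin (IZR m * t))) (scal Ci v)));
        [reflexivity|lin_C V].
    + unfold cis, Cplus, Cmult, Ci, RtoC; simpl. f_equal; ring.
  - transitivity (plus (scal (RtoC (if Z.eq_dec m 0 then 2 * PI else 0)) v)
      (scal (RtoC 0) (scal Ci v))); [reflexivity|].
    destruct (Z.eq_dec m 0); lin_C V.
Qed.

Context {T : Type} (v : T -> V) (L : list (Z * T)) (s : R).

Lemma leval_cont_circle : cont_circle V (fun w => leval v L (RtoC (exp s) * w)%C).
Proof.
  intros z hz. apply (cont_at_comp_mul (fun _ => True)); trivial.
  apply (leval_cont_at (V := V)). apply Cmod_gt_0. rewrite Cmod_mult, hz, Rmult_1_r, Cmod_R.
  apply Rabs_pos_lt, Rgt_not_eq, exp_pos.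
Qed.

(** Orthogonality of characters, monomial by monomial; on the circle of radius e^s the monomial of
    exponent n carries the factor e^(sn). *)
Lemma fourier_leval (n : Z) :
  fourier_coef (fun w => leval v L (RtoC (exp s) * w)%C) n =
  scal (RtoC (exp (s * IZR n))) (lcoef v L n).
Proof.
  unfold fourier_coef.
  pose proof (is_RInt_iter (V := restr_R V) L _ _ _ _ (fun mv _ =>
    is_RInt_cis (fst mv - n) (scal (RtoC (exp (s * IZR (fst mv)))) (v (snd mv))))) as h.
  rewrite (is_RInt_unique (V := restr_R V) _ 0 (2 * PI) (scal (RtoC (2 * PI))
    (scal (RtoC (exp (s * IZR n))) (lcoef v L n)))).
  - rewrite <- (two_PI_scal V (scal (RtoC (exp (s * IZR n))) (lcoef v L n))) at 2. lin_C V.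
  - eapply (is_RInt_eq (V := restr_R V)); cycle 1.
    + eapply is_RInt_ext; [|exact h]. intros t _. cbv beta. unfold leval.
      symmetry. etransitivity; [apply (iter_morph plus zero plus zero
        (fun x : V => scal (cis (- (IZR n * t))) x))|].
      * apply (scal_zero_r (V := V)).
      * intros x y. apply (scal_distr_l (V := V)).
      * change (iter plus (zero : V) L (fun i => scal (cis (- (IZR n * t)))
          (scal (zpow (exp s * cis t)%C (fst i)) (v (snd i)))) = iter plus (zero : V) L (fun i =>
          scal (cis (IZR (fst i - n) * t)) (scal (RtoC (exp (s * IZR (fst i)))) (v (snd i))))).
        f_equal. extensionality mv.
        change (exp s * cis t)%C with (polar s t). rewrite zpow_polar. unfold polar.
        rewrite minus_IZR.
        replace ((IZR (fst mv) - IZR n) * t) with (- (IZR n * t) + IZR (fst mv) * t) by ring.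
        rewrite cis_plus, (Rmult_comm s). lin_C V.
    + change (iter plus (zero : V) L (fun mv => if Z.eq_dec (fst mv - n) 0
        then scal (RtoC (2 * PI)) (scal (RtoC (exp (s * IZR (fst mv)))) (v (snd mv))) else zero) =
        scal (RtoC (2 * PI)) (scal (RtoC (exp (s * IZR n))) (lcoef v L n))).
      symmetry. unfold lcoef.
      etransitivity; [apply (iter_morph plus zero plus zero
        (fun x : V => scal (RtoC (2 * PI)) (scal (RtoC (exp (s * IZR n))) x)))|].
      * rewrite (scal_zero_r (V := V)). apply (scal_zero_r (V := V)).
      * intros x y. lin_C V.
      * change (iter plus (zero : V) L (fun mv => scal (RtoC (2 * PI)) (scal (RtoC (exp (s * IZR n)))
          (if Z.eq_dec (fst mv) n then v (snd mv) else zero))) =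
          iter plus (zero : V) L (fun mv => if Z.eq_dec (fst mv - n) 0
          then scal (RtoC (2 * PI)) (scal (RtoC (exp (s * IZR (fst mv)))) (v (snd mv))) else zero)).
        f_equal. extensionality mv.
        destruct (Z.eq_dec (fst mv) n) as [->|], (Z.eq_dec (fst mv - n) 0); try lia.
        -- destruct (Z.eq_dec (n - n) 0); [trivial|lia].
        -- destruct (Z.eq_dec (n - n) 0); [trivial|lia].
        -- lin_C V.
Qed.

Lemma FC_norm_leval (b : Z -> V) :
  (forall n, b n = scal (RtoC (exp (s * IZR n))) (lcoef v L n)) ->
  FC_norm b = Rbar_lub (fun q => exists t, q = Finite (norm (leval v L (polar s t)))).
Proof.
  intros hb.
  assert (hrep : FC_rep b (fun w => leval v L (RtoC (exp s) * w)%C)).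
  { split; [apply (continuous_on_cont_at (V := V)), leval_cont_circle|].
    intros n. now rewrite fourier_leval. }
  apply Rbar_le_antisym.
  - apply Rbar_glb_lb. eexists. split; [exact hrep|reflexivity].
  - apply Rbar_le_glb. intros r [f [[hf hf'] ->]].
    apply Rbar_lub_le. intros q [t ->]. apply Rbar_lub_ub. exists t. do 2 f_equal.
    apply (fourier_unique V (fun w => leval v L (RtoC (exp s) * w)%C) f).
    + apply leval_cont_circle.
    + exact (proj1 (continuous_on_cont_at (V := V) circle f) hf).
    + intros n. now rewrite fourier_leval, <- hf', hb.
Qed.

End FourierLaurent.

(** * The shift on FC *)

Lemma FC_rep_translate {V : CompleteNormedModule C_AbsRing} (b : Z -> V) (f : C -> V) (k : Z) :
  FC_rep b f -> FC_rep (fun n => b (n - k)%Z) (fun z => scal (zpow z k) (f z)).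
Proof.
  intros [hf hb].
  assert (hc : cont_circle V f) by (intros z; now apply (continuous_on_cont_at (V := V))).
  split.
  - apply (continuous_on_cont_at (V := V)). now apply cont_circle_zpow_scal.
  - intros n. rewrite hb. unfold fourier_coef. f_equal. apply (RInt_ext (V := restr_R V)).
    intros t _. rewrite (scal_assoc (V := V)). f_equal.
    change (mult (cis (- (IZR n * t))) (zpow (cis t) k)) with (cis (- (IZR n * t)) * zpow (cis t) k)%C.
    rewrite zpow_cis, <- cis_plus, minus_IZR. f_equal. ring.
Qed.

(** Translating the coefficients by k multiplies the function by z^k, which has modulus 1 on the
    circle. *)
Lemma FC_norm_translate_le {V : CompleteNormedModule C_AbsRing} (b : Z -> V) (k : Z) :
  Rbar_le (FC_norm (fun n => b (n - k)%Z)) (FC_norm b).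
Proof.
  apply Rbar_le_glb. intros r [f [hf ->]]. apply Rbar_glb_lb.
  exists (fun z => scal (zpow z k) (f z)). split; [now apply FC_rep_translate|].
  f_equal. extensionality q.
  apply propositional_extensionality.
  split; intros [t ->]; exists t; f_equal; [symmetry|];
    rewrite (norm_scal_C (V := V)), zpow_cis, Cmod_cis; ring.
Qed.

Lemma FC_shift_isometry (V : CompleteNormedModule C_AbsRing) :
  isometry_on (V := V) in_FC FC_norm shiftZ.
Proof.
  intros b [f hf]. split.
  - eexists. exact (FC_rep_translate b f 1 hf).
  - apply Rbar_le_antisym; [apply (FC_norm_translate_le b 1)|].
    pose proof (FC_norm_translate_le (shiftZ b) (-1)) as h.
    replace (fun n => shiftZ b (n - -1)%Z) with b in h; [exact h|].
    extensionality n. unfold shiftZ. f_equal. lia.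
Qed.

(** * Laurent polynomials over the intersection *)

Lemma cap_plus_eq {B : BanachPair} (x y : cap B) :
  bp_emb false (plus (x false) (y false)) = bp_emb true (plus (x true) (y true)).
Proof. rewrite !bp_emb_plus. f_equal; apply cap_eq. Qed.

Definition cap_plus {B : BanachPair} (x y : cap B) : cap B :=
  {| cap_at := fun j => plus (x j) (y j); cap_eq := cap_plus_eq x y |}.

(** Formed inside [cap], so that one coefficient serves B_0 and B_1 at once. *)
Definition cap_coef {B : BanachPair} (L : list (Z * cap B)) (n : Z) : cap B :=
  iter cap_plus (cap_zero B) L (fun mv => if Z.eq_dec (fst mv) n then snd mv else cap_zero B).

Lemma cap_coef_at {B : BanachPair} (L : list (Z * cap B)) (n : Z) (j : bool) :
  cap_coef L n j = lcoef (V := B j) (fun x : cap B => x j) L n.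
Proof.
  unfold cap_coef, lcoef.
  rewrite (iter_morph cap_plus (cap_zero B) plus zero (fun x : cap B => x j)) by reflexivity.
  f_equal. extensionality mv.
  now destruct (Z.eq_dec (fst mv) n).
Qed.

Lemma cap_coef_support {B : BanachPair} (L : list (Z * cap B)) : finitely_supported (cap_coef L).
Proof.
  induction L as [|mv L [N IH]].
  - exists 0%Z. reflexivity.
  - exists (Z.max N (Z.abs (fst mv))). intros n hn j.
    change (plus (cap_at (if Z.eq_dec (fst mv) n then snd mv else cap_zero B) j) (cap_coef L n j) = zero).
    destruct (Z.eq_dec (fst mv) n); [lia|]. rewrite IH by lia. apply plus_zero_l.
Qed.

Lemma cap_coef_represents {B : BanachPair} (L : list (Z * cap B)) (s : R) :
  represents (fun n => exp (s * IZR n)) (cap_coef L)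
    (leval (V := sumsp_NormedModule B) cap_in_sum L (RtoC (exp s))).
Proof.
  pose proof (is_sumZ_linear (in_sum false) _ _ (is_linear_in_sum B false)
    (is_sumZ_lcoef (V := B false) (fun x : cap B => x false) L s)) as h.
  rewrite (leval_linear _ _ _ _ (is_linear_in_sum B false)) in h.
  eapply is_sumZ_ext; [|exact h]. intros n. cbv beta.
  rewrite (linear_scal _ (is_linear_in_sum B false)). f_equal.
  unfold cap_in_sum. now rewrite cap_coef_at.
Qed.

Lemma in_sum_leval {B : BanachPair} (L : list (Z * cap B)) (j : bool) (z : C) :
  in_sum j (leval (V := B j) (fun x : cap B => x j) L z) =
  leval (V := sumsp_NormedModule B) cap_in_sum L z.
Proof.
  rewrite (leval_linear (V := sumsp_NormedModule B) _ _ _ _ (is_linear_in_sum B j)).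
  unfold leval. f_equal. extensionality mv.
  now rewrite in_sum_cap.
Qed.

Lemma annulus_neq_0 (z : C) : annulus z -> z <> 0.
Proof. intros [h _]. apply Cmod_gt_0. lra. Qed.

Lemma annulus_circle_neq_0 (j : bool) (z : C) : annulus_circle j z -> z <> 0.
Proof. intros h. apply Cmod_gt_0. rewrite h. apply exp_pos. Qed.

Definition laurent_annulus_fun {B : BanachPair} (L : list (Z * cap B)) : annulus_fun B :=
  {| ann_fun := leval (V := sumsp_NormedModule B) cap_in_sum L;
     ann_trace := fun j => leval (V := B j) (fun x : cap B => x j) L;
     ann_continuous := proj2 (continuous_on_cont_at (V := sumsp_NormedModule B) annulus _)
       (fun z hz => leval_cont_at (V := sumsp_NormedModule B) _ L annulus z (annulus_neq_0 z hz));
     ann_analytic := fun z hz => leval_analytic (V := sumsp_NormedModule B) _ L z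
       (annulus_neq_0 z (conj (Rlt_le _ _ (proj1 hz)) (Rlt_le _ _ (proj2 hz))));
     ann_trace_eq := fun j z _ => eq_sym (in_sum_leval L j z);
     ann_trace_continuous := fun j => proj2 (continuous_on_cont_at (V := B j) (annulus_circle j) _)
       (fun z hz => leval_cont_at (V := B j) _ L (annulus_circle j) z (annulus_circle_neq_0 j z hz)) |}.

Definition laurent_list {B : BanachPair} (b : Z -> cap B) (N : Z) : list (Z * cap B) :=
  map (fun k => ((Z.of_nat k - N)%Z, b (Z.of_nat k - N)%Z)) (List.seq 0 (Z.to_nat (2 * N + 1))).

Lemma laurent_list_coef {B : BanachPair} (b : Z -> cap B) (N : Z) (j : bool) :
  (forall n, (N < Z.abs n)%Z -> forall j, b n j = zero) ->
  forall n, lcoef (V := B j) (fun x : cap B => x j) (laurent_list b N) n = b n j.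
Proof.
  intros hN n. unfold lcoef, laurent_list. rewrite iter_map. cbn [fst snd].
  transitivity (iter plus (zero : B j) (seq 0 (Z.to_nat (2 * N + 1)))
    (fun k => if Z.eq_dec (Z.of_nat k - N) n then b n j else zero)).
  { f_equal. extensionality k.
    now destruct (Z.eq_dec (Z.of_nat k - N) n) as [->|]. }
  destruct (Z_lt_dec N (Z.abs n)) as [h|h].
  - rewrite (hN n h). generalize (seq 0 (Z.to_nat (2 * N + 1))) as F.
    induction F as [|k F IH]; [reflexivity|]. cbn [iter]. rewrite IH.
    destruct (Z.eq_dec (Z.of_nat k - N) n); apply plus_zero_l.
  - transitivity (iter plus (zero : B j) (seq 0 (Z.to_nat (2 * N + 1)))
      (fun k => if Nat.eq_dec k (Z.to_nat (n + N)) then b n j else zero)).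
    { f_equal. extensionality k.
      destruct (Z.eq_dec (Z.of_nat k - N) n), (Nat.eq_dec k (Z.to_nat (n + N))); trivial; lia. }
    rewrite (iter_delta plus (zero : B j) _ (Z.to_nat (n + N)) (b n j)
      (fun k => Nat.eq_dec k (Z.to_nat (n + N)))).
    + destruct (excluded_middle_informative _) as [_|hn]; trivial.
      destruct hn. apply in_seq. lia.
    + apply plus_zero_l.
    + apply plus_zero_r.
    + apply seq_NoDup.
Qed.

(** The easy inequality: finitely many coefficients define a Laurent polynomial, which is an
    admissible function, and its boundary suprema are the FC norms. *)
Lemma annulus_norm_le_laurent (B : BanachPair) (theta : R) (x : cap B) (b : Z -> cap B) :
  finitely_supported b ->
  represents (fun n => exp (theta * IZR n)) b (cap_in_sum x) ->
  exists f : annulus_fun B, ann_fun B f (RtoC (exp theta)) = cap_in_sum x /\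
    Rbar_le (annulus_fun_norm B f)
      (max_j (fun j => FC_norm (weighted (fun n => exp (idx j * IZR n)) b j))).
Proof.
  intros [N hN] hrep. set (L := laurent_list b N).
  pose proof (fun j => laurent_list_coef b N j hN) as hc.
  exists (laurent_annulus_fun L). split.
  - apply (is_sumZ_unique (V := sumsp_NormedModule B) _ _ _ (cap_coef_represents L theta)).
    eapply is_sumZ_ext; [|exact hrep]. intros n. cbv beta. f_equal.
    apply sumsp_eq. simpl. f_equal. rewrite cap_coef_at. symmetry. apply hc.
  - apply Rbar_lub_le. intros r [j [t [_ ->]]].
    refine (Rbar_le_trans _ _ _ _ (max_j_ub
      (fun j => FC_norm (weighted (fun n => exp (idx j * IZR n)) b j)) j)).
    rewrite (FC_norm_leval (B j) (fun x : cap B => x j) L (idx j)).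
    + apply Rbar_lub_ub. now exists t.
    + intros n. exact (f_equal (scal (RtoC (exp (idx j * IZR n)))) (eq_sym (hc j n))).
Qed.

(** * The annulus method *)

Lemma cont_at_local {V : NormedModule C_AbsRing} (D : C -> Prop) (f g : C -> V) (z : C) (d : R) :
  0 < d -> (forall w, Cmod (w - z)%C < d -> f w = g w) -> cont_at D f z -> cont_at D g z.
Proof.
  intros hd h hf eps he. destruct (hf eps he) as [d' [hd' h']].
  exists (Rmin d d'). split; [now apply Rmin_pos|]. intros w hD hw.
  Rmin_bounds d d'.
  rewrite <- (h w), <- (h z).
  - apply h'; [trivial|lra].
  - replace (z - z)%C with (RtoC 0) by ring. now rewrite Cmod_0.
  - lra.
Qed.

Lemma cdiff_local {V : NormedModule C_AbsRing} (f g : C -> V) (z : C) (d : R) :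
  0 < d -> (forall w, Cmod (w - z)%C < d -> f w = g w) -> cdiff f z -> cdiff g z.
Proof.
  intros hd h [phi [hphi [d' [hd' h']]]]. exists phi. split; trivial.
  exists (Rmin d d'). split; [now apply Rmin_pos|]. intros w hw.
  Rmin_bounds d d'.
  rewrite <- (h w), <- (h z).
  - apply h'. lra.
  - replace (z - z)%C with (RtoC 0) by ring. now rewrite Cmod_0.
  - lra.
Qed.

Section Quotient.

Variables (B : BanachPair) (theta : R) (x : cap B) (f : annulus_fun B).
Hypothesis htheta : 0 < theta < 1.
Hypothesis hfx : ann_fun B f (RtoC (exp theta)) = cap_in_sum x.

Let c : C := RtoC (exp theta).

Lemma Cmod_center : Cmod c = exp theta.
Proof. unfold c. rewrite <- polar_0_r. apply Cmod_polar. Qed.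

Lemma polar_neq_center (j : bool) (t : R) : (polar (idx j) t - c)%C <> 0.
Proof.
  intros h. assert (e : polar (idx j) t = c).
  { replace (polar (idx j) t) with ((polar (idx j) t - c) + c)%C by ring. rewrite h. ring. }
  apply (f_equal Cmod) in e. rewrite Cmod_polar, Cmod_center in e.
  apply exp_inv in e. unfold idx in e. destruct j; lra.
Qed.

(** The quotient g = (f - x)/(z - c) on the circle of radius e^j, pulled back to the unit circle. It
    has values in B_j because x lies in both spaces. *)
Definition quotient_trace (j : bool) (w : C) : B j :=
  scal (/ (RtoC (exp (idx j)) * w - c))%C
    (minus (ann_trace B f j (RtoC (exp (idx j)) * w)%C) (x j)).

Lemma quotient_trace_cont (j : bool) : cont_circle (B j) (quotient_trace j).
Proof.
  intros z hz. destruct (circle_cis z hz) as [t ->].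
  assert (hcirc : forall w, circle w -> annulus_circle j (RtoC (exp (idx j)) * w)%C).
  { intros w hw. unfold annulus_circle. rewrite Cmod_mult, hw, Cmod_R, Rabs_right; [ring|].
    left; apply exp_pos. }
  apply (cont_at_scal (V := B j) circle (fun w => / (RtoC (exp (idx j)) * w - c))%C).
  - apply (cont_at_inv circle (fun w => RtoC (exp (idx j)) * w - c)%C).
    + apply polar_neq_center.
    + apply (cont_at_plus (V := CC) circle (fun w => RtoC (exp (idx j)) * w)%C (fun _ => - c)%C).
      * apply (cont_at_scal (V := CC) circle (fun _ => RtoC (exp (idx j))) (fun w => w)).
        -- exact (cont_at_const (V := CC) _ (RtoC (exp (idx j))) _).
        -- apply cont_at_id.
      * exact (cont_at_const (V := CC) _ (- c)%C _).
  - apply (cont_at_plus (V := B j) circle _ (fun _ => opp (x j))).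
    + apply (cont_at_comp_mul (annulus_circle j) circle (ann_trace B f j)); trivial.
      apply (proj1 (continuous_on_cont_at (V := B j) (annulus_circle j) _)
        (ann_trace_continuous B f j)). apply hcirc, hz.
    + apply (cont_at_const (V := B j)).
Qed.

(* Cauchy's theorem for z^(-n) (f(z) - x) / (z - c), whose singularity at c is
   removable: its means over the two boundary circles agree. *)
Lemma quotient_fourier_agree (n : Z) :
  in_sum false (scal (RtoC (exp (- idx false * IZR n))) (fourier_coef (quotient_trace false) n)) =
  in_sum true (scal (RtoC (exp (- idx true * IZR n))) (fourier_coef (quotient_trace true) n)).
Proof.
  (* Inside the annulus f has values only in the sum, so the integrals are taken there, in its
     complete version. *)
  set (S := sumsp_CompleteNormedModule B).
  assert (hana : analytic (V := S) (ann_fun B f) c).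
  { apply (ann_analytic B f c). rewrite Cmod_center. rewrite <- exp_0 at 1.
    split; apply exp_increasing; lra. }
  (* [a1] fills the singularity at c. As f(c) = x, the completed quotient agrees on the boundary
     circles with [quotient_trace]. *)
  destruct (analytic_quotient (V := S) _ _ hana) as [a1 ha1].
  set (G := fun w => if Ceq_dec w c then a1 else
    scal (/ (w - c))%C (minus (ann_fun B f w) (ann_fun B f c)) : S) in ha1.
  set (F := fun w => scal (zpow w (- n)) (G w) : S).
  (* Away from c the completed quotient is locally the plain one, so continuity and
     differentiability reduce to those of f. *)
  assert (hfar : forall z, z <> c -> exists d, 0 < d /\ forall w, Cmod (w - z)%C < d ->
    scal (/ (w - c))%C (minus (ann_fun B f w) (ann_fun B f c)) = G w).
  { intros z hz. exists (Cmod (z - c)%C).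
    assert (hzc : (z - c)%C <> 0).
    { intros h. apply hz. replace z with ((z - c) + c)%C by ring. rewrite h. ring. }
    split; [now apply Cmod_gt_0|]. intros w hw. unfold G.
    destruct (Ceq_dec w c) as [->|]; [|trivial].
    replace (c - z)%C with (- (z - c))%C in hw by ring. rewrite Cmod_opp in hw. lra. }
  assert (hminus : forall z, z <> c -> (z - c)%C <> 0).
  { intros z hz h. apply hz. replace z with ((z - c) + c)%C by ring. rewrite h. ring. }
  assert (hF1 : forall z, annulus z -> cont_at (V := S) annulus F z).
  { intros z hz. apply (cont_at_scal (V := S) annulus (fun w => zpow w (- n))).
    - now apply cont_at_zpow, annulus_neq_0.
    - destruct (Ceq_dec z c) as [->|hzc].
      + apply (cont_at_sub (V := S) (fun _ => True)); trivial. exact (cdiff_cont_at (V := S) G c ha1).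
      + destruct (hfar z hzc) as [d [hd h]]. apply (cont_at_local (V := S) annulus _ G z d hd h).
        apply (cont_at_scal (V := S) annulus (fun w => / (w - c))%C).
        * apply (cont_at_inv annulus (fun w => w - c)%C); [now apply hminus|].
          apply (cont_at_plus (V := CC) annulus (fun w => w) (fun _ => - c)%C).
          -- apply cont_at_id.
          -- exact (cont_at_const (V := CC) _ (- c)%C _).
        * apply (cont_at_plus (V := S) annulus (ann_fun B f) (fun _ => opp (ann_fun B f c))).
          -- apply (proj1 (continuous_on_cont_at (V := S) annulus _) (ann_continuous B f) z hz).
          -- apply (cont_at_const (V := S)). }
  assert (hF2 : forall z, 1 < Cmod z < exp 1 -> cdiff (V := S) F z).
  { intros z hz.
    assert (hz0 : z <> 0) by (apply Cmod_gt_0; lra).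
    apply (cdiff_scal (V := S) (fun w => zpow w (- n))).
    - now apply cdiff_zpow.
    - destruct (Ceq_dec z c) as [->|hzc]; [exact ha1|].
      destruct (hfar z hzc) as [d [hd h]]. apply (cdiff_local (V := S) _ G z d hd h).
      apply (cdiff_scal (V := S) (fun w => / (w - c))%C).
      + apply (cdiff_inv (fun w => w - c)%C); [now apply hminus|].
        apply (cdiff_plus (V := CC) (fun w => w) (fun _ => - c)%C).
        * apply cdiff_id.
        * exact (cdiff_const (V := CC) (- c)%C z).
      + apply (cdiff_plus (V := S) (ann_fun B f) (fun _ => opp (ann_fun B f c))).
        * apply (analytic_cdiff (V := S)). exact (ann_analytic B f z hz).
        * apply (cdiff_const (V := S)). }
  pose proof (cauchy_annulus S F hF1 hF2) as hC.
  (* On |z| = e^j one has z^(-n) = e^(-jn) e^(-int), so the integral of F is 2 pi times the image of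
     the rescaled Fourier coefficient computed in B_j. *)
  assert (hint : forall j, RInt (V := restr_R S) (fun t => F (polar (idx j) t)) 0 (2 * PI) =
    scal (RtoC (2 * PI)) (in_sum j (scal (RtoC (exp (- idx j * IZR n)))
      (fourier_coef (quotient_trace j) n)) : S)).
  { intros j. apply (is_RInt_unique (V := restr_R S)).
    pose proof (RInt_correct (V := restr_R (B j)) _ _ _
      (fourier_ex_RInt (B j) _ n (quotient_trace_cont j))) as hI.
    assert (hlin : is_linear (U := restr_R (B j)) (V := restr_R S)
      (fun v => in_sum j (scal (RtoC (exp (- idx j * IZR n))) v))).
    { pose proof (is_linear_in_sum B j) as hl.
      assert (hl' : is_linear (U := restr_R (B j)) (V := restr_R S) (in_sum j)).
      { destruct hl as [h1 h2 h3]. apply Build_is_linear.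
        - exact h1.
        - intros k v. exact (h2 (RtoC k) v).
        - exact h3. }
      exact (is_linear_comp _ _ (is_linear_restr_scal (B j) (RtoC (exp (- idx j * IZR n)))) hl'). }
    apply (is_RInt_linear (V := restr_R S) _ _ _ _ _ hlin) in hI.
    eapply (is_RInt_eq (V := restr_R S)); cycle 1.
    - eapply is_RInt_ext; [|exact hI]. intros t _. cbv beta.
      change (in_sum j (scal (RtoC (exp (- idx j * IZR n)))
        (scal (cis (- (IZR n * t))) (quotient_trace j (cis t)))) = F (polar (idx j) t)).
      unfold F, G. destruct (Ceq_dec (polar (idx j) t) c) as [h|_].
      { destruct (polar_neq_center j t). rewrite h. ring. }
      unfold quotient_trace.
      change (RtoC (exp (idx j)) * cis t)%C with (polar (idx j) t).
      rewrite zpow_polar, opp_IZR.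
      assert (hann : ann_fun B f (polar (idx j) t) = in_sum j (ann_trace B f j (polar (idx j) t))).
      { apply (ann_trace_eq B f). unfold annulus_circle. apply Cmod_polar. }
      assert (hc0 : ann_fun B f c = in_sum j (x j)) by (rewrite in_sum_cap; exact hfx).
      rewrite hann, hc0.
      set (T := ann_trace B f j (polar (idx j) t)). unfold polar.
      replace (- IZR n * idx j) with (- idx j * IZR n) by ring.
      replace (- IZR n * t) with (- (IZR n * t)) by ring.
      set (k := (/ (RtoC (exp (idx j)) * cis t - c))%C).
      rewrite !(linear_scal _ (is_linear_in_sum B j)), (linear_minus _ _ _ (is_linear_in_sum B j)).
      lin_C (sumsp_ModuleSpace B).
    - assert (hgen : forall v : B j, in_sum j (scal (RtoC (exp (- idx j * IZR n))) v) =
        scal (RtoC (2 * PI)) (in_sum j (scal (RtoC (exp (- idx j * IZR n)))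
          (scal (RtoC (/ (2 * PI))) v)))).
      { intros v. rewrite <- (linear_scal _ (is_linear_in_sum B j)). f_equal.
        rewrite <- (two_PI_scal (B j) v) at 1. lin_C (B j). }
      exact (hgen _). }
  pose proof (hint false) as h0. pose proof (hint true) as h1. simpl idx in h0, h1.
  rewrite h0, h1 in hC.
  set (u := in_sum false _) in hC. set (v := in_sum true _) in hC.
  change (u = v). clearbody u v.
  assert (hinv : forall y : S, scal (RtoC (/ (2 * PI))) (scal (RtoC (2 * PI)) y) = y).
  { intros y. rewrite <- (two_PI_scal S y) at 2. lin_C S. }
  rewrite <- (hinv u), <- (hinv v). f_equal. exact hC.
Qed.

End Quotient.

(* [(z - a) p(z) + x] for the Laurent polynomial [p] with monomials [P]. *)
Definition times_center {B : BanachPair} (x : cap B) (a : C) (P : list (Z * cap B)) : list (Z * cap B) :=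
  (0%Z, x) :: map (fun mv => ((fst mv + 1)%Z, snd mv)) P
    ++ map (fun mv => (fst mv, cap_scal (- a)%C (snd mv))) P.

Lemma leval_times_center {B : BanachPair} {V : NormedModule C_AbsRing} (v : cap B -> V)
  (x : cap B) (a : C) (P : list (Z * cap B)) (s t : R) :
  (forall k y, v (cap_scal k y) = scal k (v y)) ->
  leval v (times_center x a P) (polar s t) =
  plus (v x) (scal (polar s t - a)%C (leval v P (polar s t))).
Proof.
  intros hv. unfold leval, times_center. cbn [iter fst snd].
  rewrite iter_app, !iter_map; [|apply plus_zero_l|apply plus_assoc]. cbn [fst snd].
  set (z := polar s t).
  assert (e1 : iter plus zero P (fun n => scal (zpow z (fst n + 1)) (v (snd n))) =
    scal z (iter plus zero P (fun n => scal (zpow z (fst n)) (v (snd n))))).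
  { symmetry. etransitivity; [apply (iter_morph plus zero plus zero (fun y : V => scal z y))|].
    - apply (scal_zero_r (V := V)).
    - intros; apply (scal_distr_l (V := V)).
    - f_equal. extensionality mv.
      unfold z. rewrite !zpow_polar, plus_IZR.
      replace ((IZR (fst mv) + 1) * s) with (s + IZR (fst mv) * s) by ring.
      replace ((IZR (fst mv) + 1) * t) with (t + IZR (fst mv) * t) by ring.
      rewrite polar_plus. lin_C V. }
  assert (e2 : iter plus zero P (fun n => scal (zpow z (fst n)) (v (cap_scal (- a)%C (snd n)))) =
    scal (- a)%C (iter plus zero P (fun n => scal (zpow z (fst n)) (v (snd n))))).
  { symmetry. etransitivity; [apply (iter_morph plus zero plus zero (fun y : V => scal (- a)%C y))|].
    - apply (scal_zero_r (V := V)).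
    - intros; apply (scal_distr_l (V := V)).
    - f_equal. extensionality mv.
      rewrite hv. lin_C V. }
  rewrite e1, e2. simpl zpow.
  set (y := iter plus zero P _). lin_C V.
Qed.

(** With g = (f - x)/(z - c), the polynomial x + (z - c) sigma_N(g) differs from f by (z -
    c)(sigma_N(g) - g), which is small on both circles by Fejer's theorem. *)
Lemma laurent_approx (B : BanachPair) (theta : R) (x : cap B) (f : annulus_fun B) (eps : R) :
  0 < theta < 1 -> ann_fun B f (RtoC (exp theta)) = cap_in_sum x -> 0 < eps ->
  exists L : list (Z * cap B),
    leval (V := sumsp_NormedModule B) cap_in_sum L (RtoC (exp theta)) = cap_in_sum x /\
    forall j t, norm (minus (leval (V := B j) (fun y : cap B => y j) L (polar (idx j) t))
      (ann_trace B f j (polar (idx j) t))) <= eps.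
Proof.
  intros ht hfx he. set (c := RtoC (exp theta)).
  set (g := quotient_trace B theta x f).
  (* The Laurent coefficients of g, placed in the intersection by the agreement of the two circle
     means. *)
  set (beta := fun n => mk_cap _ _ (quotient_fourier_agree B theta x f ht hfx n)).
  assert (hbeta : forall n j, beta n j =
    scal (RtoC (exp (- idx j * IZR n))) (fourier_coef (g j) n)) by (intros n [|]; reflexivity).
  pose proof (exp_pos 1) as hep.
  (* The denominator is the bound 2e for |z - c| on the annulus. *)
  assert (he' : 0 < eps / (2 * exp 1)) by (apply Rdiv_lt_0_compat; lra).
  pose proof (fun j => fejer (B j) (g j) _ (quotient_trace_cont B theta x f ht j) he') as hfej.
  destruct (hfej false) as [N0 h0]. destruct (hfej true) as [N1 h1].
  set (N := (N0 + N1)%nat).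
  assert (hN : forall j t, norm (minus (fejer_sum (B j) (g j) N t) (g j (cis t))) <= eps / (2 * exp 1)).
  { intros [|] t; [apply h1|apply h0]; unfold N; lia. }
  set (P := map (fun kl => (index_diff kl, cap_scal (RtoC (/ INR (S N))) (beta (index_diff kl))))
    (square_indices N)).
  assert (hP : forall j t, leval (V := B j) (fun y : cap B => y j) P (polar (idx j) t) =
    fejer_sum (B j) (g j) N t).
  { intros j t. unfold leval, P, fejer_sum. rewrite iter_map. cbn [fst snd].
    symmetry. etransitivity; [apply (iter_morph plus zero plus zero
      (fun y : B j => scal (RtoC (/ INR (S N))) y))|].
    - apply (scal_zero_r (V := B j)).
    - intros; apply (scal_distr_l (V := B j)).
    - f_equal. extensionality kl.
      cbn [cap_at cap_scal]. rewrite hbeta, zpow_polar. unfold polar.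
      set (m := index_diff kl).
      assert (e : (RtoC (exp (IZR m * idx j)) * RtoC (exp (- idx j * IZR m)))%C = 1).
      { rewrite <- RtoC_mult, <- exp_plus.
        replace (IZR m * idx j + - idx j * IZR m) with 0 by ring. now rewrite exp_0. }
      transitivity (scal ((RtoC (exp (IZR m * idx j)) * RtoC (exp (- idx j * IZR m))) *
        (cis (IZR m * t) * RtoC (/ INR (S N))))%C (fourier_coef (g j) m)).
      + rewrite e. lin_C (B j).
      + lin_C (B j). }
  exists (times_center x c P). split.
  - unfold c. rewrite <- polar_0_r, (leval_times_center (V := sumsp_NormedModule B)).
    (* At z = c the factor z - c vanishes, so the value is exactly x. *)
    + rewrite polar_0_r. fold c. set (y := leval _ _ _). lin_C (sumsp_ModuleSpace B).
    + intros; apply cap_in_sum_scal.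
  - intros j t. rewrite (leval_times_center (V := B j)) by reflexivity. rewrite hP.
    set (z := polar (idx j) t). set (T := ann_trace B f j z).
    assert (hz : (z - c)%C <> 0) by (apply (polar_neq_center theta ht)).
    assert (hg : g j (cis t) = scal (/ (z - c))%C (minus T (x j))) by reflexivity.
    assert (hT : T = plus (x j) (scal (z - c)%C (g j (cis t)))).
    { rewrite hg. lin_C (B j); field; trivial. }
    apply (norm_eq_le (V := B j) _
      (scal (z - c)%C (minus (fejer_sum (B j) (g j) N t) (g j (cis t))))).
    { rewrite hT. lin_C (B j). }
    rewrite (norm_scal_C (V := B j)).
    assert (hzc : Cmod (z - c)%C <= 2 * exp 1).
    { unfold Cminus. eapply Rle_trans; [apply Cmod_triangle|]. rewrite Cmod_opp.
      assert (hzm : Cmod z <= exp 1).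
      { unfold z. rewrite Cmod_polar. destruct j; simpl; [lra|]. left; apply exp_increasing; lra. }
      assert (hcm : Cmod c <= exp 1).
      { unfold c. rewrite Cmod_center by trivial. left; apply exp_increasing; lra. }
      lra. }
    apply Rle_trans with (2 * exp 1 * (eps / (2 * exp 1))).
    + apply Rmult_le_compat; trivial; [apply Cmod_ge_0|apply norm_ge_0].
    + right. field. lra.
Qed.

Lemma annulus_norm_finite_support (B : BanachPair) (theta : R) (x : cap B) :
  0 < theta < 1 ->
  annulus_norm theta (cap_in_sum x) =
    Rbar_glb (fun r => exists b : Z -> cap B,
      finitely_supported b /\
      represents (fun n => exp (theta * IZR n)) b (cap_in_sum x) /\
      r = max_j (fun j => FC_norm (weighted (fun n => exp (idx j * IZR n)) b j))).
Proof.
  intros ht. pose proof PI_RGT_0 as hpi. apply Rbar_glb_eq_approx.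
  - intros r [b [hfin [hrep ->]]].
    destruct (annulus_norm_le_laurent B theta x b hfin hrep) as [f [hf hle]].
    eexists. split; [exists f; split; [exact hf|reflexivity]|exact hle].
  - intros r [f [_ ->]] hm.
    (* A single boundary value, here at z = e, keeps the supremum away from -infinity. *)
    assert (h : Rbar_le (Finite (norm (ann_trace B f true (RtoC (exp (idx true)) * cis 0)%C)))
      (annulus_fun_norm B f)).
    { apply Rbar_lub_ub. exists true, 0. split; [lra|reflexivity]. }
    rewrite hm in h. exact h.
  - intros r [f [hf hr]] eps he.
    destruct (laurent_approx B theta x f eps ht hf he) as [L [hL1 hL2]].
    eexists. split.
    { exists (cap_coef L). split; [apply cap_coef_support|]. split; [|reflexivity].
      rewrite <- hL1. apply cap_coef_represents. }
    apply max_j_le. intros j.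
    rewrite (FC_norm_leval (B j) (fun y : cap B => y j) L (idx j)).
    2:{ intros n. unfold weighted. now rewrite cap_coef_at. }
    apply Rbar_lub_le. intros q [t ->]. simpl.
    (* The norm of [f] is a supremum over one period, while that of FC runs over all real angles. *)
    destruct (cis_reduce t) as [t' [ht' hcis]].
    assert (hp : polar (idx j) t = polar (idx j) t') by (unfold polar; now rewrite hcis).
    rewrite hp. specialize (hL2 j t').
    set (u := leval (V := B j) (fun y : cap B => y j) L (polar (idx j) t')) in *. set (T := ann_trace B f j (polar (idx j) t')) in *.
    assert (hT : norm T <= r).
    { assert (h : Rbar_le (Finite (norm T)) (annulus_fun_norm B f)).
      { apply Rbar_lub_ub. exists j, t'. split; [trivial|reflexivity]. }
      rewrite <- hr in h. exact h. }
    apply (norm_eq_le (V := B j) _ (plus T (minus u T))); [lin_C (B j)|].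
    eapply Rle_trans; [apply (norm_plus_le (V := B j))|]. lra.
Qed.

Theorem mainTheorem2 :
  forall (B : BanachPair) (theta : R) (x : cap B),
  0 < theta < 1 ->
  annulus_norm theta (cap_in_sum x) =
    Rbar_glb (fun r => exists b : Z -> cap B,
      finitely_supported b /\
      represents (fun n => exp (theta * IZR n)) b (cap_in_sum x) /\
      r = max_j (fun j => FC_norm (weighted (fun n => exp (idx j * IZR n)) b j)))
  /\
  (forall p : R, 1 <= p ->
    real_norm theta p (cap_in_sum x) =
      Rbar_glb (fun r => exists c : Z -> cap B,
        finitely_supported c /\
        represents (fun _ => 1) c (cap_in_sum x) /\
        r = max_j (fun j =>
              lpV_norm p (weighted (fun n => exp ((idx j - theta) * IZR n)) c j)))
    /\
    J_norm (exp 1) theta p (cap_in_sum x) =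
      Rbar_glb (fun r => exists c : Z -> cap B,
        finitely_supported c /\
        represents (fun _ => 1) c (cap_in_sum x) /\
        r = lp_norm p (fun n => exp (- theta * IZR n) * Jfun (exp (IZR n)) (c n)))
    /\
    J_norm 2 theta p (cap_in_sum x) =
      Rbar_glb (fun r => exists c : Z -> cap B,
        finitely_supported c /\
        represents (fun _ => 1) c (cap_in_sum x) /\
        r = lp_norm p (fun n =>
              Rpower 2 (- theta * IZR n) * Jfun (Rpower 2 (IZR n)) (c n))))
  /\
  peetre_norm theta (cap_in_sum x) =
    Rbar_glb (fun r => exists c : Z -> cap B,
      finitely_supported c /\
      represents (fun _ => 1) c (cap_in_sum x) /\
      r = max_j (fun j =>
            UC_norm (weighted (fun n => Rpower 2 ((idx j - theta) * IZR n)) c j)))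
  /\
  (forall j : bool,
    isometry_on (V := B j) in_FC FC_norm shiftZ /\
    (forall p : R, 1 <= p -> isometry_on (V := B j) (in_lpV p) (lpV_norm p) shiftZ) /\
    isometry_on (V := B j) in_UC UC_norm shiftZ).
Proof.
  intros B theta x ht.
  split; [now apply annulus_norm_finite_support|]. split; [|split].
  - intros p hp. split; [now apply real_norm_finite_support|].
    assert (hexp : forall y, Rpower (exp 1) y = exp y).
    { intros y. unfold Rpower. now rewrite ln_exp, Rmult_1_r. }
    split; [|apply J_norm_finite_support; lra].
    rewrite (J_norm_finite_support B theta (exp 1) p x ht) by
      (trivial; rewrite <- exp_0 at 1; apply exp_increasing; lra).
    apply Rbar_glb_rw. intros r.
    split; intros [c [h1 [h2 ->]]]; exists c; split; trivial; split; trivial;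
      apply lp_norm_ext; intros n; now rewrite !hexp.
  - now apply peetre_norm_finite_support.
  - intros j. split; [apply FC_shift_isometry|]. split; [intros p hp; apply lpV_shift_isometry|].
    apply UC_shift_isometry.
Qed.
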